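(* Assume that (A1), (A2) and (A4) (see context) hold, and let $P_0,\bar P$ be fixed. Problem (P3) admits a solution $$\breve u_i=-R^{-1}B^T(Kx_i+\bar Kx^{(N)}+K_0x_0)-R^{-1}L(P_0x_0+\bar Px^{(N)}),\quad i=1,\dots,N,$$ where $K,\bar K,K_0$ (together with $\Lambda_0,\bar\Lambda$) are determined on $[0,T]$ by $$ \begin{aligned} &\dot K+A^TK+KA-KBR^{-1}B^TK+Q=0,\quad K(T)=H,\\ &\dot{\bar K}+(A+G+\bar B_1\bar P)^T\bar K+\bar K(A+G+\bar B_1\bar P)-KBR^{-1}B^T\bar K-\bar KBR^{-1}B^TK-\bar KBR^{-1}B^T\bar K\\ &\quad+(G+\bar B_1\bar P)^TK+K(G+\bar B_1\bar P)+K_0(G_0+B_0\bar P)+(G_0+B_0\bar P)^T\bar\Lambda+\bar P^TR_1\bar P-Q_\Gamma\\ &\quad-\bar P^TL^TR^{-1}L\bar P=0,\quad\bar K(T)=-H_{\bar\Gamma},\\ &\dot K_0+(A+G+\bar B_1\bar P)^TK_0+K_0(A_0+B_0P_0)-(K+\bar K)BR^{-1}B^TK_0+(G_0+B_0\bar P)^T\Lambda_0\\ &\quad+(K+\bar K)(F+\bar B_1P_0)-Q_{\Gamma_1}+\bar P^TR_1P_0-\bar P^TL^TR^{-1}LP_0=0,\quad K_0(T)=-H_{\bar\Gamma_1},\\ &\dot\Lambda_0+\Lambda_0(A_0+B_0P_0)+(A_0+B_0P_0)^T\Lambda_0-\bar\Lambda BR^{-1}B^TK_0+\bar\Lambda(F+\bar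 B_1P_0)+(F+\bar B_1P_0)^TK_0\\ &\quad+P_0^TR_1P_0+\Gamma_1^TQ\Gamma_1-P_0^TL^TR^{-1}LP_0=0,\quad\Lambda_0(T)=\bar\Gamma_1^TH\bar\Gamma_1,\\ &\dot{\bar\Lambda}+\bar\Lambda(A+G+\bar B_1\bar P)+(A_0+B_0P_0)^T\bar\Lambda-\bar\Lambda BR^{-1}B^T(K+\bar K)+\Lambda_0(G_0+B_0\bar P)\\ &\quad+(F+\bar B_1P_0)^T(K+\bar K)-Q_{\Gamma_1}^T+P_0^TR_1\bar P-P_0^TL^TR^{-1}L\bar P=0,\quad\bar\Lambda(T)=-H_{\bar\Gamma_1}^T. \end{aligned} $$
   Context: Fix $T>0$. The leader $\mathcal A_0$ and followers $\mathcal A_i$, $1\le i\le N$, have states $x_0,x_i\in\mathbb R^n$, controls $u_0,u_i\in\mathbb R^m$ and dynamics $$dx_0=[A_0x_0+B_0u_0+G_0x^{(N)}]dt+D_0dW_0,\quad dx_i=[Ax_i+Bu_i+Gx^{(N)}+Fx_0+B_1u_0]dt+DdW_i,$$ $x_0(0)=\xi_0$, $x_i(0)=\xi_i$, $x^{(N)}=\frac1N\sum_{i=1}^Nx_i$, with $d$-dimensional standard Brownian motions $W_0,\dots,W_N$ and constant coefficient matrices of proper dimensions. $\|z\|_S^2=z^TSz$. (A1) $\xi_0,\dots,\xi_N$ are independent, $\mathbb E\xi_i=\bar\xi$ for $1\le i\le N$, they have finite second moments with $\sup_{1\le i\le N}\mathbb E\|\xi_i\|^2\le c_0$, and $\{\xi_i\}$,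 $W_0,\dots,W_N$ are mutually independent. (A2) $Q_0\ge0$, $H_0\ge0$, $R_0>0$ (weights of the leader's cost, not used here) and $Q\ge0$, $H\ge0$, $R>0$. (A4) $R-LR_1^{-1}L^T\ge0$, where $R_1$ is symmetric positive definite. $\mathcal F_t=\sigma(\xi_0,\xi_i,W_0(s),W_i(s),s\le t,1\le i\le N)$; $\mathcal U_c$ is the set of $(u_1,\dots,u_N)$ with each $u_i$ an $\mathcal F_t$-adapted $\mathbb R^m$-valued process with $\mathbb E\int_0^T\|u_i\|^2dt<\infty$. The leader uses the feedback control $u_0=P_0x_0+\bar Px^{(N)}$ with fixed deterministic gains $P_0,\bar P\in L^2(0,T;\mathbb R^{m\times n})$. Problem (P3): minimize over $u\in\mathcal U_c$, with $u_0=P_0x_0+\bar Px^{(N)}$, $$ \begin{aligned} J_{\rm soc}^{(N)}(u)=&\sum_{i=1}^N\mathbb E\int_0^T\big\{\|x_i-\Gamma x^{(N)}-\Gamma_1x_0\|_Q^2+\|u_i\|_R^2+2u_i^TL(P_0x_0+\bar Px^{(N)})+\|P_0x_0+\bar Px^{(N)}\|_{R_1}^2\big\}dt\\ &+\sum_{i=1}^N\mathbb E\big[\|x_i(T)-\bar\Gamma x^{(N)}(T)-\bar\Gamma_1x_0(T)\|_H^2\big]. \end{aligned} $$ Notation: $\bar B_1=B_1-BR^{-1}L$, $Q_\Gamma=Q\Gamma+\Gamma^TQ-\Gamma^TQ\Gamma$, $Q_{\Gamma_1}=Q\Gamma_1-\Gamma^TQ\Gamma_1$, $H_{\bar\Gamma}=H\bar\Gamma+\bar\Gamma^TH-\bar\Gamma^TH\bar\Gamma$,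 $H_{\bar\Gamma_1}=H\bar\Gamma_1-\bar\Gamma^TH\bar\Gamma_1$. *)

(* Defs.v *)
From HB Require Import structures.
From mathcomp Require Import all_boot all_order all_algebra.
From mathcomp Require Import all_classical all_reals all_analysis.
Import Order.TTheory GRing.Theory Num.Theory.
Import numFieldNormedType.Exports.

Set Implicit Arguments.
Unset Strict Implicit.
Unset Printing Implicit Defensive.

Local Open Scope classical_set_scope.
Local Open Scope ring_scope.

Section Matrices.
Variable R : realType.

Definition wnorm p (S : 'M[R]_p) (z : 'cV[R]_p) : R := (z^T *m S *m z) 0 0.

Definition sqnorm p (z : 'cV[R]_p) : R := wnorm 1%:M z.

Definition psd p (S : 'M[R]_p) : Prop := S^T = S /\ forall z, 0 <= wnorm S z.

Definition posdef p (S : 'M[R]_p) : Prop :=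
  S^T = S /\ forall z, z != 0 -> 0 < wnorm S z.

Definition mx_integrable p q (D : set R) (g : R -> 'M[R]_(p, q)) : Prop :=
  forall i j,
    (@lebesgue_measure R).-integrable D (EFin \o (fun s => g s i j)).

Definition mx_integral p q (D : set R) (g : R -> 'M[R]_(p, q)) : 'M[R]_(p, q) :=
  \matrix_(i, j) \int[@lebesgue_measure R]_(s in D) g s i j.

Definition mx_L2 p q (T : R) (g : R -> 'M[R]_(p, q)) : Prop :=
  forall i j,
    measurable_fun `[0, T] (fun s => g s i j) /\
    (@lebesgue_measure R).-integrable `[0, T]
      (EFin \o (fun s => g s i j ^+ 2)).

(* X' + Phi = 0 on [0, T], X(T) = XT, in the sense of Caratheodory: since the
   gains P0 and Pbar are only square integrable, the coefficients of the matrix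
   equations are only integrable and the equations hold in integral form. *)
Definition terminal_ode p q (T : R) (X Phi : R -> 'M[R]_(p, q))
    (XT : 'M[R]_(p, q)) : Prop :=
  mx_integrable `[0, T] Phi /\
  forall t, t \in `[0, T] -> X t = XT + mx_integral `[t, T] Phi.

End Matrices.

(* Coefficients of the dynamics and weights of the costs (mR and mR0 are the
   control weights R and R_0). *)
Record model (R : realType) (n m d : nat) := Model {
  mA0 : 'M[R]_n; mB0 : 'M[R]_(n, m); mG0 : 'M[R]_n; mD0 : 'M[R]_(n, d);
  mA : 'M[R]_n; mB : 'M[R]_(n, m); mG : 'M[R]_n; mF : 'M[R]_n;
  mB1 : 'M[R]_(n, m); mD : 'M[R]_(n, d);
  mQ0 : 'M[R]_n; mH0 : 'M[R]_n; mR0 : 'M[R]_m;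
  mQ : 'M[R]_n; mH : 'M[R]_n; mR : 'M[R]_m;
  mL : 'M[R]_m; mR1 : 'M[R]_m;
  mGam : 'M[R]_n; mGam1 : 'M[R]_n; mGamb : 'M[R]_n; mGamb1 : 'M[R]_n
}.

Section Model.
Variables (R : realType) (n m d : nat) (c : model R n m d).

Local Notation A0 := (mA0 c).
Local Notation B0 := (mB0 c).
Local Notation G0 := (mG0 c).
Local Notation A := (mA c).
Local Notation B := (mB c).
Local Notation G := (mG c).
Local Notation F := (mF c).
Local Notation B1 := (mB1 c).
Local Notation Q := (mQ c).
Local Notation H := (mH c).
Local Notation Rw := (mR c).
Local Notation L := (mL c).
Local Notation R1 := (mR1 c).
Local Notation Gam := (mGam c).
Local Notation Gam1 := (mGam1 c).
Local Notation Gamb := (mGamb c).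
Local Notation Gamb1 := (mGamb1 c).

Definition assumptionA2 : Prop :=
  [/\ psd (mQ0 c), psd (mH0 c) & posdef (mR0 c)] /\
  [/\ psd Q, psd H & posdef Rw].

Definition assumptionA4 : Prop :=
  posdef R1 /\ psd (Rw - L *m invmx R1 *m L^T).

Definition B1bar : 'M[R]_(n, m) := B1 - B *m invmx Rw *m L.
Definition QGam : 'M[R]_n := Q *m Gam + Gam^T *m Q - Gam^T *m Q *m Gam.
Definition QGam1 : 'M[R]_n := Q *m Gam1 - Gam^T *m Q *m Gam1.
Definition HGamb : 'M[R]_n := H *m Gamb + Gamb^T *m H - Gamb^T *m H *m Gamb.
Definition HGamb1 : 'M[R]_n := H *m Gamb1 - Gamb^T *m H *m Gamb1.

Local Notation S := (B *m invmx Rw *m B^T).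
Local Notation V := (L^T *m invmx Rw *m L).

Definition riccati_system (T : R) (P0 Pb : R -> 'M[R]_(m, n))
    (K Kb K0 Lam0 Lamb : R -> 'M[R]_n) : Prop :=
  [/\ terminal_ode T K (fun t =>
        A^T *m K t + K t *m A - K t *m S *m K t + Q) H,
      terminal_ode T Kb (fun t =>
        (A + G + B1bar *m Pb t)^T *m Kb t + Kb t *m (A + G + B1bar *m Pb t)
        - K t *m S *m Kb t - Kb t *m S *m K t - Kb t *m S *m Kb t
        + (G + B1bar *m Pb t)^T *m K t + K t *m (G + B1bar *m Pb t)
        + K0 t *m (G0 + B0 *m Pb t) + (G0 + B0 *m Pb t)^T *m Lamb t
        + (Pb t)^T *m R1 *m Pb t - QGam - (Pb t)^T *m V *m Pb t) (- HGamb),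
      terminal_ode T K0 (fun t =>
        (A + G + B1bar *m Pb t)^T *m K0 t + K0 t *m (A0 + B0 *m P0 t)
        - (K t + Kb t) *m S *m K0 t + (G0 + B0 *m Pb t)^T *m Lam0 t
        + (K t + Kb t) *m (F + B1bar *m P0 t) - QGam1
        + (Pb t)^T *m R1 *m P0 t - (Pb t)^T *m V *m P0 t) (- HGamb1),
      terminal_ode T Lam0 (fun t =>
        Lam0 t *m (A0 + B0 *m P0 t) + (A0 + B0 *m P0 t)^T *m Lam0 t
        - Lamb t *m S *m K0 t + Lamb t *m (F + B1bar *m P0 t)
        + (F + B1bar *m P0 t)^T *m K0 t
        + (P0 t)^T *m R1 *m P0 t + Gam1^T *m Q *m Gam1
        - (P0 t)^T *m V *m P0 t) (Gamb1^T *m H *m Gamb1)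
    & terminal_ode T Lamb (fun t =>
        Lamb t *m (A + G + B1bar *m Pb t) + (A0 + B0 *m P0 t)^T *m Lamb t
        - Lamb t *m S *m (K t + Kb t) + Lam0 t *m (G0 + B0 *m Pb t)
        + (F + B1bar *m P0 t)^T *m (K t + Kb t) - QGam1^T
        + (P0 t)^T *m R1 *m Pb t - (P0 t)^T *m V *m Pb t) (- HGamb1^T)].

End Model.

Section Probability.
Variables (R : realType) (dOm : measure_display) (Om : measurableType dOm).
Variable P : probability Om R.

Definition vec_events p (X : Om -> 'cV[R]_p) : set (set Om) :=
  \bigcup_(k in [set: 'I_p])
    preimage_set_system setT (fun w => X w k 0) measurable.

Definition random_vector p (X : Om -> 'cV[R]_p) : Prop :=
  forall k, measurable_fun setT (fun w => X w k 0).

Definition mutual_indep (I : finType) (F : I -> set (set Om)) : Prop :=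
  forall (J : {set I}) (E : I -> set Om), (forall i, F i (E i)) ->
    P (\big[setI/setT]_(i in J) E i) = (\prod_(i in J) P (E i))%E.

Record brownian_motion d (T : R) (W : R -> Om -> 'cV[R]_d) : Prop := {
  bm_measurable : forall t, t \in `[0, T] -> random_vector (W t);
  bm_start : forall w, W 0 w = 0;
  bm_continuous : forall w, {within `[0, T], continuous (fun t => W t w)};
  bm_indep : forall s t, 0 <= s -> s < t -> t <= T ->
    mutual_indep (fun b : bool =>
      if b then <<s vec_events (fun w => W t w - W s w) >>
      else <<s \bigcup_(r in `[0, s]) vec_events (W r) >>);
  (* W(t) - W(s) has law N(0, (t - s) I_d) *)
  bm_normal : forall s t, 0 <= s -> s < t -> t <= T ->
    forall E : 'I_d -> set R, (forall k, measurable (E k)) ->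
    P (\big[setI/setT]_k [set w | E k ((W t w - W s w) k 0)]) =
    (\prod_k normal_prob 0%R (Num.sqrt (t - s)%R) (E k))%E
}.

(* A process indexed by [0, T], jointly measurable in (t, w). *)
Definition measurable_process p (T : R) (X : R -> Om -> 'cV[R]_p) : Prop :=
  forall k, measurable_fun ([set` `[0, T]] `*` [set: Om])
    (fun tw : measurableTypeR R * Om => X tw.1 tw.2 k 0).

End Probability.

(* Families indexed by [option 'I_N] have [None] for the leader and [Some i]
   for the follower i. *)
Section Problem.
Variables (R : realType) (dOm : measure_display) (Om : measurableType dOm).
Variable P : probability Om R.
Variables (n m d N : nat) (c : model R n m d) (T : R).
Variable xi : option 'I_N -> Om -> 'cV[R]_n.
Variable W : option 'I_N -> R -> Om -> 'cV[R]_d.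

Local Notation mu := (@lebesgue_measure R).

Definition assumptionA1 (xibar : 'cV[R]_n) (c0 : R) : Prop :=
  [/\ forall a, random_vector (xi a),
      mutual_indep P (fun a => <<s vec_events (xi a) >>),
      forall i k, ('E_P[fun w => xi (Some i) w k 0%R] = (xibar k 0%R)%:E)%E,
      ('E_P[fun w => sqnorm (xi None w)] < +oo)%E
    & forall i, ('E_P[fun w => sqnorm (xi (Some i) w)] <= c0%:E)%E] /\
  mutual_indep P (fun o : option (option 'I_N) =>
    if o is Some a
    then <<s \bigcup_(s in `[0, T]) vec_events (W a s) >>
    else <<s \bigcup_(a in [set: option 'I_N]) vec_events (xi a) >>).

Definition filtration (t : R) : set (set Om) :=
  <<s (\bigcup_(a in [set: option 'I_N]) vec_events (xi a)) `|`
      (\bigcup_(a in [set: option 'I_N])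
         \bigcup_(s in `[0, t]) vec_events (W a s)) >>.

Definition adapted p (X : R -> Om -> 'cV[R]_p) : Prop :=
  forall t, t \in `[0, T] -> vec_events (X t) `<=` filtration t.

Definition Uc (u : 'I_N -> R -> Om -> 'cV[R]_m) : Prop :=
  forall i, [/\ measurable_process T (u i), adapted (u i)
    & (\int[P]_w \int[mu]_(t in `[0%R, T]) (sqnorm (u i t w))%:E < +oo)%E].

Definition average (x : 'I_N -> R -> Om -> 'cV[R]_n) (t : R) (w : Om) :
    'cV[R]_n :=
  N%:R^-1 *: \sum_i x i t w.

Section FixedGains.
Variables P0 Pb : R -> 'M[R]_(m, n).

Definition leader_control (x0 : R -> Om -> 'cV[R]_n)
    (x : 'I_N -> R -> Om -> 'cV[R]_n) (t : R) (w : Om) : 'cV[R]_m :=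
  P0 t *m x0 t w + Pb t *m average x t w.

(* X(t) = X_0 + \int_0^t b(s) ds + D W(t) for all t in [0, T], almost surely;
   the noise is additive, so that the stochastic integral of D is D W(t). *)
Definition solves_sde (X0 : Om -> 'cV[R]_n) (b : R -> Om -> 'cV[R]_n)
    (D : 'M[R]_(n, d)) (B : R -> Om -> 'cV[R]_d) (X : R -> Om -> 'cV[R]_n) :
    Prop :=
  measurable_process T X /\
  {ae P, forall w, mx_integrable `[0, T] (fun s => b s w) /\
    forall t, t \in `[0, T] ->
      X t w = X0 w + mx_integral `[0, t] (fun s => b s w) + D *m B t w}.

Definition state (u : 'I_N -> R -> Om -> 'cV[R]_m)
    (x0 : R -> Om -> 'cV[R]_n) (x : 'I_N -> R -> Om -> 'cV[R]_n) : Prop :=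
  let u0 := leader_control x0 x in
  solves_sde (xi None)
    (fun t w => mA0 c *m x0 t w + mB0 c *m u0 t w + mG0 c *m average x t w)
    (mD0 c) (W None) x0 /\
  forall i, solves_sde (xi (Some i))
    (fun t w => mA c *m x i t w + mB c *m u i t w + mG c *m average x t w
                + mF c *m x0 t w + mB1 c *m u0 t w)
    (mD c) (W (Some i)) (x i).

Definition Jsoc (u : 'I_N -> R -> Om -> 'cV[R]_m)
    (x0 : R -> Om -> 'cV[R]_n) (x : 'I_N -> R -> Om -> 'cV[R]_n) : \bar R :=
  let u0 := leader_control x0 x in
  (\sum_(i < N) \int[P]_w \int[mu]_(t in `[0%R, T])
      (wnorm (mQ c) (x i t w - mGam c *m average x t w - mGam1 c *m x0 t w)
       + wnorm (mR c) (u i t w)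
       + 2 * ((u i t w)^T *m mL c *m u0 t w) 0 0
       + wnorm (mR1 c) (u0 t w))%R%:E
   + \sum_(i < N) \int[P]_w
      (wnorm (mH c) (x i T w - mGamb c *m average x T w
                     - mGamb1 c *m x0 T w)%R)%:E)%E.

(* u is a solution of problem (P3), with state trajectory (x0, x). *)
Definition solves_P3 (u : 'I_N -> R -> Om -> 'cV[R]_m)
    (x0 : R -> Om -> 'cV[R]_n) (x : 'I_N -> R -> Om -> 'cV[R]_n) : Prop :=
  [/\ Uc u, state u x0 x
    & forall v y0 y, Uc v -> state v y0 y -> (Jsoc u x0 x <= Jsoc v y0 y)%E].

Definition feedback_control (K Kb K0 : R -> 'M[R]_n)
    (x0 : R -> Om -> 'cV[R]_n) (x : 'I_N -> R -> Om -> 'cV[R]_n)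
    (i : 'I_N) (t : R) (w : Om) : 'cV[R]_m :=
  - (invmx (mR c) *m (mB c)^T
     *m (K t *m x i t w + Kb t *m average x t w + K0 t *m x0 t w))
  - invmx (mR c) *m mL c *m leader_control x0 x t w.

End FixedGains.
End Problem.

(* Main.v *)
Require Import Defs.
From HB Require Import structures.
From mathcomp Require Import all_boot all_order all_algebra.
From mathcomp Require Import all_classical all_reals all_analysis.
From mathcomp Require Import measurable_realfun ring lra.
Import Order.TTheory GRing.Theory Num.Theory.
Import numFieldNormedType.Exports.

Set Implicit Arguments.
Unset Strict Implicit.
Unset Printing Implicit Defensive.

Local Open Scope classical_set_scope.
Local Open Scope ring_scope.

(** The followers share dynamics and weights and the noise is additive, so both dynamics and
    cost split orthogonally. Write [x_i] as the average plus a deviation. As the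
    deviations sum to zero, the quadratic costs have no cross terms
    ([variance_split], [run_split], [end_split]), and subtracting the averaged
    equation removes the coupling from the equations of the deviations
    ([state_paths]). What remains is a linear-quadratic problem for each
    deviation, and one for the pair made of the average of the followers and the
    state of the leader, in which the gains of the leader have been substituted.

    The five matrix equations are the Riccati equations of these problems: [K] is
    the solution for a deviation, and the block matrix with rows [K + Kb, K0] and
    [Lamb, Lam0] is the solution for the pair ([riccati_systemP]). A Riccati
    equation has at most one solution, since the difference of two solutions
    satisfies a linear equation ([riccati_unique]); it has a solution on the whole
    interval when its weights are nonnegative, by the linear Hamiltonian system
    and an energy argument ([hamiltonian_unit], [riccati_exists]). For the pair
    the weight is nonnegative because [R - L R1^-1 L^T >= 0] makes the joint form
    in the control of a follower and that of the leader nonnegative, and hence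
    also the other Schur complement [R1 - L^T R^-1 L] ([R1_complement_psd]).

    Each linear-quadratic problem is solved path by path. With the same noise, the
    cost of a competitor exceeds that of the feedback by a nonnegative
    second-order term and a first-order term; the Riccati equation and an
    integration by parts turn the latter into the time integral of [lq_cross],
    where each summand is the product of a difference of controls or states at
    time [t] with the later increment [M T - M t] of the noise ([lq_cost_ge]).
    This integral has zero mean: the controls are adapted, the differences of
    states are integrals of differences of controls, and both are uncorrelated
    with later increments ([null_adapted], [null_flow]). Taking expectations
    gives optimality ([feedback_optimal]). Conversely, solving the separate
    closed-loop equations by variation of constants and adding the average back
    to the deviations gives the optimal trajectory ([feedback_exists]).

    The gains are only square integrable in time, so that differential equations
    are understood in integral form; [ac] and [mac] are the corresponding calculus
    for scalar and matrix functions. *)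

(** * Fubini and Tonelli on product subsets *)

Section FubiniOnSets.
Context d1 d2 (T1 : measurableType d1) (T2 : measurableType d2) (R : realType).
Variable m1 : {sigma_finite_measure set T1 -> \bar R}.
Variable m2 : {sigma_finite_measure set T2 -> \bar R}.
Variables (D1 : set T1) (D2 : set T2).
Hypotheses (mD1 : measurable D1) (mD2 : measurable D2).
Variable f : T1 -> T2 -> R.
Hypothesis mf : measurable_fun (D1 `*` D2) (fun z : T1 * T2 => f z.1 z.2).

(** Extending by zero reduces the statements to those on the whole product. *)
Let F (z : T1 * T2) : \bar R :=
  ((fun z : T1 * T2 => (f z.1 z.2)%:E) \_ (D1 `*` D2)) z.

Let mF : measurable_fun setT F.
Proof.
apply/(measurable_restrictT (fun z : T1 * T2 => (f z.1 z.2)%:E)).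
  exact: measurableX.
exact/measurable_EFinP.
Qed.

Let F1 x : D1 x -> (fun y => F (x, y)) = (EFin \o f x) \_ D2.
Proof.
move=> D1x; apply/funext => y; rewrite /F !patchE /=.
by congr (if _ then _ else _); rewrite in_setX /= (mem_set D1x).
Qed.

Let F1N x : ~ D1 x -> (fun y => F (x, y)) = cst 0%E.
Proof.
move=> D1x; apply/funext => y; rewrite /F !patchE /= in_setX /=.
by rewrite memNset.
Qed.

Let F2 y : D2 y -> (fun x => F (x, y)) = (EFin \o f^~ y) \_ D1.
Proof.
move=> D2y; apply/funext => x; rewrite /F !patchE /=.
by congr (if _ then _ else _); rewrite in_setX /= (mem_set D2y) andbT.
Qed.

Let F2N y : ~ D2 y -> (fun x => F (x, y)) = cst 0%E.
Proof.
move=> D2y; apply/funext => x; rewrite /F !patchE /= in_setX /=.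
by rewrite (memNset D2y) andbF.
Qed.

Lemma measurable_section1 x : D1 x -> measurable_fun D2 (f x).
Proof.
move=> D1x; apply/measurable_EFinP.
apply/(measurable_restrictT _ mD2); rewrite -F1//.
exact: measurableT_comp.
Qed.

Lemma measurable_section2 y : D2 y -> measurable_fun D1 (f^~ y).
Proof.
move=> D2y; apply/measurable_EFinP.
apply/(measurable_restrictT _ mD1); rewrite -F2//.
exact: measurableT_comp.
Qed.

Let point0 : (point : \bar R) = 0%E. Proof. by []. Qed.

Let intF1 (h : \bar R -> \bar R) : h 0%E = 0%E ->
  (\int[m1]_x \int[m2]_y h (F (x, y)) =
  \int[m1]_(x in D1) \int[m2]_(y in D2) h (f x y)%:E)%E.
Proof.
move=> h0; rewrite [RHS]integral_mkcond; apply: eq_integral => x _.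
rewrite patchE; case: ifPn => xD.
  rewrite [RHS]integral_mkcond; apply: eq_integral => y _.
  have -> : F (x, y) = ((EFin \o f x) \_ D2) y by rewrite -F1//; exact: set_mem.
  by rewrite !patchE; case: ifPn.
rewrite point0; apply: integral0_eq => y _.
have -> : F (x, y) = cst 0%E y by rewrite -(@F1N x)//; exact/(contra_not _ (negP xD))/mem_set.
by [].
Qed.

Let intF2 (h : \bar R -> \bar R) : h 0%E = 0%E ->
  (\int[m2]_y \int[m1]_x h (F (x, y)) =
  \int[m2]_(y in D2) \int[m1]_(x in D1) h (f x y)%:E)%E.
Proof.
move=> h0; rewrite [RHS]integral_mkcond; apply: eq_integral => y _.
rewrite patchE; case: ifPn => yD.
  rewrite [RHS]integral_mkcond; apply: eq_integral => x _.
  have -> : F (x, y) = ((EFin \o f^~ y) \_ D1) x by rewrite -F2//; exact: set_mem.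
  by rewrite !patchE; case: ifPn.
rewrite point0; apply: integral0_eq => x _.
have -> : F (x, y) = cst 0%E x by rewrite -(@F2N y)//; exact/(contra_not _ (negP yD))/mem_set.
by [].
Qed.

Lemma tonelli_on : (forall x y, D1 x -> D2 y -> 0 <= f x y) ->
  (\int[m1]_(x in D1) \int[m2]_(y in D2) (f x y)%:E =
   \int[m2]_(y in D2) \int[m1]_(x in D1) (f x y)%:E)%E.
Proof.
move=> f0; rewrite -(@intF1 id)// -(@intF2 id)//.
apply: (@fubini_tonelli _ _ T1 T2 R m1 m2 F mF) => -[x y].
rewrite /F patchE; case: ifPn => // /set_mem [/= ? ?].
by rewrite lee_fin f0.
Qed.

Lemma measurable_integral_on2 : (forall x y, D1 x -> D2 y -> 0 <= f x y) ->
  measurable_fun D2 (fun y => \int[m1]_(x in D1) (f x y)%:E)%E.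
Proof.
move=> f0; apply/(measurable_restrictT _ mD2).
rewrite [X in measurable_fun _ X](_ : _ = fubini_G m1 F).
  apply: measurable_fun_fubini_tonelli_G => // -[x y].
  rewrite /F patchE; case: ifPn => // /set_mem [/= ? ?].
  by rewrite lee_fin f0.
apply/funext => y; rewrite /fubini_G patchE; case: ifPn => yD.
  by rewrite [LHS]integral_mkcond (@F2 y)//; exact: set_mem.
by rewrite F2N ?integral0//; exact/(contra_not _ (negP yD))/mem_set.
Qed.

Lemma measurable_integral_on1 : (forall x y, D1 x -> D2 y -> 0 <= f x y) ->
  measurable_fun D1 (fun x => \int[m2]_(y in D2) (f x y)%:E)%E.
Proof.
move=> f0; apply/(measurable_restrictT _ mD1).
rewrite [X in measurable_fun _ X](_ : _ = fubini_F m2 F).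
  apply: measurable_fun_fubini_tonelli_F => // -[x y].
  rewrite /F patchE; case: ifPn => // /set_mem [/= ? ?].
  by rewrite lee_fin f0.
apply/funext => x; rewrite /fubini_F patchE; case: ifPn => xD.
  by rewrite [LHS]integral_mkcond (@F1 x)//; exact: set_mem.
by rewrite F1N ?integral0//; exact/(contra_not _ (negP xD))/mem_set.
Qed.

Hypothesis fint :
  (\int[m1]_(x in D1) \int[m2]_(y in D2) `|f x y|%:E < +oo)%E.

Let iF : (m1 \x m2)%E.-integrable setT F.
Proof. by apply/integrable12ltyP; [exact: mF|rewrite (@intF1 abse) ?abse0]. Qed.

Lemma ae_integrable_on1 :
  {ae m1, forall x, D1 x -> m2.-integrable D2 (EFin \o f x)}.
Proof.
have := ae_integrable1 iF; apply: filterS => x /[swap] D1x.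
by rewrite F1// -integrable_mkcond.
Qed.

Let aeR1 : {ae m1, forall x, D1 x ->
  (\int[m2]_(y in D2) (f x y)%:E = (\int[m2]_(y in D2) f x y)%:E)%E}.
Proof.
have := ae_integrable_on1; apply: filterS => x /[apply] fi.
by rewrite /Rintegral fineK//; exact: integrable_fin_num.
Qed.

Let aeR2 : {ae m2, forall y, D2 y ->
  (\int[m1]_(x in D1) (f x y)%:E = (\int[m1]_(x in D1) f x y)%:E)%E}.
Proof.
have := ae_integrable2 iF; apply: filterS => y /[swap] D2y.
rewrite F2// -integrable_mkcond// => fi.
by rewrite /Rintegral fineK//; exact: integrable_fin_num.
Qed.

Let E1 : fubini_F m2 F = (fun x => \int[m2]_(y in D2) (f x y)%:E)%E \_ D1.
Proof.
apply/funext => x; rewrite /fubini_F patchE; case: ifPn => xD.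
  by rewrite [RHS]integral_mkcond (@F1 x)//; exact: set_mem.
by rewrite F1N ?integral0//; exact/(contra_not _ (negP xD))/mem_set.
Qed.

Let E2 : fubini_G m1 F = (fun y => \int[m1]_(x in D1) (f x y)%:E)%E \_ D2.
Proof.
apply/funext => y; rewrite /fubini_G patchE; case: ifPn => yD.
  by rewrite [RHS]integral_mkcond (@F2 y)//; exact: set_mem.
by rewrite F2N ?integral0//; exact/(contra_not _ (negP yD))/mem_set.
Qed.

Let iE1 : m1.-integrable D1 (fun x => \int[m2]_(y in D2) (f x y)%:E)%E.
Proof. by rewrite integrable_mkcond// -E1; exact: (integrable_fubini_F iF). Qed.

Let iE2 : m2.-integrable D2 (fun y => \int[m1]_(x in D1) (f x y)%:E)%E.
Proof.
rewrite integrable_mkcond// -E2; apply/integrableP; split.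
  exact: (measurable_fubini_G iF).
have : (\int[m2]_y \int[m1]_x `|F (x, y)| < +oo)%E by apply/integrable21ltyP.
apply: le_lt_trans; apply: ge0_le_integral => //.
- by apply: measurableT_comp => //; exact: (measurable_fubini_G iF).
- apply: (measurable_fun_fubini_tonelli_G (abse \o F)) => //=.
  exact: measurableT_comp.
- by move=> y _; apply: le_abse_integral => //; exact: measurableT_comp.
Qed.

Lemma integrable_Rintegral1 :
  m1.-integrable D1 (EFin \o (fun x => \int[m2]_(y in D2) f x y)).
Proof.
apply: le_integrable iE1 => //=.
  apply/measurable_EFinP.
  have -> : (fun x => \int[m2]_(y in D2) f x y) =
    fine \o (fun x => \int[m2]_(y in D2) (f x y)%:E)%E by [].
  by apply: measurableT_comp => //; exact: measurable_int iE1.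
by move=> x _; rewrite /Rintegral; case: (integral _ _ _) => //= ; rewrite normr0 leey.
Qed.

Lemma integrable_Rintegral2 :
  m2.-integrable D2 (EFin \o (fun y => \int[m1]_(x in D1) f x y)).
Proof.
apply: le_integrable iE2 => //=.
  apply/measurable_EFinP.
  have -> : (fun y => \int[m1]_(x in D1) f x y) =
    fine \o (fun y => \int[m1]_(x in D1) (f x y)%:E)%E by [].
  by apply: measurableT_comp => //; exact: measurable_int iE2.
by move=> x _; rewrite /Rintegral; case: (integral _ _ _) => //= ; rewrite normr0 leey.
Qed.

Lemma Rfubini_on : \int[m1]_(x in D1) (\int[m2]_(y in D2) f x y) =
  \int[m2]_(y in D2) (\int[m1]_(x in D1) f x y).
Proof.
rewrite /Rintegral; congr fine.
transitivity (\int[m1]_(x in D1) \int[m2]_(y in D2) (f x y)%:E)%E.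
  apply: ae_eq_integral => //.
  - exact: measurable_int integrable_Rintegral1.
  - exact: measurable_int iE1.
  - by apply: filterS aeR1 => x /[apply] ->.
transitivity (\int[m2]_(y in D2) \int[m1]_(x in D1) (f x y)%:E)%E.
  by rewrite -(@intF1 id)// -(@intF2 id)//; exact: Fubini.
apply: ae_eq_integral => //; first exact: measurable_int iE2.
  exact: measurable_int integrable_Rintegral2.
Qed.

End FubiniOnSets.

Lemma iterated_integral_lty d1 d2 (T1 : measurableType d1)
    (T2 : measurableType d2) (R : realType)
    (m1 : {sigma_finite_measure set T1 -> \bar R})
    (m2 : {sigma_finite_measure set T2 -> \bar R}) (D1 : set T1) (D2 : set T2)
    (f : T1 -> T2 -> R) (phi : T1 -> R) :
  measurable D1 -> measurable D2 ->
  measurable_fun (D1 `*` D2) (fun z : T1 * T2 => f z.1 z.2) ->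
  m1.-integrable D1 (EFin \o phi) ->
  (forall x, D1 x -> (\int[m2]_(y in D2) `|f x y|%:E <= (phi x)%:E)%E) ->
  (\int[m1]_(x in D1) \int[m2]_(y in D2) `|f x y|%:E < +oo)%E.
Proof.
move=> mD1 mD2 mf iphi le_phi.
apply: le_lt_trans (integrable_lty mD1 iphi).
apply: ge0_le_integral => //.
- by move=> x _; exact: integral_ge0.
- apply: (@measurable_integral_on1 _ _ _ _ _ m2 _ _ mD1 mD2 (fun x y => `|f x y|)) => //.
  exact: measurableT_comp.
- exact: measurable_int iphi.
Qed.

Section Comp2.
Context d1 d2 (T1 : measurableType d1) (T2 : measurableType d2) (R : realType).
Variables (D1 : set T1) (D2 : set T2).
Hypotheses (mD1 : measurable D1) (mD2 : measurable D2).

Lemma measurable_fun_on_fst (f : T1 -> R) : measurable_fun D1 f ->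
  measurable_fun (D1 `*` D2) (fun z : T1 * T2 => f z.1).
Proof.
move=> mf; apply: (measurable_comp mD1 _ mf) => //.
  by move=> _ [z [? _] <-].
exact: measurable_funTS.
Qed.

Lemma measurable_fun_on_snd (f : T2 -> R) : measurable_fun D2 f ->
  measurable_fun (D1 `*` D2) (fun z : T1 * T2 => f z.2).
Proof.
move=> mf; apply: (measurable_comp mD2 _ mf) => //.
  by move=> _ [z [_ ?] <-].
exact: measurable_funTS.
Qed.

End Comp2.

(** * Integrable and bounded functions on an interval *)

Section BigopClosure.
Variables (V : Type) (idx : V) (op : V -> V -> V) (I : finType).

Lemma bigop_closed (X : Type) (Q : (X -> V) -> Prop) (f : I -> X -> V) :
  Q (fun=> idx) -> (forall g h, Q g -> Q h -> Q (fun x => op (g x) (h x))) ->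
  (forall i, Q (f i)) -> Q (fun x => \big[op/idx]_i f i x).
Proof.
move=> Q0 Q2 Qf.
rewrite (_ : (fun x => _) =
  \big[(fun g h x => op (g x) (h x))/(fun=> idx)]_i f i); first exact: big_ind.
by apply/funext => x; rewrite (big_morph (fun g : X -> V => g x) (id1 := idx) (op1 := op)).
Qed.

Lemma bigop_closed2 (X Y : Type) (Q : (X -> Y -> V) -> Prop) (f : I -> X -> Y -> V) :
  Q (fun _ _ => idx) ->
  (forall g h, Q g -> Q h -> Q (fun x y => op (g x y) (h x y))) ->
  (forall i, Q (f i)) -> Q (fun x y => \big[op/idx]_i f i x y).
Proof.
move=> Q0 Q2 Qf.
apply: (@bigop_closed _ (fun h : X * Y -> V => Q (fun x y => h (x, y)))
  (fun i z => f i z.1 z.2)) => // g h; exact: Q2.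
Qed.

End BigopClosure.

Section L1.
Context (R : realType) (T : R).
Hypothesis T_gt0 : 0 < T.
Local Notation mu := (@lebesgue_measure R).
Implicit Types (f g F G : R -> R) (t : R).

Definition L1 f := mu.-integrable `[0, T] (EFin \o f).

Definition L2 f :=
  measurable_fun `[0, T] f /\ mu.-integrable `[0, T] (EFin \o (fun s => f s ^+ 2)).

Definition bmeas f :=
  measurable_fun `[0, T] f /\ exists M : R, forall t, t \in `[0, T] -> `|f t| <= M.

Lemma in0T : 0 \in `[0, T]. Proof. by rewrite in_itv /= lexx ltW. Qed.

Lemma inTT : T \in `[0, T]. Proof. by rewrite in_itv /= lexx ltW. Qed.

Lemma sub0t t : t \in `[0, T] -> `[0, t] `<=` `[0, T].
Proof. by rewrite in_itv /= => /andP[_ tT]; apply: subset_itvl; rewrite bnd_simp. Qed.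

Lemma in_sub0t s t : t \in `[0, T] -> s \in `[0, t] -> s \in `[0, T].
Proof. by move=> tT st; have := sub0t tT st. Qed.

Lemma L1_meas f : L1 f -> measurable_fun `[0, T] f.
Proof. by move=> /(@measurable_int _ _ _ _ _ _) /measurable_EFinP. Qed.

Lemma L1_sub f t : t \in `[0, T] -> L1 f -> mu.-integrable `[0, t] (EFin \o f).
Proof. by move=> tT; apply: integrableS => //; exact: sub0t. Qed.

Lemma L1_le f g : measurable_fun `[0, T] f ->
  (forall t, t \in `[0, T] -> `|f t| <= `|g t|) -> L1 g -> L1 f.
Proof.
move=> mf fg; apply: le_integrable => //; exact/measurable_EFinP.
Qed.

Lemma L1_eq f g : {in `[0, T], f =1 g} -> L1 f -> L1 g.
Proof.
move=> fg; apply: eq_integrable => // t.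
by rewrite inE /= => tT; rewrite /= fg.
Qed.

Lemma L1D f g : L1 f -> L1 g -> L1 (fun t => f t + g t).
Proof. exact: integrableD. Qed.

Lemma L1Zl a f : L1 f -> L1 (fun t => a * f t).
Proof. exact: integrableZl. Qed.

Lemma L1N f : L1 f -> L1 (fun t => - f t).
Proof. by move=> /(L1Zl (-1)); apply: L1_eq => t _ /=; rewrite mulN1r. Qed.

Lemma L1B f g : L1 f -> L1 g -> L1 (fun t => f t - g t).
Proof. by move=> Lf Lg; apply: L1D => //; exact: L1N. Qed.

Lemma L1_cst a : L1 (fun=> a).
Proof.
apply: measurable_bounded_integrable => //.
  by rewrite [X in (X < _)%E](@lebesgue_measure_itv R `[0, T]%R) /=; case: ifP => _; rewrite ?ltry.
by exists `|a|; split; rewrite ?num_real// => M aM t _ /=; exact: ltW.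
Qed.

Lemma L1_sum (I : finType) (f : I -> R -> R) :
  (forall i, L1 (f i)) -> L1 (fun t => \sum_i f i t).
Proof. exact: (bigop_closed (Q := L1) (L1_cst 0) L1D). Qed.

Lemma L1_norm f : L1 f -> L1 (fun t => `|f t|).
Proof. exact: integrable_norm. Qed.

Lemma bmeasM f g : bmeas f -> bmeas g -> bmeas (fun t => f t * g t).
Proof.
move=> [mf [M fM]] [mg [N gN]]; split; first exact: measurable_funM.
by exists (M * N) => t tT; rewrite normrM ler_pM// ?fM ?gN.
Qed.

Lemma bmeasD f g : bmeas f -> bmeas g -> bmeas (fun t => f t + g t).
Proof.
move=> [mf [M fM]] [mg [N gN]]; split; first exact: measurable_funD.
by exists (M + N) => t tT; rewrite (le_trans (ler_normD _ _))// lerD ?fM ?gN.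
Qed.

Lemma bmeas_cst a : bmeas (fun=> a).
Proof. by split=> //; exists `|a|. Qed.

Lemma bmeas_eq f g : {in `[0, T], f =1 g} -> bmeas f -> bmeas g.
Proof.
move=> fg [mf [M fM]]; split.
  by apply: eq_measurable_fun mf => t; rewrite inE /= => tT; rewrite fg.
by exists M => t tT; rewrite -fg// fM.
Qed.

Lemma bmeas_sum (I : finType) (f : I -> R -> R) :
  (forall i, bmeas (f i)) -> bmeas (fun t => \sum_i f i t).
Proof. exact: (bigop_closed (Q := bmeas) (bmeas_cst 0) bmeasD). Qed.

Lemma bmeas_prod (I : finType) (f : I -> R -> R) :
  (forall i, bmeas (f i)) -> bmeas (fun t => \prod_i f i t).
Proof. exact: (bigop_closed (Q := bmeas) (bmeas_cst 1) bmeasM). Qed.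

Lemma continuous_bmeas f : {within `[0, T], continuous f} -> bmeas f.
Proof.
move=> cf; split.
  by apply: subspace_continuous_measurable_fun.
have cnf : {within `[0, T], continuous (fun t => `|f t|)}.
  by move=> t; apply: continuous_comp; [exact: cf|exact: norm_continuous].
have [c _ fc] := EVT_max (ltW T_gt0) cnf.
by exists (`|f c|).
Qed.

Lemma L1M f g : bmeas f -> L1 g -> L1 (fun t => f t * g t).
Proof.
move=> [mf [M fM]] Lg; apply: (L1_le _ _ (L1Zl M Lg)).
  by apply: measurable_funM => //; exact: L1_meas.
move=> t tT; rewrite !normrM ler_wpM2r//.
by rewrite (le_trans (fM t tT))// ler_norm.
Qed.

Lemma L1Mr f g : L1 f -> bmeas g -> L1 (fun t => f t * g t).
Proof. by move=> Lf /L1M /(_ Lf); apply: L1_eq => t _; rewrite mulrC. Qed.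

Lemma bmeas_L1 f : bmeas f -> L1 f.
Proof. by move=> bf; apply: (L1_eq _ (L1M bf (L1_cst 1))) => t _; rewrite mulr1. Qed.

Lemma L2_sq f : L2 f -> L1 (fun t => f t ^+ 2).
Proof. by case. Qed.

Lemma L2_L1M f g : L2 f -> L2 g -> L1 (fun t => f t * g t).
Proof.
move=> [mf Lf] [mg Lg]; apply: (L1_le _ _ (L1D Lf Lg)).
  exact: measurable_funM.
move=> t _; rewrite [leRHS]ger0_norm ?addr_ge0 ?sqr_ge0// normrM.
rewrite -(real_normK (num_real (f t))) -(real_normK (num_real (g t))).
have := sqr_ge0 (`|f t| - `|g t|); have := sqr_ge0 (`|f t| + `|g t|); lra.
Qed.

Lemma bmeas_L2 f : bmeas f -> L2 f.
Proof. by move=> bf; split; [case: bf|apply/bmeas_L1/bmeasM]. Qed.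

Lemma L2_L1 f : L2 f -> L1 f.
Proof.
move=> Lf; apply: (L1_eq _ (L2_L1M Lf (bmeas_L2 (bmeas_cst 1)))) => t _.
by rewrite mulr1.
Qed.

Lemma L2_eq f g : {in `[0, T], f =1 g} -> L2 f -> L2 g.
Proof.
move=> fg [mf Lf]; split.
  by apply: eq_measurable_fun mf => t; rewrite inE /= => tT; rewrite fg.
by apply: L1_eq Lf => t tT /=; rewrite fg.
Qed.

Lemma L2D f g : L2 f -> L2 g -> L2 (fun t => f t + g t).
Proof.
move=> Lf Lg; split; first by case: Lf Lg => mf _ [mg _]; exact: measurable_funD.
have := L1D (L1D (L2_sq Lf) (L2_sq Lg)) (L1Zl 2 (L2_L1M Lf Lg)).
apply: L1_eq => t _ /=; ring.
Qed.

Lemma L2Ml f g : bmeas f -> L2 g -> L2 (fun t => f t * g t).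
Proof.
move=> bf Lg; split; first by case: bf Lg => mf _ [mg _]; exact: measurable_funM.
have := L1M (bmeasM bf bf) (L2_sq Lg).
by apply: L1_eq => t _ /=; rewrite exprMn expr2.
Qed.

Lemma L2_sum (I : finType) (f : I -> R -> R) :
  (forall i, L2 (f i)) -> L2 (fun t => \sum_i f i t).
Proof. exact: (bigop_closed (Q := L2) (bmeas_L2 (bmeas_cst 0)) L2D). Qed.

End L1.

(** * Absolutely continuous functions *)

Section AC.
Context (R : realType) (T : R).
Hypothesis T_gt0 : 0 < T.
Local Notation mu := (@lebesgue_measure R).
Implicit Types (f g F G : R -> R) (t : R).

(** [F] is absolutely continuous with derivative [f]. Keeping the derivative as an
    argument avoids differentiating almost everywhere. *)
Definition ac F f :=
  L1 T f /\ forall t, t \in `[0, T] -> F t = F 0 + \int[mu]_(s in `[0, t]) f s.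

Lemma Rint00 f : \int[mu]_(s in `[0, 0]) f s = 0.
Proof. by rewrite set_itv1 Rintegral_set1. Qed.

Lemma ac_eq F G f g : {in `[0, T], F =1 G} -> {in `[0, T], f =1 g} ->
  ac F f -> ac G g.
Proof.
move=> FG fg [Lf eF]; split; first exact: L1_eq Lf.
move=> t tT; rewrite -!FG ?(in0T T_gt0)// eF//; congr (_ + _).
by apply: eq_Rintegral => s; rewrite inE /= => st; rewrite fg// (in_sub0t tT st).
Qed.

Lemma ac_int a f : L1 T f -> ac (fun t => a + \int[mu]_(s in `[0, t]) f s) f.
Proof. by move=> Lf; split=> // t tT; rewrite Rint00 addr0. Qed.

Lemma ac_continuous F f : ac F f -> {within `[0, T], continuous F}.
Proof.
move=> [Lf eF].
have c : {within `[0, T], continuous (fun t => F 0 + \int[mu]_(s in `[0, t]) f s)}.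
  move=> t; apply: cvgD; first exact: cvg_cst.
  exact: (parameterized_integral_continuous (ltW T_gt0) Lf).
apply: subspace_eq_continuous c => t; rewrite inE /= => tT.
by rewrite /from_subspace /= -eF.
Qed.

Lemma ac_bmeas F f : ac F f -> bmeas T F.
Proof. by move=> /ac_continuous; exact: continuous_bmeas. Qed.

Lemma ac_cst a : ac (fun=> a) (fun=> 0).
Proof.
split; first exact: L1_cst.
by move=> t tT; rewrite Rintegral_cst// mul0r addr0.
Qed.

Lemma acD F f G g : ac F f -> ac G g ->
  ac (fun t => F t + G t) (fun t => f t + g t).
Proof.
move=> [Lf eF] [Lg eG]; split; first exact: L1D.
move=> t tT; rewrite eF// eG// RintegralD//; last 2 first.
  exact: L1_sub Lf.
  exact: L1_sub Lg.
by rewrite addrACA.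
Qed.

Lemma acZ a F f : ac F f -> ac (fun t => a * F t) (fun t => a * f t).
Proof.
move=> [Lf eF]; split; first exact: L1Zl.
move=> t tT; rewrite eF// RintegralZl//; last exact: L1_sub Lf.
by rewrite mulrDr.
Qed.

Lemma acN F f : ac F f -> ac (fun t => - F t) (fun t => - f t).
Proof. by move=> /(acZ (-1)); apply: ac_eq => t _; rewrite mulN1r. Qed.

Lemma ac_sum (I : finType) (F f : I -> R -> R) : (forall i, ac (F i) (f i)) ->
  ac (fun t => \sum_i F i t) (fun t => \sum_i f i t).
Proof.
move=> aF.
have : ac (fun t => \sum_(i <- index_enum I) F i t)
          (fun t => \sum_(i <- index_enum I) f i t).
  elim: (index_enum I) => [|i s IHs].
    by apply: (ac_eq _ _ (ac_cst 0)) => t _; rewrite big_nil.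
  by apply: (ac_eq _ _ (acD (aF i) IHs)) => t _; rewrite big_cons.
by [].
Qed.

Lemma ac_incr F f s t : ac F f -> s \in `[0, T] -> t \in `[0, T] -> s <= t ->
  F t - F s = \int[mu]_(r in `]s, t]) f r.
Proof.
move=> [Lf eF] sT tT st; rewrite (eF t tT) (eF s sT) opprD addrACA subrr add0r.
apply: Rintegral_itvB; first exact: L1_sub Lf.
  by move: sT; rewrite in_itv /= bnd_simp => /andP[].
by rewrite bnd_simp.
Qed.

Lemma ac0_cst F t : ac F (fun=> 0) -> t \in `[0, T] -> F t = F 0.
Proof. by move=> [_ eF] tT; rewrite eF// Rintegral_cst// mul0r addr0. Qed.

Lemma Rint_prim_left f t s : t \in `[0, T] -> s \in `[0, t] -> L1 T f ->
  \int[mu]_(r in `[0, t]) (f r * \1_(`]-oo, s[%classic) r) =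
  \int[mu]_(r in `[0, s]) f r.
Proof.
move=> tT; rewrite in_itv /= => /andP[s0 st] Lf.
have sT : s \in `[0, T].
  by move: tT; rewrite !in_itv /= s0 => /andP[_ tT]; rewrite (le_trans st).
rewrite -[RHS]Rintegral_itv_bndo_bndc; last first.
  apply: integrableS (L1_sub sT Lf) => //.
  by apply: subset_itvl; rewrite bnd_simp.
have -> : `[0, s[%classic = `[0, t] `&` `]-oo, s[%classic :> set R.
  apply/seteqP; split=> r /=; rewrite !in_itv /=.
    by move=> /andP[-> rs]; rewrite rs (le_trans (ltW rs)).
  by move=> [/andP[-> _] ->].
rewrite Rintegral_mkcondr; apply: eq_Rintegral => r _.
by rewrite patchE indicE; case: (r \in _) => /=; rewrite ?mulr1 ?mulr0.
Qed.

Lemma Rint_prim_right f t s : t \in `[0, T] -> s \in `[0, t] -> L1 T f ->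
  \int[mu]_(r in `[0, t]) (f r * \1_(`]s, +oo[%classic) r) =
  \int[mu]_(r in `[0, t]) f r - \int[mu]_(r in `[0, s]) f r.
Proof.
move=> tT; rewrite in_itv /= => /andP[s0 st] Lf.
rewrite Rintegral_itvB ?bnd_simp//; last exact: L1_sub Lf.
have -> : `]s, t]%classic = `[0, t] `&` `]s, +oo[%classic :> set R.
  apply/seteqP; split=> r /=; rewrite !in_itv /= andbT.
    by move=> /andP[sr ->]; rewrite sr (le_trans s0 (ltW sr)).
  by move=> [/andP[_ ->] ->].
rewrite Rintegral_mkcondr; apply: eq_Rintegral => r _.
by rewrite patchE indicE; case: (r \in _) => /=; rewrite ?mulr1 ?mulr0.
Qed.

Lemma indic_swap (r s : R) :
  \1_(`]-oo, s[%classic) r = \1_(`]r, +oo[%classic) s :> R.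
Proof. by rewrite !indicE !mem_setE !in_itv /= andbT. Qed.

Lemma measurable_indic_lt (D : set (measurableTypeR R * measurableTypeR R)) :
  measurable_fun D (fun z : measurableTypeR R * measurableTypeR R =>
    \1_(`]-oo, z.1[%classic) z.2 : R).
Proof.
apply: measurable_funTS.
have -> : (fun z : measurableTypeR R * measurableTypeR R =>
    \1_(`]-oo, z.1[%classic) z.2 : R) = \1_[set z | z.2 < z.1].
  by apply/funext => z; rewrite !indicE mem_setE in_itv /= mem_setE.
apply: measurable_indic.
rewrite -[X in measurable X]setTI.
have := @measurable_fun_ltr _ (measurableTypeR R * measurableTypeR R)%type R setT
  (fun z => z.2) (fun z => z.1) measurable_snd measurable_fst.
move=> /(_ measurableT [set true]) /=.
apply => //.
Qed.

(** Both sides integrate [f s * g r] over the triangle [r < s]. *)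
Lemma Rint_triangle f g t : t \in `[0, T] -> L1 T f -> L1 T g ->
  \int[mu]_(s in `[0, t]) (f s * \int[mu]_(r in `[0, s]) g r) =
  \int[mu]_(r in `[0, t]) (g r * (\int[mu]_(s in `[0, t]) f s -
                                  \int[mu]_(s in `[0, r]) f s)).
Proof.
move=> tT Lf Lg.
have Lft := L1_sub tT Lf; have Lgt := L1_sub tT Lg.
pose h (s r : measurableTypeR R) : R := f s * g r * \1_(`]-oo, s[%classic) r.
have mh : measurable_fun (`[0, t]%classic `*` `[0, t]%classic)
   (fun z : measurableTypeR R * measurableTypeR R => h z.1 z.2).
  apply: measurable_funM; last exact: measurable_indic_lt.
  apply: measurable_funM.
    apply: (@measurable_fun_on_fst _ _ (measurableTypeR R) (measurableTypeR R)) => //.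
    by apply/measurable_EFinP; exact: measurable_int Lft.
  apply: (@measurable_fun_on_snd _ _ (measurableTypeR R) (measurableTypeR R)) => //.
  by apply/measurable_EFinP; exact: measurable_int Lgt.
have bnd : (\int[mu]_(s in `[0%R, t]) \int[mu]_(r in `[0%R, t]) `|h s r|%:E < +oo)%E.
  pose C := fine (\int[mu]_(r in `[0%R, t]) `|g r|%:E).
  have CE : (\int[mu]_(r in `[0%R, t]) `|g r|%:E = C%:E)%E.
    by rewrite /C fineK//; apply: integrable_fin_num => //; exact: integrable_norm.
  apply: (@iterated_integral_lty _ _ (measurableTypeR R) (measurableTypeR R) R
    mu mu _ _ h (fun s => `|f s| * C)) => //.
    apply: (L1_eq _ (L1Zl C (L1_norm (Lft : L1 t f)))) => s _ /=.
    by rewrite mulrC.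
  have mg : measurable_fun `[0, t] (fun r => `|g r|).
    by apply: measurableT_comp => //; exact: (L1_meas (Lgt : L1 t g)).
  move=> s st; rewrite EFinM -CE -ge0_integralZl_EFin//; last exact/measurable_EFinP.
  apply: ge0_le_integral => //.
  - apply/measurable_EFinP/measurableT_comp => //.
    exact: (@measurable_section1 _ _ (measurableTypeR R) (measurableTypeR R) _ _ _
      (measurable_itv _) (measurable_itv _) h mh s st).
  - by apply/measurable_EFinP/measurable_funM.
  - move=> r _; rewrite -EFinM lee_fin /h !normrM indicE ler_piMr ?mulr_ge0//.
    by case: (_ \in _); rewrite ?normr1 ?normr0.
have := @Rfubini_on _ _ (measurableTypeR R) (measurableTypeR R) R mu mu
  _ _ (measurable_itv _) (measurable_itv _) h mh bnd.
have Lind s (k : R -> R) : L1 t k -> L1 t (fun r => k r * \1_(`]-oo, s[%classic) r).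
  move=> Lk; apply: L1Mr => //; split; first exact/measurable_funTS/measurable_indic.
  by exists 1 => r _; rewrite indicE; case: (_ \in _); rewrite ?normr1 ?normr0.
have Lind' s (k : R -> R) : L1 t k -> L1 t (fun r => k r * \1_(`]s, +oo[%classic) r).
  move=> Lk; apply: L1Mr => //; split; first exact/measurable_funTS/measurable_indic.
  by exists 1 => r _; rewrite indicE; case: (_ \in _); rewrite ?normr1 ?normr0.
under eq_Rintegral => s.
  rewrite inE /= => st.
  under eq_Rintegral do rewrite /h -mulrA.
  rewrite RintegralZl//; last exact: (Lind s g).
  rewrite Rint_prim_left//.
  over.
move=> ->; apply: eq_Rintegral => r; rewrite inE /= => rt.
under eq_Rintegral do rewrite /h indic_swap mulrAC -mulrC.
rewrite RintegralZl//; last exact: (Lind' r f).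
by rewrite Rint_prim_right.
Qed.

(** Integration by parts is Fubini's theorem on a triangle. *)
Lemma acM F f G g : ac F f -> ac G g ->
  ac (fun t => F t * G t) (fun t => f t * G t + F t * g t).
Proof.
move=> aF aG; have [Lf eF] := aF; have [Lg eG] := aG.
have LfG : L1 T (fun t => f t * G t) by apply: L1Mr => //; exact: ac_bmeas aG.
have LFg : L1 T (fun t => F t * g t) by apply: L1M => //; exact: ac_bmeas aF.
split; first exact: L1D.
move=> t tT; rewrite RintegralD//; last 2 first.
  exact: L1_sub LfG.
  exact: L1_sub LFg.
pose Fi s := \int[mu]_(r in `[0, s]) f r.
pose Gi s := \int[mu]_(r in `[0, s]) g r.
have bGi : bmeas T Gi.
  apply: (bmeas_eq _ (bmeasD (ac_bmeas aG) (bmeas_cst T (- G 0)))) => s sT.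
  by rewrite eG// addrC addKr.
have bFi : bmeas T Fi.
  apply: (bmeas_eq _ (bmeasD (ac_bmeas aF) (bmeas_cst T (- F 0)))) => s sT.
  by rewrite eF// addrC addKr.
have e1 : \int[mu]_(s in `[0, t]) (f s * G s) =
    G 0 * Fi t + \int[mu]_(s in `[0, t]) (f s * Gi s).
  rewrite -RintegralZl//; last exact: L1_sub Lf.
  rewrite -RintegralD//; last 2 first.
    exact: L1_sub (L1Zl (G 0) Lf).
    exact: (L1_sub tT (L1Mr Lf bGi)).
  apply: eq_Rintegral => s; rewrite inE /= => st.
  by rewrite (eG s (in_sub0t tT st)) mulrDr mulrC.
have e2 : \int[mu]_(s in `[0, t]) (F s * g s) =
    F 0 * Gi t + \int[mu]_(s in `[0, t]) (g s * Fi s).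
  rewrite -RintegralZl//; last exact: L1_sub Lg.
  rewrite -RintegralD//; last 2 first.
    exact: L1_sub (L1Zl (F 0) Lg).
    exact: (L1_sub tT (L1Mr Lg bFi)).
  apply: eq_Rintegral => s; rewrite inE /= => st.
  by rewrite (eF s (in_sub0t tT st)) mulrDl [g s * _]mulrC.
have e3 : \int[mu]_(s in `[0, t]) (g s * Fi s) =
    Gi t * Fi t - \int[mu]_(s in `[0, t]) (f s * Gi s).
  rewrite Rint_triangle//.
  under eq_Rintegral do rewrite mulrBr.
  rewrite RintegralB//; last 2 first.
    exact: (L1_sub tT (L1Mr Lf (bmeas_cst T (Gi t)))).
    exact: (L1_sub tT (L1Mr Lf bGi)).
  by rewrite RintegralZr//; [rewrite mulrC|exact: L1_sub Lf].
rewrite e1 e2 e3 (eF t tT) (eG t tT) -/(Fi t) -/(Gi t); ring.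
Qed.

End AC.

(** * Calculus of matrix functions *)

Section MatrixCalculus.
Context (R : realType) (T : R).
Hypothesis T_gt0 : 0 < T.

Definition mL1 p q (f : R -> 'M[R]_(p, q)) := forall i j, L1 T (fun t => f t i j).
Definition mL2 p q (f : R -> 'M[R]_(p, q)) := forall i j, L2 T (fun t => f t i j).
Definition mbm p q (f : R -> 'M[R]_(p, q)) := forall i j, bmeas T (fun t => f t i j).
Definition mac p q (F f : R -> 'M[R]_(p, q)) :=
  forall i j, ac T (fun t => F t i j) (fun t => f t i j).

Lemma mac_eq p q (F G f g : R -> 'M[R]_(p, q)) : {in `[0, T], F =1 G} ->
  {in `[0, T], f =1 g} -> mac F f -> mac G g.
Proof.
by move=> FG fg aF i j; apply: (ac_eq _ _ _ (aF i j)) => // t tT; rewrite ?FG ?fg.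
Qed.

Lemma mL1_eq p q (f g : R -> 'M[R]_(p, q)) :
  {in `[0, T], f =1 g} -> mL1 f -> mL1 g.
Proof. by move=> fg Lf i j; apply: (L1_eq _ (Lf i j)) => t tT; rewrite fg. Qed.

Lemma mac_mbm p q (F f : R -> 'M[R]_(p, q)) : mac F f -> mbm F.
Proof. by move=> aF i j; apply: ac_bmeas (aF i j). Qed.

Lemma mac_mL1 p q (F f : R -> 'M[R]_(p, q)) : mac F f -> mL1 f.
Proof. by move=> aF i j; case: (aF i j). Qed.

Lemma mac_cst p q (A : 'M[R]_(p, q)) : mac (fun=> A) (fun=> 0).
Proof. by move=> i j; apply: (ac_eq _ _ _ (ac_cst T (A i j))) => // t _; rewrite mxE. Qed.

Lemma macD p q (F G f g : R -> 'M[R]_(p, q)) : mac F f -> mac G g ->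
  mac (fun t => F t + G t) (fun t => f t + g t).
Proof.
by move=> aF aG i j; apply: (ac_eq _ _ _ (acD (aF i j) (aG i j))) => // t _; rewrite mxE.
Qed.

Lemma macN p q (F f : R -> 'M[R]_(p, q)) : mac F f ->
  mac (fun t => - F t) (fun t => - f t).
Proof. by move=> aF i j; apply: (ac_eq _ _ _ (acN _ (aF i j))) => // t _; rewrite mxE. Qed.

Lemma macB p q (F G f g : R -> 'M[R]_(p, q)) : mac F f -> mac G g ->
  mac (fun t => F t - G t) (fun t => f t - g t).
Proof. by move=> aF aG; apply: macD => //; exact: macN. Qed.

Lemma mac_tr p q (F f : R -> 'M[R]_(p, q)) : mac F f ->
  mac (fun t => (F t)^T) (fun t => (f t)^T).
Proof. by move=> aF i j; apply: (ac_eq _ _ _ (aF j i)) => // t _; rewrite mxE. Qed.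

Lemma macM p q r (F f : R -> 'M[R]_(p, q)) (G g : R -> 'M[R]_(q, r)) :
  mac F f -> mac G g -> mac (fun t => F t *m G t) (fun t => f t *m G t + F t *m g t).
Proof.
move=> aF aG i j.
apply: (ac_eq _ _ _ (@ac_sum _ T T_gt0 _ _ _
  (fun k => acM T_gt0 (aF i k) (aG k j)))) => // t _; rewrite !mxE //.
by rewrite big_split /=.
Qed.

Lemma mac0_cst p q (F : R -> 'M[R]_(p, q)) t : mac F (fun=> 0) ->
  t \in `[0, T] -> F t = F 0.
Proof.
move=> aF tT; apply/matrixP => i j.
apply: (@ac0_cst _ T (fun t => F t i j)) => //.
by apply: (ac_eq _ _ _ (aF i j)) => // s _; rewrite mxE.
Qed.

Lemma mbm_cst p q (A : 'M[R]_(p, q)) : mbm (fun=> A).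
Proof. by move=> i j; exact: bmeas_cst. Qed.

Lemma mbmD p q (f g : R -> 'M[R]_(p, q)) : mbm f -> mbm g ->
  mbm (fun t => f t + g t).
Proof.
by move=> bf bg i j; apply: (bmeas_eq _ (bmeasD (bf i j) (bg i j))) => t _; rewrite mxE.
Qed.

Lemma mbm_tr p q (f : R -> 'M[R]_(p, q)) : mbm f -> mbm (fun t => (f t)^T).
Proof. by move=> bf i j; apply: (bmeas_eq _ (bf j i)) => t _; rewrite mxE. Qed.

Lemma mbmM p q r (f : R -> 'M[R]_(p, q)) (g : R -> 'M[R]_(q, r)) :
  mbm f -> mbm g -> mbm (fun t => f t *m g t).
Proof.
move=> bf bg i j; apply: (bmeas_eq _ (bmeas_sum (fun k => bmeasM (bf i k) (bg k j)))).
by move=> t _; rewrite mxE.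
Qed.

Lemma mL1_cst p q (A : 'M[R]_(p, q)) : mL1 (fun=> A).
Proof. by move=> i j; exact: L1_cst. Qed.

Lemma mL1D p q (f g : R -> 'M[R]_(p, q)) : mL1 f -> mL1 g ->
  mL1 (fun t => f t + g t).
Proof.
by move=> bf bg i j; apply: (L1_eq _ (L1D (bf i j) (bg i j))) => t _; rewrite mxE.
Qed.

Lemma mL1N p q (f : R -> 'M[R]_(p, q)) : mL1 f -> mL1 (fun t => - f t).
Proof. by move=> bf i j; apply: (L1_eq _ (L1N (bf i j))) => t _; rewrite mxE. Qed.

Lemma mL1B p q (f g : R -> 'M[R]_(p, q)) : mL1 f -> mL1 g ->
  mL1 (fun t => f t - g t).
Proof. by move=> Lf Lg; apply: mL1D => //; exact: mL1N. Qed.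

Lemma mL1_tr p q (f : R -> 'M[R]_(p, q)) : mL1 f -> mL1 (fun t => (f t)^T).
Proof. by move=> bf i j; apply: (L1_eq _ (bf j i)) => t _; rewrite mxE. Qed.

Lemma mL1Ml p q r (f : R -> 'M[R]_(p, q)) (g : R -> 'M[R]_(q, r)) :
  mbm f -> mL1 g -> mL1 (fun t => f t *m g t).
Proof.
move=> bf bg i j; apply: (L1_eq _ (L1_sum (fun k => L1M (bf i k) (bg k j)))).
by move=> t _; rewrite mxE.
Qed.

Lemma mL1Mr p q r (f : R -> 'M[R]_(p, q)) (g : R -> 'M[R]_(q, r)) :
  mL1 f -> mbm g -> mL1 (fun t => f t *m g t).
Proof.
move=> bf bg i j; apply: (L1_eq _ (L1_sum (fun k => L1Mr (bf i k) (bg k j)))).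
by move=> t _; rewrite mxE.
Qed.

Lemma mbm_mL1 p q (f : R -> 'M[R]_(p, q)) : mbm f -> mL1 f.
Proof. by move=> bf i j; exact: bmeas_L1. Qed.

Lemma mL2_mL1 p q (f : R -> 'M[R]_(p, q)) : mL2 f -> mL1 f.
Proof. by move=> bf i j; exact: L2_L1. Qed.

Lemma mbm_mL2 p q (f : R -> 'M[R]_(p, q)) : mbm f -> mL2 f.
Proof. by move=> bf i j; exact: bmeas_L2. Qed.

Lemma mL2_eq p q (f g : R -> 'M[R]_(p, q)) :
  {in `[0, T], f =1 g} -> mL2 f -> mL2 g.
Proof. by move=> fg Lf i j; apply: (L2_eq _ (Lf i j)) => t tT; rewrite fg. Qed.

Lemma mL2D p q (f g : R -> 'M[R]_(p, q)) : mL2 f -> mL2 g ->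
  mL2 (fun t => f t + g t).
Proof.
by move=> bf bg i j; apply: (L2_eq _ (L2D (bf i j) (bg i j))) => t _; rewrite mxE.
Qed.

Lemma mL2_tr p q (f : R -> 'M[R]_(p, q)) : mL2 f -> mL2 (fun t => (f t)^T).
Proof. by move=> bf i j; apply: (L2_eq _ (bf j i)) => t _; rewrite mxE. Qed.

Lemma mL2Ml p q r (f : R -> 'M[R]_(p, q)) (g : R -> 'M[R]_(q, r)) :
  mbm f -> mL2 g -> mL2 (fun t => f t *m g t).
Proof.
move=> bf bg i j; apply: (L2_eq _ (L2_sum (fun k => L2Ml (bf i k) (bg k j)))).
by move=> t _; rewrite mxE.
Qed.

Lemma mL2Mr p q r (f : R -> 'M[R]_(p, q)) (g : R -> 'M[R]_(q, r)) :
  mL2 f -> mbm g -> mL2 (fun t => f t *m g t).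
Proof.
move=> Lf bg; have := mL2_tr (mL2Ml (mbm_tr bg) (mL2_tr Lf)).
by apply: mL2_eq => t _; rewrite trmx_mul !trmxK.
Qed.

Lemma mL2N p q (f : R -> 'M[R]_(p, q)) : mL2 f -> mL2 (fun t => - f t).
Proof.
move=> Lf; have := mL2Ml (mbm_cst (- 1%:M)) Lf.
by apply: mL2_eq => t _; rewrite mulNmx mul1mx.
Qed.

Lemma mL2M p q r (f : R -> 'M[R]_(p, q)) (g : R -> 'M[R]_(q, r)) :
  mL2 f -> mL2 g -> mL1 (fun t => f t *m g t).
Proof.
move=> bf bg i j; apply: (L1_eq _ (L1_sum (fun k => L2_L1M (bf i k) (bg k j)))).
by move=> t _; rewrite mxE.
Qed.

Lemma mac_int p q (A : 'M[R]_(p, q)) (f : R -> 'M[R]_(p, q)) : mL1 f ->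
  mac (fun t => A + mx_integral `[0, t] f) f.
Proof.
move=> Lf i j; apply: (ac_eq _ _ _ (@ac_int _ T (A i j) _ (Lf i j))) => // t _.
by rewrite !mxE.
Qed.

Lemma mac_incr p q (F f : R -> 'M[R]_(p, q)) s t : mac F f ->
  s \in `[0, T] -> t \in `[0, T] -> s <= t ->
  F t - F s = mx_integral `]s, t] f.
Proof.
move=> aF sT tT st; apply/matrixP => i j; rewrite !mxE.
exact: (@ac_incr _ T _ _ s t (aF i j)).
Qed.

Lemma mac0 p q (F f : R -> 'M[R]_(p, q)) t : mac F f -> t \in `[0, T] ->
  F t = F 0 + mx_integral `[0, t] f.
Proof.
by move=> aF tT; apply/matrixP => i j; rewrite !mxE; case: (aF i j) => _ ->.
Qed.

End MatrixCalculus.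

(** * Linear differential equations *)

Section LinearODE.
Context (R : realType) (T : R).
Hypothesis T_gt0 : 0 < T.
Local Notation mu := (@lebesgue_measure R).

Lemma ac_expS F f k : ac T F f ->
  ac T (fun t => F t ^+ k.+1) (fun t => k.+1%:R * (F t ^+ k * f t)).
Proof.
move=> aF; elim: k => [|k IHk].
  by apply: (ac_eq T_gt0 _ _ aF) => t _; rewrite ?expr1// expr0 !mul1r.
apply: (ac_eq T_gt0 _ _ (acM T_gt0 aF IHk)) => t _; first by rewrite -exprS.
by rewrite [in RHS]exprS [k.+2%:R]mulrS exprS; ring.
Qed.

Lemma Rdominated_convergence (D : set R) (f_ : nat -> R -> R) (f g : R -> R) :
  measurable D -> (forall n, measurable_fun D (f_ n)) ->
  (forall t, D t -> f_ ^~ t @ \oo --> f t) ->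
  mu.-integrable D (EFin \o g) ->
  (forall n t, D t -> `|f_ n t| <= g t) ->
  mu.-integrable D (EFin \o f) /\
  (fun n => \int[mu]_(s in D) f_ n s) @ \oo --> \int[mu]_(s in D) f s.
Proof.
move=> mD mf ff ig fg.
have mff : measurable_fun D f by apply: (measurable_fun_cvg mf).
have [] := @dominated_convergence _ _ R mu D mD (fun n => EFin \o f_ n)
   (EFin \o f) (EFin \o g).
- by move=> n; apply/measurable_EFinP; exact: mf.
- by apply/measurable_EFinP; exact: mff.
- by apply: aeW => t Dt; apply/cvg_EFin; [exact: nearW|exact: ff].
- by [].
- by apply: aeW => t n Dt; rewrite lee_fin fg.
move=> iff _ cv; split => //.
rewrite /Rintegral; apply: fine_cvg.
by rewrite fineK//; exact: integrable_fin_num.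
Qed.

Variables (p : nat) (L : R -> 'M[R]_p).
Hypothesis L_L1 : mL1 T L.

Fixpoint picard k : R -> 'M[R]_p :=
  if k is k'.+1 then fun t => mx_integral `[0, t] (fun s => L s *m picard k' s)
  else fun=> 1%:M.

Lemma mac_picard k : mbm T (picard k) /\
  mac T (picard k.+1) (fun s => L s *m picard k s).
Proof.
have H j : mbm T (picard j) -> mac T (picard j.+1) (fun s => L s *m picard j s).
  move=> bj; have := mac_int T_gt0 0 (mL1Mr L_L1 bj).
  by apply: mac_eq => // t _; rewrite add0r.
elim: k => [|k [_ /(mac_mbm T_gt0) bk]]; last by split=> //; exact: H.
by split; [|apply: H]; exact: mbm_cst.
Qed.

Let lam s : R := \sum_i \sum_j `|L s i j|.
Let Lam t : R := \int[mu]_(s in `[0, t]) lam s.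

Let lam_L1 : L1 T lam.
Proof. by apply: L1_sum => i; apply: L1_sum => j; exact: L1_norm. Qed.

Let lam_ge0 s : 0 <= lam s.
Proof. by apply: sumr_ge0 => i _; apply: sumr_ge0. Qed.

Let ac_Lam : ac T Lam lam.
Proof. by apply: (ac_eq _ _ _ (ac_int 0 lam_L1)) => // t _; rewrite add0r. Qed.

Let Lam_ge0 t : 0 <= Lam t.
Proof. exact: Rintegral_ge0. Qed.

Let Lam_le t : t \in `[0, T] -> Lam t <= Lam T.
Proof.
move=> tT; rewrite -subr_ge0 (ac_incr ac_Lam tT (inTT T_gt0)).
  exact: Rintegral_ge0.
by move: tT; rewrite in_itv /= => /andP[].
Qed.

Lemma le_mulmx_sum (A B : 'M[R]_p) (C : R) i j : 0 <= C ->
  (forall k, `|B k j| <= C) -> `|(A *m B) i j| <= (\sum_i \sum_j `|A i j|) * C.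
Proof.
move=> C0 BC; rewrite mxE (le_trans (ler_norm_sum _ _ _))//.
rewrite [X in _ <= X * _](bigD1 i)//= mulrDl -[leLHS]addr0 lerD//; last first.
  by rewrite mulr_ge0// sumr_ge0// => k _; exact: sumr_ge0.
by rewrite mulr_suml ler_sum// => k _; rewrite normrM ler_wpM2l.
Qed.

(** The powers of the primitive [Lam] of [lam] satisfy the recursion of the iterates:
    [Lam ^ k.+1 / k.+1`!] is the primitive of [lam * Lam ^ k / k`!]. *)
Lemma picard_bound k t i j : t \in `[0, T] ->
  `|picard k t i j| <= exp_coeff (Lam t) k.
Proof.
elim: k t i j => [|k IHk] t i j tT.
  by rewrite /exp_coeff /= expr0 fact0 divr1 mxE normr_nat; case: (i == j).
have [bk ak1] := mac_picard k.
have Lk i' j' := mac_mL1 ak1 i' j'.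
rewrite /= mxE.
apply: (le_trans (le_normr_Rintegral _ _)) => //; first exact: L1_sub (Lk i j).
have aE := acZ ((k.+1)`!%:R^-1) (ac_expS k ac_Lam).
have := aE.2 t tT; rewrite /= (Rint00 lam : Lam 0 = 0) expr0n mulr0 add0r.
rewrite /exp_coeff /= [_ / _]mulrC => ->.
apply: le_Rintegral => //.
- exact: L1_sub (L1_norm (Lk i j)).
- exact: L1_sub aE.1.
move=> s st; have sT := in_sub0t tT st.
have E0 : 0 <= exp_coeff (Lam s) k by exact: exp_coeff_ge0.
apply: (le_trans (le_mulmx_sum (L s) i E0 (fun k' => IHk s k' j sT))).
rewrite -/(lam s) /exp_coeff /= factS natrM invfM -!mulrA mulrCA.
rewrite [X in _ <= _ * X]mulrCA mulKf ?pnatr_eq0//.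
by rewrite [X in _ <= X]mulrC -mulrA.
Qed.

Let S n t := \sum_(k < n) picard k t.
Definition picard_lim t : 'M[R]_p :=
  \matrix_(i, j) limn (series (fun k => picard k t i j)).

Let S_series n t i j : S n t i j = series (fun k => picard k t i j) n.
Proof. by rewrite /S summxE /series /= big_mkord. Qed.

Let cvg_S t i j : t \in `[0, T] ->
  (fun n => S n t i j) @ \oo --> picard_lim t i j.
Proof.
move=> tT; rewrite mxE.
under eq_cvg do rewrite S_series.
apply: (@normed_cvg R R^o).
apply: (@series_le_cvg R _ (exp_coeff (Lam t))) => //.
- by move=> n; rewrite /=.
- by move=> n; exact: exp_coeff_ge0.
- by move=> n; exact: picard_bound.
- exact: is_cvg_series_exp_coeff.
Qed.

Let S_bound n t i j : t \in `[0, T] -> `|S n t i j| <= expR (Lam T).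
Proof.
move=> tT; rewrite S_series /series /=.
apply: (le_trans (ler_norm_sum _ _ _)).
apply: (@le_trans _ _ (series (exp_coeff (Lam T)) n)).
  rewrite /series /=; apply: ler_sum => k _.
  apply: (le_trans (picard_bound _ _ _ tT)).
  rewrite /exp_coeff /= ler_wpM2r ?invr_ge0//.
  by rewrite lerXn2r ?nnegrE// Lam_le.
apply: nondecreasing_cvgn_le; last exact: is_cvg_series_exp_coeff.
by apply: nondecreasing_series => k _ _; exact: exp_coeff_ge0.
Qed.

Let S_rec n t : t \in `[0, T] ->
  S n.+1 t = 1%:M + mx_integral `[0, t] (fun s => L s *m S n s).
Proof.
move=> tT; rewrite /S big_ord_recl /=; congr (_ + _).
apply/matrixP => i j; rewrite mxE summxE.
transitivity (\sum_(k < n) \int[mu]_(s in `[0, t]) (L s *m picard k s) i j).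
  by apply: eq_bigr => k _; rewrite mxE.
have aP (k : 'I_n) := (mac_picard k).2 i j.
have := (@ac_sum _ T T_gt0 _ _ _ aP).2 t tT.
rewrite /= [X in _ = X + _]big1; last first.
  by move=> k _; rewrite mxE Rint00.
rewrite add0r => eS; transitivity (\sum_(k < n) picard k.+1 t i j).
  by apply: eq_bigr => k _; rewrite /= mxE.
rewrite [LHS]eS; apply: eq_Rintegral => s _.
by rewrite mulmx_sumr summxE.
Qed.

(** Sum of the Picard iterates. The partial sums are bounded by [expR (Lam T)], so
    that dominated convergence passes to the limit in the integral equation although
    [L] is only integrable. *)
Lemma linear_ode_exists : exists Phi : R -> 'M[R]_p,
  Phi 0 = 1%:M /\ mac T Phi (fun t => L t *m Phi t).
Proof.
have S_L1 n : mL1 T (S n).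
  move=> i j; rewrite /S.
  apply: (L1_eq _ (@L1_sum _ T _ _ (fun k : 'I_n => bmeas_L1 ((mac_picard k).1 i j)))).
  by move=> t _; rewrite summxE.
have lim_bm : mbm T picard_lim.
  move=> i j; split.
    apply: (@measurable_fun_cvg _ _ _ _ (fun n t => S n t i j)).
      by move=> n; exact: L1_meas (S_L1 n i j).
    by move=> t tT; exact: cvg_S.
  exists (expR (Lam T)) => t tT.
  have cn := cvg_norm (@cvg_S t i j tT).
  apply: (@ler_cvg_to _ _ _ _ _ (cst (expR (Lam T))) _ _ (cn _) (cvg_cst _)) => //.
  by apply: nearW => n; exact: S_bound.
have cS t i j : t \in `[0, T] -> (fun n => S n.+1 t i j) @ \oo --> picard_lim t i j.
  by move=> tT; rewrite (cvg_shiftS (fun n => S n t i j)); exact: cvg_S.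
exists picard_lim; split.
  apply/matrixP => i j.
  have cS' : (fun n => S n.+1 0 i j) @ \oo --> (1%:M : 'M[R]_p) i j.
    under eq_cvg do rewrite S_rec ?in0T// mxE [X in _ + X]mxE Rint00 addr0.
    exact: cvg_cst.
  rewrite -(cvg_lim _ cS')//; apply/esym/cvg_lim => //.
  by apply: cS; exact: in0T.
have LP_L1 : mL1 T (fun t => L t *m picard_lim t) by exact: mL1Mr.
suff e t : t \in `[0, T] ->
    picard_lim t = 1%:M + mx_integral `[0, t] (fun s => L s *m picard_lim s).
  apply: mac_eq (mac_int T_gt0 1%:M LP_L1) => // t tT.
  by rewrite e.
move=> tT; apply/matrixP => i j.
rewrite -(cvg_lim _ (cS t i j tT))//; apply: cvg_lim => //.
under eq_cvg do rewrite S_rec// mxE [X in _ + X]mxE.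
rewrite mxE [X in _ + X]mxE; apply: cvgD; first exact: cvg_cst.
have LS_L1 n : mL1 T (fun s => L s *m S n s).
  apply: mL1Mr => // k l; rewrite /S.
  apply: (bmeas_eq _ (@bmeas_sum _ T _ _ (fun m : 'I_n => (mac_picard m).1 k l))).
  by move=> s _; rewrite summxE.
apply: (@Rdominated_convergence _ (fun n s => (L s *m S n s) i j)
   (fun s => (L s *m picard_lim s) i j) (fun s => lam s * expR (Lam T)) _ _ _ _ _).2.
- exact: measurable_itv.
- by move=> n; exact: L1_meas (L1_sub tT (LS_L1 n i j)).
- move=> s st; have sT := in_sub0t tT st.
  under eq_cvg do rewrite mxE; rewrite mxE.
  apply: cvg_big => [|k _]; first exact: add_continuous.
  apply: cvgM; first exact: cvg_cst.
  exact: cvg_S.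
- apply: (L1_sub tT (L1Mr lam_L1 (bmeas_cst T _))).
- move=> n s st; have sT := in_sub0t tT st.
  apply: le_mulmx_sum; first exact: expR_ge0.
  by move=> k; exact: S_bound.
Qed.

End LinearODE.

Section FundamentalMatrix.
Context (R : realType) (T : R).
Hypothesis T_gt0 : 0 < T.
Variables (p : nat) (L : R -> 'M[R]_p).
Hypothesis L_L1 : mL1 T L.

(** Uniqueness for linear equations costs nothing once the adjoint equation
    [Psi' = - Psi L] is solved as well: [Psi] times any solution of [X' = L X]
    is constant. *)
Lemma fundamental_pair : exists Phi Psi : R -> 'M[R]_p,
  [/\ Phi 0 = 1%:M, Psi 0 = 1%:M,
      mac T Phi (fun t => L t *m Phi t),
      mac T Psi (fun t => - (Psi t *m L t)) &
      forall t, t \in `[0, T] ->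
        Phi t *m Psi t = 1%:M /\ Psi t *m Phi t = 1%:M].
Proof.
have [Phi [Phi0 aPhi]] := linear_ode_exists T_gt0 L_L1.
have [Y [Y0 aY]] := linear_ode_exists T_gt0 (mL1N (mL1_tr L_L1)).
exists Phi, (fun t => (Y t)^T); rewrite Phi0 Y0 trmx1.
have aPsi : mac T (fun t => (Y t)^T) (fun t => - ((Y t)^T *m L t)).
  apply: mac_eq (mac_tr T_gt0 aY) => // t _.
  by rewrite mulNmx linearN /= trmx_mul trmxK.
split=> // t tT.
have PsiPhi : (Y t)^T *m Phi t = 1%:M.
  have aM : mac T (fun t => (Y t)^T *m Phi t) (fun=> 0).
    apply: mac_eq (macM T_gt0 aPsi aPhi) => // s _.
    by rewrite mulNmx mulmxA addNr.
  by rewrite (mac0_cst T_gt0 aM tT) Phi0 Y0 trmx1 mulmx1.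
by split=> //; exact: mulmx1C.
Qed.

Lemma linear_ode_unique q (X : R -> 'M[R]_(p, q)) :
  mac T X (fun t => L t *m X t) -> X 0 = 0 ->
  forall t, t \in `[0, T] -> X t = 0.
Proof.
have [Phi [Psi [_ _ _ aPsi inv]]] := fundamental_pair.
move=> aX X0 t tT.
have aM : mac T (fun t => Psi t *m X t) (fun=> 0).
  apply: mac_eq (macM T_gt0 aPsi aX) => // s _.
  by rewrite mulNmx mulmxA addNr.
have := mac0_cst T_gt0 aM tT; rewrite X0 mulmx0 => /(congr1 (mulmx (Phi t))).
by rewrite mulmxA (inv t tT).1 mul1mx mulmx0.
Qed.

End FundamentalMatrix.

(** * Quadratic forms *)

(** Products are treated as atoms, so that only the additive structure is left. *)
Ltac mxadd :=
  repeat match goal with |- context [@mulmx ?K ?a ?b ?c ?A ?B] =>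
    let x := fresh "x" in set x := (@mulmx K a b c A B); move: x => x end;
  apply/matrixP => ? ?; rewrite ?mxE; ring.

(** Decides identities between matrices that hold by distributivity and
    associativity alone. *)
Ltac mxabel :=
  rewrite ?(mulmxDl, mulmxDr, mulNmx, mulmxN, opprD, opprK, mulmxA); mxadd.

Section Bilinear.
Variable R : realType.

Definition bil p q (S : 'M[R]_(p, q)) (x : 'cV[R]_p) (y : 'cV[R]_q) : R :=
  (x^T *m S *m y) 0 0.

Lemma bilE p q (S : 'M[R]_(p, q)) x y :
  bil S x y = \sum_i \sum_j x i 0 * S i j * y j 0.
Proof.
rewrite /bil mxE exchange_big; apply: eq_bigr => j _; rewrite mxE mulr_suml.
by apply: eq_bigr => i _; rewrite mxE.
Qed.

Lemma bilDl p q (S : 'M[R]_(p, q)) x x' y : bil S (x + x') y = bil S x y + bil S x' y.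
Proof. by rewrite /bil linearD /= !mulmxDl mxE. Qed.

Lemma bilDr p q (S : 'M[R]_(p, q)) x y y' : bil S x (y + y') = bil S x y + bil S x y'.
Proof. by rewrite /bil !mulmxDr mxE. Qed.

Lemma bilZl p q (S : 'M[R]_(p, q)) a x y : bil S (a *: x) y = a * bil S x y.
Proof. by rewrite /bil linearZ /= -!scalemxAl mxE. Qed.

Lemma bilZr p q (S : 'M[R]_(p, q)) a x y : bil S x (a *: y) = a * bil S x y.
Proof. by rewrite /bil -!scalemxAr mxE. Qed.

Lemma bilNl p q (S : 'M[R]_(p, q)) x y : bil S (- x) y = - bil S x y.
Proof. by rewrite -scaleN1r bilZl mulN1r. Qed.

Lemma bilNr p q (S : 'M[R]_(p, q)) x y : bil S x (- y) = - bil S x y.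
Proof. by rewrite -scaleN1r bilZr mulN1r. Qed.

Lemma bilBl p q (S : 'M[R]_(p, q)) x x' y : bil S (x - x') y = bil S x y - bil S x' y.
Proof. by rewrite bilDl bilNl. Qed.

Lemma bilBr p q (S : 'M[R]_(p, q)) x y y' : bil S x (y - y') = bil S x y - bil S x y'.
Proof. by rewrite bilDr bilNr. Qed.

Lemma bil0l p q (S : 'M[R]_(p, q)) y : bil S 0 y = 0.
Proof. by rewrite /bil trmx0 !mul0mx mxE. Qed.

Lemma bil_suml p q (S : 'M[R]_(p, q)) (I : finType) (x : I -> 'cV[R]_p) y :
  bil S (\sum_i x i) y = \sum_i bil S (x i) y.
Proof.
by apply: (big_morph (bil S ^~ y)) => [x1 x2|]; [exact: bilDl|exact: bil0l].
Qed.

Lemma bilDM p q (S S' : 'M[R]_(p, q)) x y : bil (S + S') x y = bil S x y + bil S' x y.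
Proof. by rewrite /bil mulmxDr mulmxDl mxE. Qed.

Lemma bilNM p q (S : 'M[R]_(p, q)) x y : bil (- S) x y = - bil S x y.
Proof. by rewrite /bil mulmxN mulNmx mxE. Qed.

Lemma bilBM p q (S S' : 'M[R]_(p, q)) x y : bil (S - S') x y = bil S x y - bil S' x y.
Proof. by rewrite bilDM bilNM. Qed.

Lemma bil_mull p q r (A : 'M[R]_(p, r)) (S : 'M[R]_(p, q)) x y :
  bil S (A *m x) y = bil (A^T *m S) x y.
Proof. by rewrite /bil trmx_mul !mulmxA. Qed.

Lemma bil_mulr p q r (S : 'M[R]_(p, q)) (A : 'M[R]_(q, r)) x y :
  bil S x (A *m y) = bil (S *m A) x y.
Proof. by rewrite /bil !mulmxA. Qed.

Lemma bil_tr p q (S : 'M[R]_(p, q)) x y : bil S x y = bil S^T y x.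
Proof.
rewrite /bil -[in LHS](trmxK (x^T *m S *m y)) mxE.
by rewrite !trmx_mul trmxK mulmxA.
Qed.

Lemma bil_sym p (S : 'M[R]_p) x y : S^T = S -> bil S x y = bil S y x.
Proof. by move=> Ss; rewrite bil_tr Ss. Qed.

Lemma wnormE p (S : 'M[R]_p) z : wnorm S z = bil S z z.
Proof. by []. Qed.

Lemma bil1_ge0 p (y : 'cV[R]_p) : 0 <= bil 1%:M y y.
Proof.
by rewrite /bil mulmx1 mxE; apply: sumr_ge0 => i _; rewrite mxE -expr2 sqr_ge0.
Qed.

Lemma bil1_eq0 p (y : 'cV[R]_p) : bil 1%:M y y = 0 -> y = 0.
Proof.
rewrite /bil mulmx1 mxE => /eqP.
rewrite psumr_eq0; last by move=> i _; rewrite mxE -expr2 sqr_ge0.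
move=> /allP y0; apply/matrixP => i j; rewrite ord1 mxE.
have := y0 i (mem_index_enum i); rewrite mxE -expr2 /= sqrf_eq0 => /eqP; exact.
Qed.

(** The form is nonnegative at [z + t *: S z] for all [t], while its first-order term
    in [t] is twice the squared norm of [S z]. *)
Lemma psd_null p (S : 'M[R]_p) z : psd S -> wnorm S z = 0 -> S *m z = 0.
Proof.
move=> [S_sym S_ge0]; rewrite wnormE => z0; set y := S *m z.
pose n := bil 1%:M y y; pose b := bil S y y.
have b0 : 0 <= b by exact: S_ge0.
have n0 : 0 <= n by exact: bil1_ge0.
have zy : bil S y z = n by rewrite /n /y bil_mulr mul1mx.
have H (t : R) : 0 <= t ^+ 2 * b + 2 * t * n.
  have := S_ge0 (z + t *: y); rewrite wnormE !(bilDl, bilDr) !(bilZl, bilZr).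
  rewrite z0 (bil_sym z y S_sym) zy -/b; lra.
apply: bil1_eq0; rewrite -/n; apply/eqP; rewrite eq_le n0 andbT.
(* [b + 1] instead of the minimizing denominator [b], which may vanish *)
have := H (- n / (b + 1)).
have b1 : b + 1 != 0 by rewrite gt_eqF// ltr_wpDl.
have -> : (- n / (b + 1)) ^+ 2 * b + 2 * (- n / (b + 1)) * n =
  - (n ^+ 2 * (b + 2)) / (b + 1) ^+ 2.
  by field.
rewrite mulNr oppr_ge0 pmulr_lle0 ?invr_gt0 ?exprn_gt0 ?ltr_wpDl// => h.
rewrite leNgt; apply/negP => n_gt0.
by move: h; rewrite leNgt pmulr_lgt0 ?exprn_gt0// ltr_wpDl.
Qed.

Lemma posdef_psd p (S : 'M[R]_p) : posdef S -> psd S.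
Proof.
move=> [S_sym S_gt0]; split=> // z.
by have [->|/S_gt0/ltW //] := eqVneq z 0; rewrite wnormE bil0l.
Qed.

Lemma posdef_unit p (S : 'M[R]_p) : posdef S -> S \in unitmx.
Proof.
move=> [S_sym S_gt0]; rewrite unitmxE unitfE; apply/negP => /det0P [v v0 vS].
have vT0 : v^T != 0.
  by apply: contraNneq v0 => /(congr1 trmx); rewrite trmxK trmx0 => ->.
by have := S_gt0 _ vT0; rewrite /wnorm trmxK vS mul0mx mxE ltxx.
Qed.

Lemma invmx_sym p (S : 'M[R]_p) : S^T = S -> (invmx S)^T = invmx S.
Proof. by move=> Ss; rewrite trmx_inv Ss. Qed.

Lemma psd_congr p q (S : 'M[R]_p) (A : 'M[R]_(p, q)) : psd S -> psd (A^T *m S *m A).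
Proof.
move=> [Ss S0]; split; first by rewrite !trmx_mul trmxK Ss mulmxA.
by move=> z; rewrite wnormE -bil_mulr -bil_mull; exact: S0.
Qed.

Lemma psdD p (S S' : 'M[R]_p) : psd S -> psd S' -> psd (S + S').
Proof.
move=> [Ss S0] [Ss' S0']; split; first by rewrite linearD /= Ss Ss'.
by move=> z; rewrite wnormE bilDM addr_ge0 ?S0 ?S0'.
Qed.

Lemma psd_invmx p (S : 'M[R]_p) : posdef S -> psd (invmx S).
Proof.
move=> pS; have Su := posdef_unit pS; have := psd_congr (invmx S) (posdef_psd pS).
by rewrite invmx_sym ?(proj1 pS)// mulVmx// mul1mx.
Qed.

End Bilinear.

(** * Riccati equations *)

Section MatrixCalculus2.
Context (R : realType) (T : R).
Hypothesis T_gt0 : 0 < T.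
Local Notation mu := (@lebesgue_measure R).

Lemma Rint_split f t : t \in `[0, T] -> L1 T f ->
  \int[mu]_(s in `[0, T]) f s =
  \int[mu]_(s in `[0, t]) f s + \int[mu]_(s in `[t, T]) f s.
Proof.
move=> tT Lf.
rewrite -[X in _ + X]Rintegral_itv_obnd_cbnd; last first.
  apply: integrableS Lf => //; apply: subset_itvr.
  by move: tT; rewrite in_itv /= bnd_simp => /andP[].
rewrite -(Rintegral_itvB (a := BLeft 0) (b := BRight T)) ?bnd_simp//.
- by rewrite addrC subrK.
- by move: tT; rewrite in_itv /= => /andP[].
- by move: tT; rewrite in_itv /= => /andP[].
Qed.

(** Backward integration from [T] against forward integration from [0]. *)
Lemma terminal_odeP p q (X Phi : R -> 'M[R]_(p, q)) (XT : 'M[R]_(p, q)) :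
  terminal_ode T X Phi XT <-> mac T X (fun t => - Phi t) /\ X T = XT.
Proof.
split=> [[LPhi eX]|[aX <-]].
  have XT_ : X T = XT.
    rewrite eX ?(inTT T_gt0)//; apply/matrixP => i j.
    by rewrite !mxE set_itv1 Rintegral_set1 addr0.
  split=> // i j; split.
    apply: (L1_eq _ (L1N (LPhi i j : L1 T (fun t => Phi t i j)))) => t _.
    by rewrite mxE.
  move=> t tT; rewrite (eX t tT) (eX 0 (in0T T_gt0)) !mxE.
  rewrite (Rint_split tT (LPhi i j)).
  have -> : \int[mu]_(s in `[0, t]) (- Phi s) i j = - \int[mu]_(s in `[0, t]) Phi s i j.
    under eq_Rintegral do rewrite mxE -mulN1r.
    by rewrite RintegralZl ?mulN1r//; exact: (L1_sub tT (LPhi i j)).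
  by rewrite [X in _ + X + _]addrC addrA addrK.
have LPhi : mL1 T Phi.
  by apply: mL1_eq (mL1N (mac_mL1 aX)) => t _; rewrite opprK.
split=> // t tT; apply/matrixP => i j; rewrite !mxE.
rewrite ((aX i j).2 t tT) ((aX i j).2 T (inTT T_gt0)).
have aN s : s \in `[0, T] -> \int[mu]_(r in `[0, s]) (- Phi r) i j =
    - \int[mu]_(r in `[0, s]) Phi r i j.
  move=> sT; under eq_Rintegral do rewrite mxE -mulN1r.
  by rewrite RintegralZl ?mulN1r//; exact: (L1_sub sT (LPhi i j)).
rewrite !aN ?(inTT T_gt0)// (Rint_split tT (LPhi i j)).
by rewrite opprD addrA subrK.
Qed.

Lemma mac_usub p1 p2 q (F f : R -> 'M[R]_(p1 + p2, q)) : mac T F f ->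
  mac T (fun t => usubmx (F t)) (fun t => usubmx (f t)).
Proof. by move=> aF i j; apply: (ac_eq T_gt0 _ _ (aF (lshift _ i) j)) => t _; rewrite mxE. Qed.

Lemma mac_dsub p1 p2 q (F f : R -> 'M[R]_(p1 + p2, q)) : mac T F f ->
  mac T (fun t => dsubmx (F t)) (fun t => dsubmx (f t)).
Proof. by move=> aF i j; apply: (ac_eq T_gt0 _ _ (aF (rshift _ i) j)) => t _; rewrite mxE. Qed.

Lemma mL1_block p1 p2 q1 q2 (a : R -> 'M[R]_(p1, q1)) (b : R -> 'M[R]_(p1, q2))
    (c : R -> 'M[R]_(p2, q1)) (d : R -> 'M[R]_(p2, q2)) :
  mL1 T a -> mL1 T b -> mL1 T c -> mL1 T d ->
  mL1 T (fun t => block_mx (a t) (b t) (c t) (d t)).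
Proof.
move=> La Lb Lc Ld i j.
case: (split_ordP i) => k ->; case: (split_ordP j) => l ->.
- by apply: (L1_eq _ (La k l)) => t _; rewrite block_mxEul.
- by apply: (L1_eq _ (Lb k l)) => t _; rewrite block_mxEur.
- by apply: (L1_eq _ (Lc k l)) => t _; rewrite block_mxEdl.
- by apply: (L1_eq _ (Ld k l)) => t _; rewrite block_mxEdr.
Qed.

Lemma mbm_det p (f : R -> 'M[R]_p) : mbm T f -> bmeas T (fun t => \det (f t)).
Proof.
move=> bf; rewrite /determinant; apply: bmeas_sum => s.
by apply: bmeasM; [exact: bmeas_cst|apply: bmeas_prod => i; exact: bf].
Qed.

Lemma mac_det_continuous p (F f : R -> 'M[R]_p) : mac T F f ->
  {within `[0, T], continuous (fun t => \det (F t))}.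
Proof.
move=> aF t; rewrite /determinant.
apply: cvg_big => [|s _]; first exact: add_continuous.
apply: cvgM; first exact: cvg_cst.
apply: cvg_big => [|i _]; first exact: mul_continuous.
have cF := ac_continuous T_gt0 (aF i (perm.fun_of_perm s i)).
move: (cF t); rewrite /from_subspace /=.
exact.
Qed.

(** Boundedness of the inverse comes from compactness: the determinant is
    continuous and does not vanish on the interval. *)
Lemma mbm_invmx p (F f : R -> 'M[R]_p) : mac T F f ->
  (forall t, t \in `[0, T] -> F t \in unitmx) -> mbm T (fun t => invmx (F t)).
Proof.
move=> aF uF i j.
have bF := mac_mbm T_gt0 aF.
have bV : bmeas T (fun t => (\det (F t))^-1).
  apply: (continuous_bmeas T_gt0); apply/subspace_continuousP => t tT.
  apply: cvgV; first by have := uF t tT; rewrite unitmxE unitfE.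
  by move: (mac_det_continuous aF) => /subspace_continuousP; apply.
have bA : bmeas T (fun t => \adj (F t) i j).
  apply: (bmeas_eq (f := fun t => (-1) ^+ (j + i) * \det (row' j (col' i (F t))))).
    by move=> t _; rewrite mxE.
  apply: bmeasM; first exact: bmeas_cst.
  apply: mbm_det => k l.
  by apply: (bmeas_eq _ (bF (lift j k) (lift i l))) => t _; rewrite !mxE.
apply: (bmeas_eq _ (bmeasM bV bA)) => t tT.
by rewrite /invmx (uF t tT) !mxE.
Qed.

Lemma ac_bil p q (M : 'M[R]_(p, q)) x f y g : mac T x f -> mac T y g ->
  ac T (fun t => bil M (x t) (y t)) (fun t => bil M (f t) (y t) + bil M (x t) (g t)).
Proof.
move=> ax ay.
have := macM T_gt0 (macM T_gt0 (mac_tr T_gt0 ax) (mac_cst T_gt0 M)) ay => /(_ 0 0).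
by apply: (ac_eq T_gt0) => t _ //; rewrite mulmx0 addr0 mxE.
Qed.

End MatrixCalculus2.

Section Riccati.
Context (R : realType) (T : R).
Hypothesis T_gt0 : 0 < T.
Local Notation mu := (@lebesgue_measure R).
Variables (p : nat) (a q : R -> 'M[R]_p) (S h : 'M[R]_p).
Hypotheses (a_L1 : mL1 T a) (q_L1 : mL1 T q).

Definition ric (X : R -> 'M[R]_p) t :=
  (a t)^T *m X t + X t *m a t - X t *m S *m X t + q t.

(** The difference of two solutions solves a Sylvester equation
    [E' = - (M1 E + E M2)], hence is conjugated to a constant by the
    fundamental matrices of [M1] and [M2]. *)
Lemma riccati_unique X Y : terminal_ode T X (ric X) h ->
  terminal_ode T Y (ric Y) h -> forall t, t \in `[0, T] -> X t = Y t.
Proof.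
move=> /(terminal_odeP T_gt0)[aX XT] /(terminal_odeP T_gt0)[aY YT].
pose M1 t := (a t)^T - X t *m S; pose M2 t := a t - S *m Y t.
have bX := mac_mbm T_gt0 aX; have bY := mac_mbm T_gt0 aY.
have L1M1 : mL1 T M1.
  apply: mL1B; first exact: mL1_tr.
  by apply: mL1Mr => //; [exact: mbm_mL1|exact: mbm_cst].
have L1M2 : mL1 T M2.
  apply: mL1B => //; apply: mL1Ml; first exact: mbm_cst.
  exact: mbm_mL1.
have [F1 [G1 [_ _ _ aG1 inv1]]] := fundamental_pair T_gt0 (mL1N L1M1).
have [F2 [G2 [_ _ aF2 _ inv2]]] := fundamental_pair T_gt0 L1M2.
have aE : mac T (fun t => G1 t *m (X t - Y t) *m F2 t) (fun=> 0).
  apply: (mac_eq T_gt0 _ _ (macM T_gt0 (macM T_gt0 aG1 (macB T_gt0 aX aY)) aF2)) => // t _.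
  by rewrite /ric /M1 /M2; mxabel.
move=> t tT; have := mac0_cst T_gt0 aE tT.
rewrite -(mac0_cst T_gt0 aE (inTT T_gt0)) XT YT subrr mulmx0 mul0mx.
move=> /(congr1 (fun M => F1 t *m M *m G2 t)).
rewrite mulmx0 mul0mx -!mulmxA (inv2 t tT).1 mulmx1 mulmxA (inv1 t tT).1 mul1mx.
by move=> /eqP; rewrite subr_eq0 => /eqP.
Qed.

Hypotheses (S_psd : psd S) (h_psd : psd h).
Hypothesis q_psd : forall t, t \in `[0, T] -> psd (q t).

Let Ham t := block_mx (a t) (- S) (- q t) (- (a t)^T).

Let Ham_L1 : mL1 T Ham.
Proof.
apply: mL1_block => //; [exact: mL1_cst|exact: mL1N|].
by apply: mL1N; exact: mL1_tr.
Qed.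

(** Linearization of the Riccati equation: if [P] solves it and [X' = (a - S P) X],
    then [X] and [Y = P X] form a solution of this system. *)
Lemma hamiltonian_solution : exists X Y : R -> 'M[R]_p,
  [/\ mac T X (fun t => a t *m X t - S *m Y t),
      mac T Y (fun t => - (q t *m X t) - (a t)^T *m Y t),
      X T = 1%:M & Y T = h].
Proof.
have [Phi [Psi [_ _ aPhi _ inv]]] := fundamental_pair T_gt0 Ham_L1.
pose Z t := Phi t *m (Psi T *m col_mx 1%:M h).
have aZ : mac T Z (fun t => Ham t *m Z t).
  apply: (mac_eq T_gt0 _ _ (macM T_gt0 aPhi (mac_cst T_gt0 _))) => // t _.
  by rewrite mulmx0 addr0 /Z -mulmxA.
have ZT : Z T = col_mx 1%:M h.
  by rewrite /Z mulmxA (inv T (inTT T_gt0)).1 mul1mx.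
have HZ t : Ham t *m Z t = col_mx (a t *m usubmx (Z t) - S *m dsubmx (Z t))
    (- (q t *m usubmx (Z t)) - (a t)^T *m dsubmx (Z t)).
  by rewrite -{1}[Z t]vsubmxK mul_block_col !mulNmx.
exists (fun t => usubmx (Z t)), (fun t => dsubmx (Z t)); split.
- by apply: (mac_eq T_gt0 _ _ (mac_usub T_gt0 aZ)) => // t _; rewrite HZ col_mxKu.
- by apply: (mac_eq T_gt0 _ _ (mac_dsub T_gt0 aZ)) => // t _; rewrite HZ col_mxKd.
- by rewrite ZT col_mxKu.
- by rewrite ZT col_mxKd.
Qed.

(** Energy argument: along a vector [v] killed by [X t0], the pairing
    [(X v)^T (Y v)] vanishes at [t0], is nonnegative at [T] and does not
    increase; hence it is constant, [S Y v] vanishes and [X v] solves a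
    homogeneous equation, which forces [v = X T v = 0]. *)
Lemma hamiltonian_unit X Y :
  mac T X (fun t => a t *m X t - S *m Y t) ->
  mac T Y (fun t => - (q t *m X t) - (a t)^T *m Y t) ->
  X T = 1%:M -> Y T = h -> forall t, t \in `[0, T] -> X t \in unitmx.
Proof.
move=> aX aY XT YT t0 t0T; rewrite unitmxE unitfE -det_tr.
apply/negP => /det0P [w w0 wX].
pose v := w^T.
have Xv : X t0 *m v = 0 by rewrite -[X t0]trmxK -trmx_mul wX trmx0.
pose x t := X t *m v; pose y t := Y t *m v.
have ax : mac T x (fun t => a t *m x t - S *m y t).
  apply: (mac_eq T_gt0 _ _ (macM T_gt0 aX (mac_cst T_gt0 v))) => // t _.
  by rewrite mulmx0 addr0 mulmxBl -!mulmxA.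
have ay : mac T y (fun t => - (q t *m x t) - (a t)^T *m y t).
  apply: (mac_eq T_gt0 _ _ (macM T_gt0 aY (mac_cst T_gt0 v))) => // t _.
  by rewrite mulmx0 addr0 mulmxBl mulNmx -!mulmxA.
have xt0 : x t0 = 0 by [].
have xT : x T = v by rewrite /x XT mul1mx.
have yT : y T = h *m v by rewrite /y YT.
clearbody x y.
pose g t := bil S (y t) (y t) + bil (q t) (x t) (x t).
have aphi : ac T (fun t => bil 1%:M (x t) (y t)) (fun t => - g t).
  apply: (ac_eq T_gt0 _ _ (ac_bil T_gt0 1%:M ax ay)) => t tT //.
  rewrite bilBl bilBr bilNr !bil_mull !bil_mulr !mulmx1 !mul1mx.
  by rewrite (proj1 S_psd) /g; ring.
have Tle : t0 <= T by move: t0T; rewrite in_itv /= => /andP[].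
have sub : forall s, s \in `]t0, T] -> s \in `[0, T].
  move=> s; move: t0T; rewrite !in_itv /= => /andP[t00 _] /andP[/ltW ts ->].
  by rewrite (le_trans t00 ts).
have g0 s : s \in `[0, T] -> 0 <= g s.
  move=> sT; rewrite addr_ge0 //; first exact: (proj2 S_psd).
  exact: (proj2 (q_psd sT)).
have Lg : L1 T g.
  by apply: (L1_eq _ (L1N aphi.1)) => s _; rewrite opprK.
have iLg : mu.-integrable `]t0, T] (EFin \o g).
  apply: integrableS Lg => //; exact: sub.
have int0 : (\int[mu]_(s in `]t0, T]) `|(g s)%:E| = 0)%E.
  have := ac_incr aphi t0T (inTT T_gt0) Tle.
  rewrite xt0 xT yT bil0l subr0 => e.
  have e' : \int[mu]_(s in `]t0, T]) g s = - bil 1%:M v (h *m v).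
    rewrite e -[LHS]opprK; congr (- _); rewrite -mulN1r -RintegralZl//.
    by apply: eq_Rintegral => s _; rewrite mulN1r.
  have le0 : \int[mu]_(s in `]t0, T]) g s <= 0.
    by rewrite e' oppr_le0 bil_mulr mul1mx; exact: (proj2 h_psd).
  have ge0 : 0 <= \int[mu]_(s in `]t0, T]) g s.
    by apply: Rintegral_ge0 => s /sub; exact: g0.
  have e0 : \int[mu]_(s in `]t0, T]) g s = 0 by apply/eqP; rewrite eq_le le0.
  have : (\int[mu]_(s in `]t0, T]) (g s)%:E = 0)%E.
    by move: e0; rewrite /Rintegral => e0; rewrite -[LHS]fineK ?e0//; exact: integrable_fin_num.
  move=> <-; apply: eq_integral => s; rewrite inE /= => /sub sT.
  by rewrite ger0_norm// g0.
have ae0 : ae_eq mu `]t0, T]%classic (EFin \o g) (cst 0%E).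
  apply/ae_eq_integral_abs => //; exact: measurable_int iLg.
have Sy0 s : s \in `[0, T] -> g s = 0 -> S *m y s = 0.
  move=> sT gs; apply: (psd_null S_psd); apply/eqP; rewrite wnormE eq_le.
  rewrite (proj2 S_psd (y s)) andbT.
  have := proj2 (q_psd sT) (x s); rewrite wnormE; move: gs; rewrite /g; lra.
have [Phi [Psi [_ _ _ aPsi inv]]] := fundamental_pair T_gt0 a_L1.
have aPx : mac T (fun t => Psi t *m x t) (fun t => - (Psi t *m (S *m y t))).
  apply: (mac_eq T_gt0 _ _ (macM T_gt0 aPsi ax)) => // t _.
  by mxabel.
have := mac_incr aPx t0T (inTT T_gt0) Tle.
have -> : mx_integral `]t0, T] (fun t => - (Psi t *m (S *m y t))) = 0.
  apply/matrixP => i j; rewrite !mxE /Rintegral.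
  rewrite (_ : integral _ _ _ = 0%E)//.
  transitivity (\int[mu]_(s in `]t0, T]) (cst 0 s : \bar R))%E; last exact: integral0.
  apply: ae_eq_integral => //.
  - apply/measurable_EFinP.
    have := L1_meas (mac_mL1 aPx i j); apply: measurable_funS => //.
  - move: ae0; apply: filterS => s + sT => /(_ sT) [gs].
    by rewrite Sy0 ?mulmx0 ?oppr0 ?mxE//; exact: sub.
rewrite xt0 mulmx0 subr0 xT => /(congr1 (mulmx (Phi T))).
rewrite mulmxA (inv T (inTT T_gt0)).1 mul1mx mulmx0 => v0.
by move/negP: w0; apply; rewrite -(trmxK w) -/v v0 trmx0.
Qed.

(** The solution is [Y X^-1] for the Hamiltonian pair [(X, Y)]. The derivative of
    [X^-1] is found without differentiating inverses: with [c = a - S Y X^-1] one has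
    [X' = c X], and [X^-1] is a constant times the solution [Psi] of the adjoint
    equation. *)
Lemma riccati_exists : exists P, terminal_ode T P (ric P) h.
Proof.
have [X [Y [aX aY XT YT]]] := hamiltonian_solution.
have uX := hamiltonian_unit aX aY XT YT.
have bXV := mbm_invmx T_gt0 aX uX.
have bY := mac_mbm T_gt0 aY.
pose c t := a t - S *m Y t *m invmx (X t).
have c_L1 : mL1 T c.
  apply: mL1B => //; apply: mL1Ml => //; last exact: mbm_mL1.
  by apply: mbmM => //; exact: mbm_cst.
have [_ [Psi [_ Psi0 _ aPsi _]]] := fundamental_pair T_gt0 c_L1.
have PsiX t : t \in `[0, T] -> Psi t *m X t = X 0.
  move=> tT; have aM : mac T (fun t => Psi t *m X t) (fun=> 0).
    apply: (mac_eq T_gt0 _ _ (macM T_gt0 aPsi aX)) => // s sT.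
    have cX : c s *m X s = a s *m X s - S *m Y s by rewrite /c mulmxBl mulmxKV ?uX.
    by rewrite mulNmx -[Psi s *m _ *m _]mulmxA cX addNr.
  by rewrite (mac0_cst T_gt0 aM tT) Psi0 mul1mx.
have X0u := uX 0 (in0T T_gt0).
have aXV : mac T (fun t => invmx (X t)) (fun t => - (invmx (X t) *m c t)).
  have e t : t \in `[0, T] -> invmx (X 0) *m Psi t = invmx (X t).
    move=> tT; rewrite -[LHS](mulmxK (uX t tT)) -[_ *m Psi t *m X t]mulmxA PsiX//.
    by rewrite mulVmx// mul1mx.
  apply: (mac_eq T_gt0 _ _ (macM T_gt0 (mac_cst T_gt0 (invmx (X 0))) aPsi)).
    exact: e.
  by move=> t tT; rewrite mul0mx add0r mulmxN mulmxA e.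
exists (fun t => Y t *m invmx (X t)); apply/(terminal_odeP T_gt0); split; last first.
  by rewrite XT YT invmx1 mulmx1.
apply: (mac_eq T_gt0 _ _ (macM T_gt0 aY aXV)) => // t tT.
rewrite mulmxBl mulNmx mulmxK ?uX// /ric /c.
by mxabel.
Qed.

End Riccati.

(** * The linear-quadratic problem along a path *)

Section LQPath.
Context (R : realType) (T : R).
Hypothesis T_gt0 : 0 < T.
Local Notation mu := (@lebesgue_measure R).

Lemma L1_bil p q (M : R -> 'M[R]_(p, q)) x y : mL1 T M -> mbm T x -> mbm T y ->
  L1 T (fun t => bil (M t) (x t) (y t)).
Proof. by move=> LM bx by_; exact: (mL1Mr (mL1Ml (mbm_tr bx) LM) by_ 0 0). Qed.

Lemma L1_bil_L2 p q (M : R -> 'M[R]_(p, q)) x y : mL2 T M -> mL2 T x -> mbm T y ->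
  L1 T (fun t => bil (M t) (x t) (y t)).
Proof.
move=> LM Lx by_.
have := mL2M (mL2_tr Lx) (mL2Mr LM by_) => /(_ 0 0).
by apply: L1_eq => t _; rewrite mulmxA.
Qed.

Lemma L1_bil_cst p q (M : 'M[R]_(p, q)) x y : mL2 T x -> mL2 T y ->
  L1 T (fun t => bil M (x t) (y t)).
Proof. by move=> Lx Ly; exact: (mL2M (mL2Mr (mL2_tr Lx) (mbm_cst T M)) Ly 0 0). Qed.

Variables (p m : nat).
Variables (a : R -> 'M[R]_p) (B : 'M[R]_(p, m)) (q : R -> 'M[R]_p).
Variables (N : R -> 'M[R]_(m, p)) (Rw : 'M[R]_m) (h : 'M[R]_p).

(** Completing the square in the control removes the cross weight [N]: these are the
    coefficients of the Riccati equation, and the feedback, of the resulting problem. *)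
Definition lq_a t := a t - B *m invmx Rw *m N t.
Definition lq_S := B *m invmx Rw *m B^T.
Definition lq_q t := q t - (N t)^T *m invmx Rw *m N t.
Definition lq_gain (Pi : R -> 'M[R]_p) t := invmx Rw *m (B^T *m Pi t + N t).

Definition lq_run t (z : 'cV[R]_p) (u : 'cV[R]_m) : R :=
  wnorm (q t) z + wnorm Rw u + 2 * bil (N t) u z.

Hypotheses (a_L1 : mL1 T a) (q_L1 : mL1 T q) (N_L2 : mL2 T N).
Hypotheses (Rw_sym : Rw^T = Rw) (Rw_unit : Rw \in unitmx).
Hypotheses (h_psd : psd h) (q_sym : forall t, (q t)^T = q t).
Hypothesis run_ge0 : forall t z u, t \in `[0, T] -> 0 <= lq_run t z u.

Variable Pi : R -> 'M[R]_p.
Hypothesis Pi_ric : terminal_ode T Pi (ric lq_a lq_q lq_S Pi) h.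
Local Notation ricPi := (ric lq_a lq_q lq_S Pi).

(** First-order condition: the feedback makes the derivative of the running
    cost cancel the Riccati terms of the derivative of [d^T Pi z]. *)
Lemma lq_stationary t (z d : 'cV[R]_p) (w u : 'cV[R]_m) :
  u = - (lq_gain Pi t *m z) ->
  bil (q t) z d + bil Rw u w + bil (N t) u d + bil (N t) w z
  + (bil (Pi t) (a t *m d + B *m w) z - bil (ricPi t) d z
     + bil (Pi t) d (a t *m z + B *m u)) = 0.
Proof.
move=> ->; rewrite (bil_sym z d (q_sym t)) (bil_sym _ w Rw_sym).
rewrite [bil (N t) _ d]bil_tr /lq_gain /ric /lq_a /lq_S /lq_q.
move: (Pi t) (a t) (q t) (N t) => P A Q NN.
have Ri : (invmx Rw)^T = invmx Rw by exact: invmx_sym.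
have E : (A - B *m invmx Rw *m NN)^T = A^T - NN^T *m invmx Rw *m B^T.
  by rewrite linearB /= !trmx_mul Ri mulmxA.
rewrite E !(bilDl, bilDr, bilNr, bilNl, bil_mull, bil_mulr).
rewrite mulKVmx//.
rewrite !(mulmxDl, mulmxDr, mulmxN, mulNmx, mulmxA).
rewrite !(bilDM, bilNM).
by ring.
Qed.

Variables (z y M : R -> 'cV[R]_p) (u v : R -> 'cV[R]_m).
Hypotheses (M_bm : mbm T M) (v_L2 : mL2 T v).
Hypothesis z_ode : mac T (fun t => z t - M t) (fun t => a t *m z t + B *m u t).
Hypothesis y_ode : mac T (fun t => y t - M t) (fun t => a t *m y t + B *m v t).
Hypothesis zy0 : z 0 = y 0.
Hypothesis u_fb : forall t, t \in `[0, T] -> u t = - (lq_gain Pi t *m z t).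

Let Pi_mac : mac T Pi (fun t => - ricPi t).
Proof. by case: ((terminal_odeP T_gt0 _ _ _).1 Pi_ric). Qed.

Let PiT : Pi T = h.
Proof. by case: ((terminal_odeP T_gt0 _ _ _).1 Pi_ric). Qed.

Let Pi_bm := mac_mbm T_gt0 Pi_mac.

Lemma mbm_of_mac_noise (x f : R -> 'cV[R]_p) :
  mac T (fun t => x t - M t) f -> mbm T x.
Proof.
move=> /(mac_mbm T_gt0) /mbmD /(_ M_bm) bx i j.
by apply: (bmeas_eq _ (bx i j)) => t _; rewrite subrK.
Qed.

Let z_bm := mbm_of_mac_noise z_ode.
Let y_bm := mbm_of_mac_noise y_ode.

Lemma lq_gain_L2 : mL2 T (lq_gain Pi).
Proof.
apply: mL2Ml; first exact: mbm_cst.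
apply: mL2D => //; apply: mbm_mL2; apply: mbmM => //; exact: mbm_cst.
Qed.

Let u_L2 : mL2 T u.
Proof.
apply: (mL2_eq _ (mL2N (mL2Mr lq_gain_L2 z_bm))) => t tT.
by rewrite u_fb.
Qed.

Lemma lq_run_L1 (x : R -> 'cV[R]_p) (w : R -> 'cV[R]_m) : mbm T x -> mL2 T w ->
  L1 T (fun t => lq_run t (x t) (w t)).
Proof.
move=> bx Lw; apply: L1D; last by apply: L1Zl; exact: L1_bil_L2.
by apply: L1D; [exact: L1_bil|exact: L1_bil_cst].
Qed.

Let d t := y t - z t.
Let w t := v t - u t.

Let d_mac : mac T d (fun t => a t *m d t + B *m w t).
Proof.
apply: (mac_eq T_gt0 _ _ (macB T_gt0 y_ode z_ode)) => t _.
  by rewrite /d opprB addrA subrK.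
by rewrite /d /w !mulmxBr opprD addrACA.
Qed.

(** The first-order variation of the cost at the feedback. The noise enters only
    through later increments [M T - M t]; this is what makes its mean vanish. *)
Definition lq_cross t : R :=
  bil 1%:M (v t - u t) (B^T *m Pi t *m (M T - M t)) +
  bil 1%:M (y t - z t) (((a t)^T *m Pi t - ricPi t) *m (M T - M t)).

(* [z] is not absolutely continuous, but [z - M] is; adding the constant [M T] gives a
   function with the same value as [z] at time [T] *)
Let phi_ac : ac T (fun t => bil (Pi t) (d t) (z t - M t + M T))
  (fun t => bil (Pi t) (a t *m d t + B *m w t) (z t - M t + M T)
          - bil (ricPi t) (d t) (z t - M t + M T)
          + bil (Pi t) (d t) (a t *m z t + B *m u t)).
Proof.
have ak := macD T_gt0 z_ode (mac_cst T_gt0 (M T)).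
have := macM T_gt0 (macM T_gt0 (mac_tr T_gt0 d_mac) Pi_mac) ak => /(_ 0 0).
apply: (ac_eq T_gt0) => t _ //.
by rewrite addr0 mulmxDl mulmxN mulNmx /bil !mxE.
Qed.

Let b t := bil (q t) (z t) (d t) + bil Rw (u t) (w t) + bil (N t) (u t) (d t)
           + bil (N t) (w t) (z t).

Let d_bm : mbm T d. Proof. exact: mac_mbm d_mac. Qed.
Let w_L2 : mL2 T w. Proof. by apply: mL2D => //; exact: mL2N. Qed.

Let b_L1 : L1 T b.
Proof.
apply: L1D; last exact: L1_bil_L2.
apply: L1D; last exact: L1_bil_L2.
by apply: L1D; [exact: L1_bil|exact: L1_bil_cst].
Qed.

Let cross_eq t : t \in `[0, T] ->
  lq_cross t = b t + (bil (Pi t) (a t *m d t + B *m w t) (z t - M t + M T)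
          - bil (ricPi t) (d t) (z t - M t + M T)
          + bil (Pi t) (d t) (a t *m z t + B *m u t)).
Proof.
move=> tT; have := lq_stationary (d t) (w t) (u_fb tT).
have -> : z t - M t + M T = z t + (M T - M t) by rewrite addrAC -addrA.
rewrite /lq_cross -/(d t) -/(w t) /b.
move: (d t) (w t) (M T - M t) (z t) (u t) (ricPi t) => dd ww k zz uu rr.
rewrite !(bilDl, bilDr, bil_mull, bil_mulr) !mul1mx !(bilDM, bilNM).
by lra.
Qed.

Definition lq_cost (x : R -> 'cV[R]_p) (k : R -> 'cV[R]_m) : R :=
  \int[mu]_(t in `[0, T]) lq_run t (x t) (k t) + wnorm h (x T).

Lemma lq_run_expand t : lq_run t (y t) (v t) =
  lq_run t (z t) (u t) + lq_run t (d t) (w t) + 2 * b t.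
Proof.
have -> : y t = z t + d t by rewrite /d addrC subrK.
have -> : v t = u t + w t by rewrite /w addrC subrK.
rewrite /lq_run !wnormE /b; move: (d t) (w t) (z t) (u t) => dd ww zz uu.
rewrite !(bilDl, bilDr) (bil_sym dd zz (q_sym t)) (bil_sym ww uu Rw_sym).
by ring.
Qed.

(** Convexity: the second-order term [lq_cost d w] is nonnegative, and the
    first-order term equals the integral of [lq_cross] because the Riccati
    equation turns it into the total derivative of [d^T Pi (z - M + M T)]. *)
Lemma lq_cost_ge : lq_cost z u + 2 * \int[mu]_(t in `[0, T]) lq_cross t
  <= lq_cost y v.
Proof.
have Lz := lq_run_L1 z_bm u_L2.
have Ld := lq_run_L1 d_bm w_L2.
have e1 : \int[mu]_(t in `[0, T]) lq_run t (y t) (v t) =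
    \int[mu]_(t in `[0, T]) lq_run t (z t) (u t) +
    \int[mu]_(t in `[0, T]) lq_run t (d t) (w t) +
    2 * \int[mu]_(t in `[0, T]) b t.
  rewrite -RintegralZl// -!RintegralD//; last 2 first.
    exact: (L1D Lz Ld).
    exact: (L1Zl 2 b_L1).
  by apply: eq_Rintegral => t _; exact: lq_run_expand.
have d0 : d 0 = 0 by rewrite /d zy0 subrr.
have e2 : \int[mu]_(t in `[0, T]) lq_cross t =
    \int[mu]_(t in `[0, T]) b t + bil h (d T) (z T).
  have := phi_ac.2 T (inTT T_gt0).
  rewrite d0 bil0l add0r PiT subrK => ->.
  rewrite -RintegralD//; last by case: phi_ac.
  by apply: eq_Rintegral => t; rewrite inE /= => tT; exact: cross_eq.
have e3 : wnorm h (y T) = wnorm h (z T) + wnorm h (d T) + 2 * bil h (d T) (z T).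
  have -> : y T = z T + d T by rewrite /d addrC subrK.
  rewrite !wnormE; move: (d T) (z T) => dd zz.
  by rewrite !(bilDl, bilDr) (bil_sym dd zz (proj1 h_psd)); ring.
have r0 : 0 <= \int[mu]_(t in `[0, T]) lq_run t (d t) (w t).
  by apply: Rintegral_ge0 => t tT; exact: run_ge0.
have h0 : 0 <= wnorm h (d T) by exact: (proj2 h_psd).
rewrite /lq_cost e1 e3 e2 -subr_ge0.
rewrite [X in _ <= X](_ : _ = \int[mu]_(t in `[0, T]) lq_run t (d t) (w t) +
  wnorm h (d T)) ?addr_ge0//.
ring.
Qed.

End LQPath.

(** * Adapted processes with continuous paths *)

Section Caratheodory.
Context (R : realType) d (Y : measurableType d) (t : R).
Local Notation mu := (@lebesgue_measure R).

(** A process with continuous paths is the pointwise limit of its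
    discretisations [f (floor (k s) / k)], which are jointly measurable. *)
Lemma continuous_process_measurable (f : R -> Y -> R) :
  (forall s, s \in `[0, t] -> measurable_fun setT (f s)) ->
  (forall w, {within `[0, t], continuous (fun s => f s w)}) ->
  measurable_fun (`[0, t]%classic `*` setT)
    (fun z : measurableTypeR R * Y => f z.1 z.2).
Proof.
move=> mf cf.
pose r k (s : R) : R := (Num.truncn (k.+1%:R * s))%:R / k.+1%:R.
have r_itv k s : 0 <= s -> r k s <= s < r k s + k.+1%:R^-1.
  move=> s0; have /truncn_itv/andP[] : 0 <= k.+1%:R * s by rewrite mulr_ge0.
  rewrite /r => le1 le2.
  have k0 : 0 < k.+1%:R :> R by [].
  rewrite ler_pdivrMr// [s * _]mulrC le1 /= -[X in _ < _ + X]mul1r -mulrDl.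
  by rewrite ltr_pdivlMr// mulrC natr1.
have r_in k s : s \in `[0, t] -> r k s \in `[0, t].
  rewrite !in_itv /= => /andP[s0 st]; have /andP[rs _] := r_itv k s s0.
  by rewrite (le_trans rs st) andbT divr_ge0.
apply: (measurable_fun_cvg (h := fun k (z : measurableTypeR R * Y) => f (r k z.1) z.2)).
  move=> k.
  pose E j : set (measurableTypeR R * Y) :=
    (`[j%:R / k.+1%:R, j.+1%:R / k.+1%:R[ `&` `[0, t]) `*` setT.
  have mE j : measurable (E j).
    by apply: measurableX => //; apply: measurableI; exact: measurable_itv.
  have rE j z : E j z -> r k z.1 = j%:R / k.+1%:R.
    move=> [[/=]]; rewrite !in_itv /= => /andP[l1 l2] /andP[s0 _] _.
    rewrite /r; congr (_%:R / _).
    apply/eqP; rewrite eqn_leq -ltnS truncn_lt_nat ?mulr_ge0//.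
    rewrite -ltr_pdivlMl// mulrC l2 /= truncn_ge_nat ?mulr_ge0//.
    by rewrite -ler_pdivrMl// mulrC.
  have -> : `[0, t]%classic `*` setT = \bigcup_j E j.
    apply/seteqP; split=> [z [/= zt _]|z [j _ [[_ zt] _]]]; last by split.
    exists (Num.truncn (k.+1%:R * z.1)) => //; split=> //; split=> //=.
    move: zt; rewrite /= !in_itv /= => /andP[s0 _].
    have := r_itv k z.1 s0; rewrite /r => /andP[-> /=].
    by rewrite -[X in _ < _ + X]mul1r -mulrDl natr1.
  apply/measurable_fun_bigcup => // j.
  have [[z0 Ez0]|E0] := pselect (exists z, E j z); last first.
    suff -> : E j = set0 by exact: measurable_fun_set0.
    by apply/seteqP; split=> // z Ez; apply: E0; exists z.
  apply: (eq_measurable_fun (fun z : measurableTypeR R * Y => f (j%:R / k.+1%:R) z.2)).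
    by move=> z; rewrite inE => /rE ->.
  apply: measurable_funTS; apply: measurableT_comp => //.
  by apply: mf; rewrite -(rE j z0 Ez0); apply: r_in; case: Ez0 => -[].
move=> [s w] [/= st _].
have := cf w => /subspace_continuousP /(_ s st).
apply: cvg_comp => //=.
move=> A; rewrite /within /= => -[e /= e0 eA].
have s0 : 0 <= s by move: st; rewrite /= in_itv /= => /andP[].
near=> k; apply: eA; last exact: r_in.
have /andP[h1 h2] := r_itv k s s0.
rewrite /ball_ /= ger0_norm ?subr_ge0// ltrBlDl (lt_trans h2)// ltrD2l.
near: k; exact: (near_infty_natSinv_lt (PosNum e0)).
Unshelve. all: by end_near. Qed.

Lemma measurable_Rint_process (g : R -> R) (f : R -> Y -> R) :
  L1 t g ->
  measurable_fun (`[0, t]%classic `*` setT)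
    (fun z : measurableTypeR R * Y => f z.1 z.2) ->
  measurable_fun setT (fun w => \int[mu]_(s in `[0, t]) (g s * f s w)).
Proof.
move=> Lg mf.
pose h (s : measurableTypeR R) (w : Y) : R := g s * f s w.
have mh : measurable_fun (`[0, t]%classic `*` setT)
    (fun z : measurableTypeR R * Y => h z.1 z.2).
  apply: measurable_funM => //.
  apply: (@measurable_fun_on_fst _ _ (measurableTypeR R) Y) => //.
  exact: L1_meas Lg.
pose hp (s : measurableTypeR R) w : R := Num.max (h s w) 0.
pose hn (s : measurableTypeR R) w : R := Num.max (- h s w) 0.
have mhp : measurable_fun (`[0, t]%classic `*` setT)
    (fun z : measurableTypeR R * Y => hp z.1 z.2).
  exact: measurable_maxr.
have mhn : measurable_fun (`[0, t]%classic `*` setT)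
    (fun z : measurableTypeR R * Y => hn z.1 z.2).
  by apply: measurable_maxr => //; exact: measurableT_comp.
rewrite [X in measurable_fun _ X](_ : _ = fun w => fine
  (\int[mu]_(s in `[0%R, t]) (hp s w)%:E - \int[mu]_(s in `[0%R, t]) (hn s w)%:E)).
  apply: measurableT_comp => //; apply: emeasurable_funB.
    apply: (@measurable_integral_on2 _ _ (measurableTypeR R) Y R mu _ _ _ _ hp mhp) => //.
    by move=> s w _ _; rewrite le_max lexx orbT.
  apply: (@measurable_integral_on2 _ _ (measurableTypeR R) Y R mu _ _ _ _ hn mhn) => //.
  by move=> s w _ _; rewrite le_max lexx orbT.
apply/funext => w; rewrite /Rintegral integralE; congr (fine (_ - _)%E).
  by apply: eq_integral => s _; rewrite funeposE /hp EFin_max.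
by apply: eq_integral => s _; rewrite funenegE /hn EFin_max EFinN.
Qed.

End Caratheodory.

Section Moments.
Context (R : realType) d (Om : measurableType d) (P : probability Om R).

Definition sqE (Z : Om -> R) : \bar R := (\int[P]_w (Z w ^+ 2)%:E)%E.

Lemma sqE_ge0 Z : (0 <= sqE Z)%E.
Proof. by apply: integral_ge0 => w _; rewrite lee_fin sqr_ge0. Qed.

Lemma measurable_sqr (Z : Om -> R) : measurable_fun setT Z ->
  measurable_fun setT (fun w => (Z w ^+ 2)%:E).
Proof. by move=> mZ; apply/measurable_EFinP; exact: measurable_funX. Qed.

Lemma sqED (Z1 Z2 : Om -> R) : measurable_fun setT Z1 -> measurable_fun setT Z2 ->
  (sqE (fun w => Z1 w + Z2 w)%R <= 2%:E * sqE Z1 + 2%:E * sqE Z2)%E.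
Proof.
move=> m1 m2; rewrite /sqE -!ge0_integralZl_EFin//; last 4 first.
- by move=> w _; rewrite lee_fin sqr_ge0.
- exact: measurable_sqr.
- by move=> w _; rewrite lee_fin sqr_ge0.
- exact: measurable_sqr.
rewrite -ge0_integralD//; last 4 first.
- by move=> w _; rewrite -EFinM lee_fin mulr_ge0 ?sqr_ge0.
- by apply: measurable_funeM; exact: measurable_sqr.
- by move=> w _; rewrite -EFinM lee_fin mulr_ge0 ?sqr_ge0.
- by apply: measurable_funeM; exact: measurable_sqr.
apply: ge0_le_integral => //.
- by move=> w _; rewrite lee_fin sqr_ge0.
- by apply: measurable_sqr; exact: measurable_funD.
- by apply: emeasurable_funD; apply: measurable_funeM; exact: measurable_sqr.
move=> w _; rewrite -!EFinM -EFinD lee_fin.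
have := sqr_ge0 (Z1 w - Z2 w); lra.
Qed.

Lemma sqEZ c (Z : Om -> R) : measurable_fun setT Z ->
  sqE (fun w => c * Z w) = ((c ^+ 2)%:E * sqE Z)%E.
Proof.
move=> mZ; rewrite /sqE -ge0_integralZl_EFin ?sqr_ge0//.
- by apply: eq_integral => w _; rewrite exprMn.
- by move=> w _; rewrite lee_fin sqr_ge0.
- exact: measurable_sqr.
Qed.

Lemma L2_prod_integrable (Z1 Z2 : Om -> R) :
  measurable_fun setT Z1 -> measurable_fun setT Z2 ->
  (sqE Z1 < +oo)%E -> (sqE Z2 < +oo)%E ->
  P.-integrable setT (EFin \o (fun w => Z1 w * Z2 w)).
Proof.
move=> m1 m2 f1 f2.
have i (Z : Om -> R) : measurable_fun setT Z -> (sqE Z < +oo)%E ->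
    P.-integrable setT (EFin \o (fun w => Z w ^+ 2)).
  move=> mZ fZ; apply/integrableP; split; first exact: measurable_sqr.
  by under eq_integral do rewrite /= ger0_norm ?sqr_ge0//.
apply: le_integrable (integrableD measurableT (i _ m1 f1) (i _ m2 f2)) => //.
  by apply/measurable_EFinP; exact: measurable_funM.
move=> w _; rewrite /= lee_fin [leRHS]ger0_norm ?addr_ge0 ?sqr_ge0// normrM.
rewrite -(real_normK (num_real (Z1 w))) -(real_normK (num_real (Z2 w))).
have := sqr_ge0 (`|Z1 w| - `|Z2 w|); have := sqr_ge0 (`|Z1 w| + `|Z2 w|); lra.
Qed.

End Moments.

(** The Cauchy-Schwarz inequality from the sign of a quadratic polynomial, including
    the degenerate case. *)
Lemma discriminant_le (R : realFieldType) (V h G : R) : 0 <= G ->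
  (forall x, 0 <= V - 2 * x * h + x ^+ 2 * G) -> h ^+ 2 <= G * V.
Proof.
move=> G0 H; have [G_eq0|Gn0] := eqVneq G 0.
  rewrite G_eq0 mul0r; have [->|hn0] := eqVneq h 0; first by rewrite expr0n.
  have := H ((V + 1) / (2 * h)); rewrite G_eq0 mulr0 addr0.
  have -> : 2 * ((V + 1) / (2 * h)) * h = V + 1 by field.
  by rewrite opprD addNKr oppr_ge0 ler10.
have Gp : 0 < G by rewrite lt_neqAle eq_sym Gn0.
have := H (h / G).
have -> : V - 2 * (h / G) * h + (h / G) ^+ 2 * G = (G * V - h ^+ 2) / G by field.
by rewrite pmulr_lge0 ?invr_gt0// subr_ge0.
Qed.

Section Filtered.
Context (R : realType) d (Om : measurableType d) (P : probability Om R) (T : R).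
Hypothesis T_gt0 : 0 < T.
Local Notation mu := (@lebesgue_measure R).
Variable gen : R -> set (set Om).
Hypothesis gen_mono : forall s t, s <= t -> gen s `<=` gen t.
Hypothesis gen_meas : forall t, t \in `[0, T] -> gen t `<=` measurable.

(** Cauchy-Schwarz for the measure [`|g s| ds]: as [g] is only integrable, it cannot
    be squared. *)
Lemma weighted_CS (g X : R -> R) t : L1 T g -> bmeas T X -> t \in `[0, T] ->
  (\int[mu]_(s in `[0, t]) (g s * X s)) ^+ 2 <=
  (\int[mu]_(s in `[0, T]) `|g s|) * \int[mu]_(s in `[0, T]) (`|g s| * X s ^+ 2).
Proof.
move=> Lg bX tT.
have LnG : L1 T (fun s => `|g s|) by exact: L1_norm.
have bnX : bmeas T (fun s => `|X s|).
  case: bX => mX [K XK]; split; first exact: measurableT_comp.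
  by exists K => s sT; rewrite normr_id XK.
have L1gX : L1 T (fun s => `|g s| * `|X s|) by exact: L1Mr.
have L1gX2 : L1 T (fun s => `|g s| * X s ^+ 2) by apply: L1Mr => //; exact: bmeasM.
have LgX : L1 T (fun s => g s * X s) by exact: L1Mr.
pose h := \int[mu]_(s in `[0, T]) (`|g s| * `|X s|).
apply: (@le_trans _ _ (h ^+ 2)).
  rewrite -(real_normK (num_real (\int[mu]_(s in _) _))).
  rewrite lerXn2r ?nnegrE//; first by apply: Rintegral_ge0 => s _; rewrite mulr_ge0.
  apply: (le_trans (le_normr_Rintegral _ _)) => //; first exact: L1_sub LgX.
  under eq_Rintegral do rewrite normrM.
  rewrite /h (Rint_split tT L1gX) lerDl.
  by apply: Rintegral_ge0 => s _; rewrite mulr_ge0.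
apply: discriminant_le; first exact: Rintegral_ge0.
move=> x.
have -> : \int[mu]_(s in `[0, T]) (`|g s| * X s ^+ 2) - 2 * x * h +
    x ^+ 2 * \int[mu]_(s in `[0, T]) `|g s| =
    \int[mu]_(s in `[0, T]) (`|g s| * (`|X s| - x) ^+ 2).
  rewrite /h -!RintegralZl// -RintegralB//; last exact: (L1Zl (2 * x) L1gX).
  rewrite -RintegralD//; last exact: (L1Zl (x ^+ 2) LnG).
    by apply: eq_Rintegral => s _; rewrite -(real_normK (num_real (X s))); ring.
  exact: (L1B L1gX2 (L1Zl (2 * x) L1gX)).
by apply: Rintegral_ge0 => s _; rewrite mulr_ge0 ?sqr_ge0.
Qed.

(** Measurability with respect to the sigma-algebra generated by [gen t]; stated with
    [g_sigma_algebraType], it inherits the closure properties of measurable functions. *)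
Definition gm t (Z : Om -> R) :=
  measurable_fun setT (Z : g_sigma_algebraType (gen t) -> R).

Lemma gm_measurable t Z : t \in `[0, T] -> gm t Z -> measurable_fun setT Z.
Proof.
move=> tT gZ _ B mB; have := gZ measurableT B mB; rewrite !setTI.
by apply: smallest_sub; [exact: sigma_algebra_measurable|exact: gen_meas].
Qed.

Lemma gm_mono s t Z : s <= t -> gm s Z -> gm t Z.
Proof.
move=> st gZ _ B mB; have := gZ measurableT B mB; rewrite !setTI.
by apply: sub_sigma_algebra2; exact: gen_mono.
Qed.

(** The class in which linear equations are solved. The uniform bound on second moments
    makes it stable under integration against integrable weights; continuity of the
    paths gives joint measurability, and adaptedness of time integrals. *)
Definition good (X : R -> Om -> R) :=
  [/\ forall w, {within `[0, T], continuous (fun s => X s w)},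
      forall s, s \in `[0, T] -> gm s (X s)
    & exists C : R, forall s, s \in `[0, T] -> (sqE P (X s) <= C%:E)%E].

Lemma good_joint X : good X -> measurable_fun (`[0, T]%classic `*` setT)
    (fun z : measurableTypeR R * Om => X z.1 z.2).
Proof.
move=> [cX gX _]; apply: continuous_process_measurable => // s sT.
exact: gm_measurable (gX s sT).
Qed.

Lemma good_bmeas X w : good X -> bmeas T (fun s => X s w).
Proof. by case=> cX _ _; exact: continuous_bmeas. Qed.

Lemma good_cst Z : gm 0 Z -> (sqE P Z < +oo)%E -> good (fun=> Z).
Proof.
move=> gZ fZ; split.
- by move=> w; apply: continuous_subspaceT => x; exact: cst_continuous.
- by move=> s; rewrite in_itv /= => /andP[s0 _]; exact: gm_mono gZ.
- exists (fine (sqE P Z)) => s _; rewrite fineK// ge0_fin_numE ?sqE_ge0//.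
Qed.

Lemma goodD X Y : good X -> good Y -> good (fun s w => X s w + Y s w).
Proof.
move=> [cX gX [C XC]] [cY gY [D YD]]; split.
- by move=> w t; apply: cvgD; [exact: cX|exact: cY].
- by move=> s sT; apply: measurable_funD; [exact: gX|exact: gY].
- exists (2 * C + 2 * D) => s sT; apply: (le_trans (sqED P _ _)).
  + exact: gm_measurable (gX s sT).
  + exact: gm_measurable (gY s sT).
  + rewrite [leRHS](_ : _ = (2%:E * C%:E + 2%:E * D%:E)%E)//.
    by apply: leeD; apply: lee_wpmul2l => //; [exact: XC|exact: YD].
Qed.

Lemma goodM (c : R -> R) X : {within `[0, T], continuous c} -> good X ->
  good (fun s w => c s * X s w).
Proof.
move=> cc [cX gX [C XC]]; have [_ [K cK]] := continuous_bmeas T_gt0 cc.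
split.
- by move=> w t; apply: cvgM; [exact: cc|exact: cX].
- by move=> s sT; apply: measurable_funM => //; exact: gX.
- exists (K ^+ 2 * C) => s sT; rewrite sqEZ; last exact: gm_measurable (gX s sT).
  rewrite [leRHS](_ : _ = ((K ^+ 2)%:E * C%:E)%E)//.
  apply: lee_pmul => //; [|exact: sqE_ge0| |exact: XC].
    by rewrite lee_fin sqr_ge0.
  rewrite lee_fin -(real_normK (num_real (c s))) lerXn2r ?nnegrE ?cK//.
  by rewrite (le_trans _ (cK s sT)).
Qed.

Lemma good_sum (I : finType) (X : I -> R -> Om -> R) : (forall i, good (X i)) ->
  good (fun s w => \sum_i X i s w).
Proof.
apply: (bigop_closed2 (Q := good)); last exact: goodD.
apply: good_cst; first exact: measurable_cst.
by rewrite /sqE; under eq_integral do rewrite expr0n /=; rewrite integral0.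
Qed.

Lemma good_int (g : R -> R) X : L1 T g -> good X ->
  good (fun t w => \int[mu]_(s in `[0, t]) (g s * X s w)).
Proof.
move=> Lg gX; have [cX aX [C XC]] := gX; split.
- move=> w; apply: (parameterized_integral_continuous (ltW T_gt0)).
  by apply: L1Mr => //; exact: good_bmeas.
- move=> t tT; apply: (@measurable_Rint_process R _ (g_sigma_algebraType (gen t))).
    exact: L1_sub Lg.
  apply: continuous_process_measurable.
    move=> s st; apply: (@gm_mono s); last by apply: aX; exact: in_sub0t st.
    by move: st; rewrite in_itv /= => /andP[].
  by move=> w; apply: continuous_subspaceW (cX w); exact: sub0t.
pose G := \int[mu]_(s in `[0, T]) `|g s|.
exists (G * (G * C)) => t tT.
have LnG : L1 T (fun s => `|g s|) by exact: L1_norm.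
have G0 : 0 <= G by exact: Rintegral_ge0.
have mX := good_joint gX.
have mgX : measurable_fun (`[0, T]%classic `*` setT)
    (fun z : measurableTypeR R * Om => `|g z.1| * X z.1 z.2 ^+ 2).
  apply: measurable_funM.
    exact: (@measurable_fun_on_fst _ _ (measurableTypeR R) Om R _ setT
      (measurable_itv `[0, T]) (fun s => `|g s|) (L1_meas LnG)).
  exact: measurable_funX.
have LgX w : L1 T (fun s => `|g s| * X s w ^+ 2).
  by apply: L1Mr => //; apply: bmeasM; exact: good_bmeas.
apply: (@le_trans _ _ (\int[P]_w (G%:E *
    \int[mu]_(s in `[0%R, T]) (`|g s| * X s w ^+ 2)%:E))%E).
  apply: ge0_le_integral => //.
  - by move=> w _; rewrite lee_fin sqr_ge0.
  - apply: measurable_sqr; apply: measurable_Rint_process; first exact: L1_sub Lg.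
    by apply: measurable_funS mX => //; [exact: measurableX|move=> z [/= /(sub0t tT) ? ?]].
  - apply: measurable_funeM.
    apply: (@measurable_integral_on2 _ _ (measurableTypeR R) Om R mu _ _ _ _
      (fun s w => `|g s| * X s w ^+ 2) mgX) => //.
    by move=> s w _ _; rewrite mulr_ge0 ?sqr_ge0.
  - move=> w _; have -> : (\int[mu]_(s in `[0%R, T]) (`|g s| * X s w ^+ 2)%:E =
      (\int[mu]_(s in `[0, T]) (`|g s| * X s w ^+ 2))%:E)%E.
      by rewrite /Rintegral fineK//; exact: integrable_fin_num (LgX w).
    by rewrite -EFinM lee_fin weighted_CS//; exact: good_bmeas.
rewrite ge0_integralZl_EFin//; last 2 first.
- by move=> w _; apply: integral_ge0 => s _; rewrite lee_fin mulr_ge0 ?sqr_ge0.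
- apply: (@measurable_integral_on2 _ _ (measurableTypeR R) Om R mu _ _ _ _
      (fun s w => `|g s| * X s w ^+ 2) mgX) => //.
  by move=> s w _ _; rewrite mulr_ge0 ?sqr_ge0.
rewrite EFinM; apply: lee_wpmul2l => //.
rewrite -(@tonelli_on _ _ (measurableTypeR R) Om R mu P _ setT _ _
  (fun s w => `|g s| * X s w ^+ 2) mgX)//; last first.
  by move=> s w _ _; rewrite mulr_ge0 ?sqr_ge0.
apply: (@le_trans _ _ (\int[mu]_(s in `[0%R, T]) (`|g s| * C)%:E)%E).
  apply: ge0_le_integral => //.
  - by move=> s _; apply: integral_ge0 => w _; rewrite lee_fin mulr_ge0 ?sqr_ge0.
  - apply: (@measurable_integral_on1 _ _ (measurableTypeR R) Om R P _ _ _ _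
      (fun s w => `|g s| * X s w ^+ 2) mgX) => //.
    by move=> s w _ _; rewrite mulr_ge0 ?sqr_ge0.
  - by apply/measurable_EFinP; apply: measurable_funM => //; exact: L1_meas LnG.
  - move=> s sT; under eq_integral do rewrite EFinM.
    rewrite ge0_integralZl_EFin//; last 2 first.
      by move=> w _; rewrite lee_fin sqr_ge0.
      by apply: measurable_sqr; exact: gm_measurable (aX s sT).
    by rewrite EFinM lee_wpmul2l// ?lee_fin// XC.
have -> : (\int[mu]_(s in `[0%R, T]) (`|g s| * C)%:E)%E =
    (\int[mu]_(s in `[0, T]) (`|g s| * C))%:E.
  rewrite /Rintegral fineK//; apply: integrable_fin_num => //.
  exact: (L1Mr LnG (bmeas_cst T C)).
by rewrite RintegralZr.
Qed.

End Filtered.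

(** * Integrands whose time integral has zero mean *)

Section AlmostEverywhere.
Context (R : realType) d (Y : measurableType d) (m : {measure set Y -> \bar R}).
Implicit Types A B C D E : Y -> Prop.

Lemma ae_sub A B : (forall y, A y -> B y) -> {ae m, forall y, A y} ->
  {ae m, forall y, B y}.
Proof. by move=> AB; exact: filterS. Qed.

Lemma ae_sub2 A B C : (forall y, A y -> B y -> C y) -> {ae m, forall y, A y} ->
  {ae m, forall y, B y} -> {ae m, forall y, C y}.
Proof. by move=> ABC; exact: filterS2. Qed.

Lemma ae_sub3 A B C D : (forall y, A y -> B y -> C y -> D y) ->
  {ae m, forall y, A y} -> {ae m, forall y, B y} -> {ae m, forall y, C y} ->
  {ae m, forall y, D y}.
Proof. by move=> ABCD; exact: filterS3. Qed.

Lemma ae_sub4 A B C D E : (forall y, A y -> B y -> C y -> D y -> E y) ->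
  {ae m, forall y, A y} -> {ae m, forall y, B y} -> {ae m, forall y, C y} ->
  {ae m, forall y, D y} -> {ae m, forall y, E y}.
Proof.
move=> H a b c e.
have ab : {ae m, forall y, A y /\ B y} by apply: ae_sub2 a b => y; split.
have ce : {ae m, forall y, C y /\ D y} by apply: ae_sub2 c e => y; split.
by apply: ae_sub2 ab ce => y [? ?] [? ?]; exact: H.
Qed.

End AlmostEverywhere.

Section CrossTerms.
Context (R : realType) d (Om : measurableType d) (P : probability Om R) (T : R).
Hypothesis T_gt0 : 0 < T.
Local Notation mu := (@lebesgue_measure R).
Variable gen : R -> set (set Om).
Hypothesis gen_mono : forall s t, s <= t -> gen s `<=` gen t.
Hypothesis gen_meas : forall t, t \in `[0, T] -> gen t `<=` measurable.
Local Notation gm := (gm gen).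
Local Notation good := (good P T gen).

Definition joint (X : R -> Om -> R) := measurable_fun (`[0, T]%classic `*` setT)
  (fun z : measurableTypeR R * Om => X z.1 z.2).

Definition energy (X : R -> Om -> R) : \bar R :=
  (\int[P]_w \int[mu]_(s in `[0%R, T]) (X s w ^+ 2)%:E)%E.

(** The martingale property in its dual form: increments up to the horizon are orthogonal
    to square integrable variables of the past. *)
Definition mart (M : R -> Om -> R) := forall s, s \in `[0, T] ->
  forall Z, gm s Z -> (sqE P Z < +oo)%E ->
  \int[P]_w (Z w * (M T w - M s w)) = 0.

(** By Fubini's theorem, the time integral of such an integrand has zero mean
    ([null_expectation]). *)
Definition null (X : R -> Om -> R) := [/\ joint X,
    (\int[mu]_(s in `[0%R, T]) \int[P]_w `|X s w|%:E < +oo)%E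
  & {ae mu, forall s, s \in `[0, T] -> \int[P]_w X s w = 0}].

Lemma jointD X Y : joint X -> joint Y -> joint (fun s w => X s w + Y s w).
Proof. by move=> jX jY; exact: measurable_funD. Qed.

Lemma jointM X Y : joint X -> joint Y -> joint (fun s w => X s w * Y s w).
Proof. by move=> jX jY; exact: measurable_funM. Qed.

Lemma joint_time (g : R -> R) : measurable_fun `[0, T] g -> joint (fun s _ => g s).
Proof.
move=> mg; exact: (@measurable_fun_on_fst _ _ (measurableTypeR R) Om R _ setT
  (measurable_itv `[0, T]) g mg).
Qed.

Lemma joint_cst (Z : Om -> R) : measurable_fun setT Z -> joint (fun _ => Z).
Proof.
move=> mZ; exact: (@measurable_fun_on_snd _ _ (measurableTypeR R) Om R
  `[0, T]%classic _ measurableT Z mZ).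
Qed.

Lemma joint_abs X : joint X -> joint (fun s w => `|X s w|).
Proof. by move=> jX; exact: measurableT_comp. Qed.

Lemma joint_sub X t : t \in `[0, T] -> joint X ->
  measurable_fun (`[0, t]%classic `*` setT)
  (fun z : measurableTypeR R * Om => X z.1 z.2).
Proof.
move=> tT; apply: measurable_funS => //; first exact: measurableX.
by move=> z [/= /(sub0t tT) ? ?].
Qed.

Lemma joint_section X s : joint X -> s \in `[0, T] -> measurable_fun setT (X s).
Proof.
move=> jX sT; exact: (@measurable_section1 _ _ (measurableTypeR R) Om R
  `[0, T]%classic setT (measurable_itv _) measurableT X jX s sT).
Qed.

Lemma energy_tonelli X : joint X ->
  energy X = (\int[mu]_(s in `[0%R, T]) sqE P (X s))%E.
Proof.
move=> jX; rewrite /energy /sqE.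
rewrite (@tonelli_on _ _ (measurableTypeR R) Om R mu P _ setT _ _
  (fun s w => X s w ^+ 2))//.
- by apply: measurable_funX.
- by move=> s w _ _; rewrite sqr_ge0.
Qed.

Lemma energy_ge0 X : (0 <= energy X)%E.
Proof.
by apply: integral_ge0 => w _; apply: integral_ge0 => s _; rewrite lee_fin sqr_ge0.
Qed.

Lemma measurable_sqE X : joint X -> measurable_fun `[0, T] (fun s => sqE P (X s)).
Proof.
move=> jX; rewrite /sqE.
apply: (@measurable_integral_on1 _ _ (measurableTypeR R) Om R P _ _ _ _
      (fun s w => X s w ^+ 2)) => //.
- by apply: measurable_funX.
- by move=> s w _ _; rewrite sqr_ge0.
Qed.

Lemma measurable_absE X : joint X ->
  measurable_fun `[0, T] (fun s => \int[P]_o `|X s o|%:E)%E.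
Proof.
move=> jX; apply: (@measurable_integral_on1 _ _ (measurableTypeR R) Om R P _ _ _ _
  (fun s o => `|X s o|)) => //; exact: joint_abs.
Qed.

Lemma absE_ge0 (X : Om -> R) : (0 <= \int[P]_o `|X o|%:E)%E.
Proof. by apply: integral_ge0 => o _; rewrite lee_fin. Qed.

Lemma energy_le X C : joint X -> (forall s, s \in `[0, T] -> (sqE P (X s) <= C%:E)%E) ->
  (energy X <= (T * C)%:E)%E.
Proof.
move=> jX XC; rewrite energy_tonelli//.
apply: (@le_trans _ _ (\int[mu]_(s in `[0%R, T]) C%:E)%E).
  apply: ge0_le_integral => //.
  - by move=> s _; exact: sqE_ge0.
  - exact: measurable_sqE.
rewrite integral_cst// [X in (_ * X)%E](@lebesgue_measure_itv R `[0, T]%R) /=.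
by rewrite lte_fin T_gt0 oppr0 adde0 -EFinM mulrC.
Qed.

Lemma ae_sqE_lty X : joint X -> (energy X < +oo)%E ->
  {ae mu, forall s, s \in `[0, T] -> (sqE P (X s) < +oo)%E}.
Proof.
move=> jX; rewrite energy_tonelli// => fin.
have i : mu.-integrable `[0, T] (fun s => sqE P (X s)).
  apply/integrableP; split; first exact: measurable_sqE.
  by under eq_integral do rewrite gee0_abs ?sqE_ge0//.
have : {ae mu, forall s, `[0, T]%classic s -> sqE P (X s) \is a fin_num}.
  exact: integrable_ae.
apply: ae_sub => s h sT; have := h sT.
by rewrite ge0_fin_numE ?sqE_ge0.
Qed.

Lemma ae_path_L2 X : joint X -> (energy X < +oo)%E ->
  {ae P, forall w, L2 T (fun s => X s w)}.
Proof.
move=> jX fin.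
have m2 : measurable_fun setT (fun w => \int[mu]_(s in `[0%R, T]) (X s w ^+ 2)%:E)%E.
  apply: (@measurable_integral_on2 _ _ (measurableTypeR R) Om R mu _ _ _ _
      (fun s w => X s w ^+ 2)) => //.
  - by apply: measurable_funX.
  - by move=> s w _ _; rewrite sqr_ge0.
have i : P.-integrable setT (fun w => \int[mu]_(s in `[0%R, T]) (X s w ^+ 2)%:E)%E.
  apply/integrableP; split => //.
  under eq_integral => w _.
    rewrite gee0_abs; last by apply: integral_ge0 => s _; rewrite lee_fin sqr_ge0.
    over.
  exact: fin.
have := integrable_ae measurableT i.
apply: filterS => w /(_ I) h.
have mX : measurable_fun `[0, T] (X^~ w).
  exact: (@measurable_section2 _ _ (measurableTypeR R) Om R
   `[0, T]%classic setT (measurable_itv _) measurableT X jX w I).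
split=> //; apply/integrableP; split.
  by apply/measurable_EFinP; exact: measurable_funX.
under eq_integral do rewrite /= ger0_norm ?sqr_ge0//.
by move: h; rewrite ge0_fin_numE// integral_ge0// => s _; rewrite lee_fin sqr_ge0.
Qed.

Lemma prod_energy_le (g : R -> R) (K : R) w N t : t \in `[0, T] ->
  measurable_fun `[0, T] g -> (forall s, s \in `[0, T] -> `|g s| <= K) ->
  joint w -> joint N ->
  (\int[mu]_(s in `[0%R, t]) \int[P]_o `|g s * w s o * N s o|%:E <=
    K%:E * (energy w + energy N))%E.
Proof.
move=> tT mg gK jw jN.
have K0 : 0 <= K by rewrite (le_trans _ (gK 0 (in0T T_gt0))).
have jg := joint_time mg.
have jX : joint (fun s o => g s * w s o * N s o) by apply: jointM => //; exact: jointM.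
have bnd (Z : R -> Om -> R) : joint Z -> (forall s o, 0 <= Z s o) ->
   (\int[mu]_(s in `[0%R, t]) \int[P]_o (Z s o)%:E <=
    \int[mu]_(s in `[0%R, T]) \int[P]_o (Z s o)%:E)%E.
  move=> jZ Z0; apply: ge0_subset_integral => //.
  - apply: (@measurable_integral_on1 _ _ (measurableTypeR R) Om R P _ _ _ _ Z) => //.
  - by move=> s _; apply: integral_ge0 => o _; rewrite lee_fin.
  - exact: sub0t.
apply: (le_trans (bnd _ (joint_abs jX) _)) => //.
apply: (@le_trans _ _ (\int[mu]_(s in `[0%R, T])
    (K%:E * sqE P (w s) + K%:E * sqE P (N s)))%E).
  apply: ge0_le_integral => //.
  - by move=> s _; exact: absE_ge0.
  - exact: measurable_absE jX.
  - by apply: emeasurable_funD; apply: measurable_funeM; exact: measurable_sqE.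
  - move=> s sT; have mw := joint_section jw sT; have mN := joint_section jN sT.
    rewrite /sqE -!ge0_integralZl_EFin//; last 4 first.
    + by move=> o _; rewrite lee_fin sqr_ge0.
    + exact: measurable_sqr.
    + by move=> o _; rewrite lee_fin sqr_ge0.
    + exact: measurable_sqr.
    rewrite -ge0_integralD//; last 4 first.
    + by move=> o _; rewrite -EFinM lee_fin mulr_ge0 ?sqr_ge0.
    + by apply: measurable_funeM; exact: measurable_sqr.
    + by move=> o _; rewrite -EFinM lee_fin mulr_ge0 ?sqr_ge0.
    + by apply: measurable_funeM; exact: measurable_sqr.
    apply: ge0_le_integral => //.
    + apply/measurable_EFinP; apply: measurableT_comp => //.
      exact: joint_section jX sT.
    + by apply: emeasurable_funD; apply: measurable_funeM; exact: measurable_sqr.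
    move=> o _; rewrite -!EFinM -EFinD lee_fin -mulrDr -mulrA normrM.
    apply: ler_pM => //; first exact: gK.
    rewrite normrM -(real_normK (num_real (w s o))) -(real_normK (num_real (N s o))).
    by have := sqr_ge0 (`|w s o| - `|N s o|); have := sqr_ge0 (`|w s o| + `|N s o|); lra.
rewrite ge0_integralD//; last 4 first.
- by move=> s _; rewrite mule_ge0 ?sqE_ge0.
- by apply: measurable_funeM; exact: measurable_sqE.
- by move=> s _; rewrite mule_ge0 ?sqE_ge0.
- by apply: measurable_funeM; exact: measurable_sqE.
rewrite !ge0_integralZl_EFin//; last 4 first.
- by move=> s _; exact: sqE_ge0.
- exact: measurable_sqE.
- by move=> s _; exact: sqE_ge0.
- exact: measurable_sqE.
have -> : (K%:E * (energy w + energy N) = K%:E * energy w + K%:E * energy N)%E.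
  by rewrite ge0_muleDr ?energy_ge0.
by rewrite (energy_tonelli jw) (energy_tonelli jN).
Qed.

Lemma null_expectation X : null X ->
  P.-integrable setT (EFin \o (fun w => \int[mu]_(s in `[0, T]) X s w)) /\
  \int[P]_w (\int[mu]_(s in `[0, T]) X s w) = 0.
Proof.
move=> [jX fX zX]; split.
  exact: (@integrable_Rintegral2 _ _ (measurableTypeR R) Om R mu P _ setT
    (measurable_itv _) measurableT X jX fX).
rewrite -(@Rfubini_on _ _ (measurableTypeR R) Om R mu P _ setT
    (measurable_itv _) measurableT X jX fX).
rewrite /Rintegral (_ : integral _ _ _ = 0%E)//.
transitivity (\int[mu]_(s in `[0%R, T]) (cst 0 s : \bar R))%E; last exact: integral0.
apply: ae_eq_integral => //.
- have := @integrable_Rintegral1 _ _ (measurableTypeR R) Om R mu P _ setT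
    (measurable_itv _) measurableT X jX fX.
  exact: measurable_int.
- apply: (negligibleS _ zX) => s /=; apply: contra_not => h sT.
  by rewrite -[fine _]/(Rintegral P setT (X s)) h.
Qed.

Lemma null_ext X Y : (forall s w, X s w = Y s w) -> null X -> null Y.
Proof. by move=> XY; have -> : Y = X by apply/funext => s; apply/funext => w. Qed.

Lemma null0 : null (fun _ _ => 0).
Proof.
split; first exact: measurable_cst.
- by rewrite integral0_eq// => s _; rewrite integral0_eq// => w _; rewrite normr0.
- by apply: aeW => s _; rewrite Rintegral_cst// mul0r.
Qed.

Lemma nullD X Y : null X -> null Y -> null (fun s w => X s w + Y s w).
Proof.
move=> [jX fX zX] [jY fY zY]; have jXY := jointD jX jY; split; first exact: jXY.
- have m := measurable_absE.
  apply: (@le_lt_trans _ _ (\int[mu]_(s in `[0%R, T])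
    (\int[P]_w `|X s w|%:E + \int[P]_w `|Y s w|%:E))%E); last first.
    rewrite ge0_integralD; [by apply: lte_add_pinfty; [exact: fX|exact: fY]|by []| | | |].
    + by move=> s _; exact: absE_ge0.
    + exact: m.
    + by move=> s _; exact: absE_ge0.
    + exact: m.
  apply: ge0_le_integral => //.
  + by move=> s _; apply: integral_ge0 => w _; rewrite lee_fin.
  + exact: m.
  + by apply: emeasurable_funD; exact: m.
  move=> s sT; have mXs := joint_section jX sT; have mYs := joint_section jY sT.
  have mn (Z : Om -> R) : measurable_fun setT Z ->
      measurable_fun setT (fun w : Om => `|Z w|%:E : \bar R).
    by move=> mZ; apply/measurable_EFinP; exact: measurableT_comp.
  rewrite -ge0_integralD//; try exact: mn.
  apply: ge0_le_integral => //.
  + by apply: mn; exact: measurable_funD.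
  + by apply: emeasurable_funD; exact: mn.
  + by move=> w _; rewrite -EFinD lee_fin ler_normD.
- have aX := @ae_integrable_on1 _ _ (measurableTypeR R) Om R mu P _ setT
    (measurable_itv _) measurableT X jX fX.
  have aY := @ae_integrable_on1 _ _ (measurableTypeR R) Om R mu P _ setT
    (measurable_itv _) measurableT Y jY fY.
  move: aX aY zX zY; apply: ae_sub4 => s aX aY zX zY sT.
  by rewrite RintegralD ?zX ?zY ?addr0//; [exact: aX|exact: aY].
Qed.

Lemma null_sum (I : finType) (X : I -> R -> Om -> R) : (forall i, null (X i)) ->
  null (fun s w => \sum_i X i s w).
Proof. exact: (bigop_closed2 (Q := null) null0 nullD). Qed.

Lemma energyD_lty X Y : joint X -> joint Y -> (energy X < +oo)%E -> (energy Y < +oo)%E ->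
  (energy (fun s w => X s w + Y s w)%R < +oo)%E.
Proof.
move=> jX jY fX fY; rewrite energy_tonelli; last exact: jointD.
apply: (@le_lt_trans _ _ (\int[mu]_(s in `[0%R, T])
  (2%:E * sqE P (X s) + 2%:E * sqE P (Y s)))%E).
  apply: ge0_le_integral => //.
  - by move=> s _; exact: sqE_ge0.
  - by apply: measurable_sqE; exact: jointD.
  - by apply: emeasurable_funD; apply: measurable_funeM; exact: measurable_sqE.
  - by move=> s sT; apply: sqED; exact: joint_section.
rewrite ge0_integralD//; last 4 first.
- by move=> s _; rewrite mule_ge0 ?sqE_ge0.
- by apply: measurable_funeM; exact: measurable_sqE.
- by move=> s _; rewrite mule_ge0 ?sqE_ge0.
- by apply: measurable_funeM; exact: measurable_sqE.
rewrite !ge0_integralZl_EFin//; last 4 first.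
- by move=> s _; exact: sqE_ge0.
- exact: measurable_sqE.
- by move=> s _; exact: sqE_ge0.
- exact: measurable_sqE.
rewrite -!energy_tonelli//.
by apply: lte_add_pinfty; apply: lte_mul_pinfty.
Qed.

Lemma energyZ_lty a X : joint X -> (energy X < +oo)%E ->
  (energy (fun s w => a * X s w)%R < +oo)%E.
Proof.
move=> jX fX; have jaX := jointM (joint_time (measurable_cst a)) jX.
rewrite energy_tonelli//.
under eq_integral => s sT.
  rewrite sqEZ; last by apply: joint_section => //; move: sT; rewrite inE.
  over.
rewrite ge0_integralZl_EFin ?sqr_ge0//; last 2 first.
- by move=> s _; exact: sqE_ge0.
- exact: measurable_sqE.
by rewrite -energy_tonelli// lte_mul_pinfty// lee_fin sqr_ge0.
Qed.

Lemma energy_mul_lty (g : R -> R) X : L2 T g -> good X ->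
  (energy (fun s w => g s * X s w)%R < +oo)%E.
Proof.
move=> [mg Lg] gX; have [_ _ [C XC]] := gX; have jX := good_joint gen_meas gX.
have jgX := jointM (joint_time mg) jX.
have C0 : 0 <= C.
  by rewrite -lee_fin (le_trans (sqE_ge0 P (X 0)) (XC 0 (in0T T_gt0))).
rewrite energy_tonelli//.
apply: (@le_lt_trans _ _ (\int[mu]_(s in `[0%R, T]) (g s ^+ 2 * C)%:E)%E).
  apply: ge0_le_integral => //.
  - by move=> s _; exact: sqE_ge0.
  - exact: measurable_sqE.
  - by apply/measurable_EFinP; apply: measurable_funM => //; exact: measurable_funX.
  - move=> s sT; rewrite sqEZ; last exact: joint_section jX sT.
    by rewrite [leRHS]EFinM; apply: lee_wpmul2l; [rewrite lee_fin sqr_ge0|exact: XC].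
under eq_integral do rewrite EFinM.
rewrite ge0_integralZr//; last 2 first.
- by apply/measurable_EFinP; exact: measurable_funX.
- by move=> s _; rewrite lee_fin sqr_ge0.
have fg : (\int[mu]_(s in `[0%R, T]) (g s ^+ 2)%:E < +oo)%E.
  have /integrableP[_] := Lg; congr (_ < _)%E.
  by apply: eq_integral => s _; rewrite /= ger0_norm ?sqr_ge0.
by rewrite muleC lte_mul_pinfty.
Qed.

Lemma good_incr M s : good M -> s \in `[0, T] ->
  measurable_fun setT (fun o => M T o - M s o).
Proof.
move=> [_ aM _] sT; apply: measurable_funB.
  exact: (gm_measurable gen_meas (inTT T_gt0) (aM T (inTT T_gt0))).
exact: (gm_measurable gen_meas sT (aM s sT)).
Qed.

Lemma good_incr_sqE M : good M -> exists2 C, 0 <= C & forall s, s \in `[0, T] ->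
  (sqE P (fun o => M T o - M s o)%R <= C%:E)%E.
Proof.
move=> [_ aM [C MC]]; exists (4 * C).
  have := MC T (inTT T_gt0); move=> /(le_trans (sqE_ge0 _ _)).
  by rewrite lee_fin => C0; rewrite mulr_ge0.
move=> s sT.
have mT := gm_measurable gen_meas (inTT T_gt0) (aM T (inTT T_gt0)).
have ms := gm_measurable gen_meas sT (aM s sT).
apply: (le_trans (sqED P mT _)); first exact: measurableT_comp.
have -> : sqE P (fun o => - M s o) = sqE P (M s).
  by apply: eq_integral => o _; rewrite sqrrN.
rewrite [leRHS](_ : _ = (2%:E * C%:E + 2%:E * C%:E)%E); last first.
  by rewrite -!EFinM -EFinD; congr EFin; ring.
by apply: leeD; apply: lee_wpmul2l => //; apply: MC => //; exact: inTT.
Qed.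

(** At almost every time the control is a square integrable variable of the past, hence
    orthogonal to the later increment. *)
Lemma null_adapted (g : R -> R) (w M : R -> Om -> R) :
  bmeas T g -> joint w -> (energy w < +oo)%E ->
  (forall s, s \in `[0, T] -> gm s (w s)) -> good M -> mart M ->
  null (fun s o => g s * w s o * (M T o - M s o)).
Proof.
move=> [mg [K gK]] jw fw aw gM mM.
have mMT : measurable_fun setT (M T).
  by case: gM => _ aM _; exact: (gm_measurable gen_meas (inTT T_gt0) (aM T (inTT T_gt0))).
have jN : joint (fun s o => M T o - M s o).
  apply: measurable_funB; first exact: joint_cst.
  exact: good_joint gM.
have [C C0 NC] := good_incr_sqE gM.
split.
- by apply: jointM => //; apply: jointM => //; exact: joint_time.
- apply: (le_lt_trans (prod_energy_le (inTT T_gt0) mg gK jw jN)).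
  rewrite lte_mul_pinfty//.
    by rewrite lee_fin (le_trans _ (gK 0 (in0T T_gt0))).
  apply: lte_add_pinfty; [exact: fw|].
  by apply: (le_lt_trans (energy_le jN NC)); exact: ltry.
- have := ae_sqE_lty jw fw; apply: ae_sub => s h sT.
  under eq_Rintegral do rewrite -mulrA.
  rewrite RintegralZl//; first by rewrite mM ?mulr0//; [exact: aw|exact: h].
  apply: L2_prod_integrable; [exact: joint_section jw sT|exact: good_incr| |].
    exact: h.
  by apply: (le_lt_trans (NC s sT)); exact: ltry.
Qed.

(** For [r <= s] the control at time [r] is orthogonal to the increment after [s]; the mean
    of the integral over [r] vanishes by Fubini's theorem. *)
Lemma flow_term (psi : R -> R) (w M : R -> Om -> R) :
  bmeas T psi -> joint w -> (energy w < +oo)%E ->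
  (forall s, s \in `[0, T] -> gm s (w s)) -> good M -> mart M ->
  exists C : R, forall s, s \in `[0, T] ->
    let U o := \int[mu]_(r in `[0, s]) (psi r * w r o * (M T o - M s o)) in
    [/\ P.-integrable setT (EFin \o U), \int[P]_o U o = 0 &
      (\int[P]_o `|U o|%:E <= C%:E)%E].
Proof.
move=> [mpsi [K psiK]] jw fw aw gM mM.
have [C C0 NC] := good_incr_sqE gM.
exists (K * (fine (energy w) + T * C)) => s sT U.
have mN := good_incr gM sT.
have jN : joint (fun _ o => M T o - M s o) by exact: joint_cst.
pose X (r : measurableTypeR R) o : R := psi r * w r o * (M T o - M s o).
have jX : joint X.
  by apply: jointM => //; apply: jointM => //; exact: joint_time.
have jXs := joint_sub sT jX.
have eb : (\int[mu]_(r in `[0%R, s]) \int[P]_o `|X r o|%:E <=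
    (K * (fine (energy w) + T * C))%:E)%E.
  apply: (le_trans (prod_energy_le sT mpsi psiK jw jN)).
  rewrite EFinM; apply: lee_wpmul2l.
    by rewrite lee_fin (le_trans _ (psiK 0 (in0T T_gt0))).
  rewrite EFinD; apply: leeD; last exact: (energy_le jN (fun _ _ => NC s sT)).
  by rewrite fineK// ge0_fin_numE ?energy_ge0.
have fin : (\int[mu]_(r in `[0%R, s]) \int[P]_o `|X r o|%:E < +oo)%E.
  by apply: (le_lt_trans eb); exact: ltry.
have iU : P.-integrable setT (EFin \o U).
  exact: (@integrable_Rintegral2 _ _ (measurableTypeR R) Om R mu P _ setT
    (measurable_itv _) measurableT X jXs fin).
split=> //.
- rewrite /U -(@Rfubini_on _ _ (measurableTypeR R) Om R mu P _ setT
    (measurable_itv _) measurableT X jXs fin).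
  rewrite /Rintegral (_ : integral _ _ _ = 0%E)//.
  transitivity (\int[mu]_(r in `[0%R, s]) (cst 0 r : \bar R))%E; last exact: integral0.
  apply: ae_eq_integral => //.
    have := @integrable_Rintegral1 _ _ (measurableTypeR R) Om R mu P _ setT
      (measurable_itv _) measurableT X jXs fin.
    exact: measurable_int.
  apply: (ae_sub _ (ae_sqE_lty jw fw)) => r h rs.
  have rT := in_sub0t sT rs.
  rewrite -[fine _]/(Rintegral P setT (X r)) /X.
  under eq_Rintegral do rewrite -mulrA.
  rewrite RintegralZl//; last first.
    apply: L2_prod_integrable => //; [exact: joint_section jw rT|exact: h|].
    by apply: (le_lt_trans (NC s sT)); exact: ltry.
  rewrite mM ?mulr0//; last exact: h.
  by apply: gm_mono (aw r rT) => //; move: rs; rewrite /= in_itv /= => /andP[].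
- apply: le_trans eb.
  rewrite (@tonelli_on _ _ (measurableTypeR R) Om R mu P _ setT
    (measurable_itv _) measurableT (fun r o => `|X r o|))//; last first.
    exact: measurableT_comp.
  apply: ge0_le_integral => //.
  + by apply/measurable_EFinP; apply: measurableT_comp => //; apply/measurable_EFinP; exact: measurable_int iU.
  + apply: (@measurable_integral_on2 _ _ (measurableTypeR R) Om R mu _ _
      (measurable_itv _) measurableT (fun r o => `|X r o|)) => //.
    exact: measurableT_comp.
  + move=> o _; have mXo : measurable_fun `[0, s] (X^~ o).
      exact: (@measurable_section2 _ _ (measurableTypeR R) Om R
       `[0, s]%classic setT (measurable_itv _) measurableT X jXs o I).
    have [fi|] := boolP (mu.-integrable `[0, s] (EFin \o (X^~ o))).
      rewrite EFin_normr_Rintegral//.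
      by apply: le_abse_integral => //; apply/measurable_EFinP.
    move=> ni; rewrite [leRHS](_ : _ = +oo%E) ?leey//.
    apply/eqP; rewrite -leye_eq leNgt; apply: contraNN ni => lt.
    by apply/integrableP; split=> //; exact/measurable_EFinP.
Qed.

Lemma ae_all_fin (I : finType) (A : I -> Om -> Prop) :
  (forall i, {ae P, forall o, A i o}) -> {ae P, forall o, forall i, A i o}.
Proof.
move=> aeA.
have : {ae P, forall o, forall i, i \in index_enum I -> A i o}.
  elim: (index_enum I) => [|i r IHr]; first exact: aeW.
  apply: ae_sub2 (aeA i) IHr => o Ai Ar j; rewrite in_cons => /predU1P[->//|].
  exact: Ar.
by apply: ae_sub => o H i; apply: H; rewrite mem_index_enum.
Qed.

(** States of a linear equation driven by adapted controls are uncorrelated with later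
    martingale increments. As the controls are only jointly measurable and adapted, their
    time integral need not be adapted; exchanging the integrals reduces the claim to the
    controls themselves. *)
Lemma null_flow (I : finType) (kappa : R -> R) (phi psi : I -> R -> R)
    (w : I -> R -> Om -> R) (delta M : R -> Om -> R) :
  L1 T kappa -> (forall i, bmeas T (phi i)) -> (forall i, bmeas T (psi i)) ->
  (forall i, joint (w i)) -> (forall i, (energy (w i) < +oo)%E) ->
  (forall i s, s \in `[0, T] -> gm s (w i s)) -> good M -> mart M ->
  joint delta ->
  {ae P, forall o, forall s, s \in `[0, T] -> delta s o =
    \sum_i phi i s * \int[mu]_(r in `[0, s]) (psi i r * w i r o)} ->
  null (fun s o => kappa s * (delta s o * (M T o - M s o))).
Proof.
move=> Lk bphi bpsi jw fw aw gM mM jd dE.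
pose U i s o := \int[mu]_(r in `[0, s]) (psi i r * w i r o * (M T o - M s o)).
have /choice [C HU] : forall i, exists C : R, forall s, s \in `[0, T] ->
    [/\ P.-integrable setT (EFin \o U i s), \int[P]_o U i s o = 0 &
      (\int[P]_o `|U i s o|%:E <= C%:E)%E].
  by move=> i; exact: (flow_term (bpsi i) (jw i) (fw i) (aw i) gM mM).
have /choice [K HK] : forall i, exists K : R, forall t, t \in `[0, T] -> `|phi i t| <= K.
  by move=> i; case: (bphi i).
have mMT : measurable_fun setT (M T).
  by case: gM => _ aM _; exact: (gm_measurable gen_meas (inTT T_gt0) (aM T (inTT T_gt0))).
have jN : joint (fun s o => M T o - M s o).
  apply: measurable_funB; first exact: joint_cst.
  exact: good_joint gM.
have jD := jointM jd jN.
have pw : {ae P, forall o, forall i, L2 T (fun s => w i s o)}.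
  by apply: ae_all_fin => i; exact: ae_path_L2.
have dU : {ae P, forall o, forall s, s \in `[0, T] ->
    delta s o * (M T o - M s o) = \sum_i phi i s * U i s o}.
  apply: ae_sub2 dE pw => o dE Lw s sT.
  rewrite dE// mulr_suml; apply: eq_bigr => i _; rewrite -mulrA; congr (_ * _).
  rewrite /U RintegralZr//.
  exact: (L1_sub sT (L1M (bpsi i) (L2_L1 (Lw i)))).
have iS s : s \in `[0, T] ->
    P.-integrable setT (EFin \o (fun o => \sum_i phi i s * U i s o)).
  move=> sT.
  have := @integrable_sum _ _ _ P setT measurableT I (index_enum I) xpredT
    (fun i o => (phi i s * U i s o)%:E).
  move=> /(_ _)/wrap[i _|].
    by have [iU _ _] := HU i s sT; exact: (integrableZl measurableT (phi i s) iU).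
  by apply: eq_integrable => // o _; rewrite /= sumEFin.
have b1 s : s \in `[0, T] -> (\int[P]_o `|delta s o * (M T o - M s o)|%:E <=
    (\sum_i K i * C i)%:E)%E.
  move=> sT.
  apply: (@le_trans _ _ (\int[P]_o (\sum_i (K i * `|U i s o|)%:E))%E).
    apply: ae_ge0_le_integral => //.
    - by apply/measurable_EFinP; apply: measurableT_comp => //; exact: joint_section jD sT.
    - by move=> o _; apply: sume_ge0 => i _; rewrite lee_fin mulr_ge0// (le_trans _ (HK i s sT)).
    - apply: emeasurable_sum => i; apply/measurable_EFinP; apply: measurable_funM => //.
      apply: measurableT_comp => //; apply/measurable_EFinP.
      by have [iU _ _] := HU i s sT; exact: measurable_int iU.
    - apply: (ae_sub _ dU) => o e _; rewrite e// sumEFin lee_fin.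
      rewrite (le_trans (ler_norm_sum _ _ _))//; apply: ler_sum => i _.
      by rewrite normrM ler_wpM2r// HK.
  rewrite ge0_integral_sum//; last 2 first.
    - move=> i; apply/measurable_EFinP; apply: measurable_funM => //.
      apply: measurableT_comp => //; apply/measurable_EFinP.
      by have [iU _ _] := HU i s sT; exact: measurable_int iU.
    - by move=> i o _; rewrite lee_fin mulr_ge0// (le_trans _ (HK i s sT)).
  rewrite -sumEFin; apply: lee_sum => i _.
  have [iU _ Ub] := HU i s sT; have K0 : 0 <= K i by rewrite (le_trans _ (HK i s sT)).
  under eq_integral do rewrite EFinM.
  rewrite ge0_integralZl_EFin//; last first.
    by apply/measurable_EFinP; apply: measurableT_comp => //; apply/measurable_EFinP; exact: measurable_int iU.
  by rewrite EFinM; exact: lee_wpmul2l.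
split.
- by apply: jointM => //; apply: joint_time; exact: L1_meas Lk.
- apply: (@iterated_integral_lty _ _ (measurableTypeR R) Om R mu P _ setT
    (fun s o => kappa s * (delta s o * (M T o - M s o)))
    (fun s => `|kappa s| * \sum_i K i * C i)) => //.
  + exact: (jointM (joint_time (L1_meas Lk)) jD).
  + exact: (L1Mr (L1_norm Lk) (bmeas_cst T _)).
  + move=> s sT; under eq_integral do rewrite normrM EFinM.
    rewrite ge0_integralZl_EFin//; last first.
      by apply/measurable_EFinP; apply: measurableT_comp => //; exact: joint_section jD sT.
    by rewrite EFinM; apply: lee_wpmul2l => //; exact: b1.
- apply: aeW => s sT.
  have e : \int[P]_o (delta s o * (M T o - M s o)) = 0.
    transitivity (\int[P]_o (\sum_i phi i s * U i s o)).
      rewrite /Rintegral; congr fine; apply: ae_eq_integral => //.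
      + by apply/measurable_EFinP; exact: joint_section jD sT.
      + exact: measurable_int (iS s sT).
      + by apply: (ae_sub _ dU) => o e _; rewrite e.
    rewrite /Rintegral; under eq_integral do rewrite -sumEFin.
    rewrite integral_sum//; last first.
      by move=> i; have [iU _ _] := HU i s sT; exact: (integrableZl measurableT (phi i s) iU).
    rewrite big1// => i _; have [iU U0 _] := HU i s sT.
    under eq_integral do rewrite EFinM.
    rewrite integralZl//; move: U0; rewrite /Rintegral => U0.
    by rewrite -[integral _ _ _]fineK ?U0 ?mule0//; exact: integrable_fin_num.
  rewrite RintegralZl ?e ?mulr0//.
  apply/integrableP; split.
    by apply/measurable_EFinP; exact: joint_section jD sT.
  by apply: (le_lt_trans (b1 s sT)); exact: ltry.
Qed.

End CrossTerms.

(** * The linear-quadratic problem with additive noise *)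

Section StochasticLQ.
Context (R : realType) d (Om : measurableType d) (P : probability Om R) (T : R).
Hypothesis T_gt0 : 0 < T.
Local Notation mu := (@lebesgue_measure R).
Variable gen : R -> set (set Om).
Hypothesis gen_mono : forall s t, s <= t -> gen s `<=` gen t.
Hypothesis gen_meas : forall t, t \in `[0, T] -> gen t `<=` measurable.
Local Notation gm := (gm gen).
Local Notation good := (good P T gen).
Local Notation joint := (joint T).
Local Notation energy := (energy P T).
Local Notation mart := (mart P T gen).
Local Notation null := (null P T).

Lemma process_sub (A : Type) (Q : (R -> Om -> A) -> Prop) (X Y : R -> Om -> A) :
  (forall t w, X t w = Y t w) -> Q Y -> Q X.
Proof. by move=> XY; rewrite (_ : X = Y)//; apply/funext => t; apply/funext => w. Qed.

Definition scalar_ctrl X := [/\ joint X, (energy X < +oo)%E &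
  forall s, s \in `[0, T] -> gm s (X s)].

Definition vgood p (M : R -> Om -> 'cV[R]_p) := forall k, good (fun t w => M t w k 0).

Definition noise p (M : R -> Om -> 'cV[R]_p) :=
  vgood M /\ forall k, mart (fun t w => M t w k 0).

Definition ctrl p (U : R -> Om -> 'cV[R]_p) :=
  forall k, scalar_ctrl (fun t w => U t w k 0).

Lemma good_scale a X : good X -> good (fun t w => a * X t w).
Proof.
apply: (goodM T_gt0 gen_meas (c := fun=> a)).
by apply: continuous_subspaceT => x; exact: cst_continuous.
Qed.

Lemma vgood_sum (I : finType) p (M : I -> R -> Om -> 'cV[R]_p) :
  (forall i, vgood (M i)) -> vgood (fun t w => \sum_i M i t w).
Proof.
move=> gM k; apply: (process_sub (Q := good) (Y := fun t w => \sum_i M i t w k 0)).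
  by move=> t w; rewrite summxE.
by apply: (good_sum gen_mono gen_meas) => i; exact: gM.
Qed.

Lemma vgood_mul p q (A : 'M[R]_(p, q)) (M : R -> Om -> 'cV[R]_q) :
  vgood M -> vgood (fun t w => A *m M t w).
Proof.
move=> gM k; apply: (process_sub (Q := good) (Y := fun t w => \sum_j A k j * M t w j 0)).
  by move=> t w; rewrite mxE.
by apply: (good_sum gen_mono gen_meas) => j; apply: good_scale; exact: gM.
Qed.

Lemma vgoodD p (M M' : R -> Om -> 'cV[R]_p) : vgood M -> vgood M' ->
  vgood (fun t w => M t w + M' t w).
Proof.
move=> gM gM' k; apply: (process_sub (Q := good) (Y := fun t w => M t w k 0 + M' t w k 0)).
  by move=> t w; rewrite mxE.
by apply: (goodD gen_meas); [exact: gM|exact: gM'].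
Qed.

Lemma vgoodB p (M M' : R -> Om -> 'cV[R]_p) : vgood M -> vgood M' ->
  vgood (fun t w => M t w - M' t w).
Proof.
move=> gM gM'.
apply: (process_sub (Q := @vgood p) (Y := fun t w => M t w + (- 1%:M) *m M' t w)).
  by move=> t w; rewrite mulNmx mul1mx.
exact: vgoodD gM (vgood_mul _ gM').
Qed.

Lemma vgood_col p q (M : R -> Om -> 'cV[R]_p) (M' : R -> Om -> 'cV[R]_q) :
  vgood M -> vgood M' -> vgood (fun t w => col_mx (M t w) (M' t w)).
Proof.
move=> gM gM' k; case: (split_ordP k) => j ->.
- apply: (process_sub (Q := good) (Y := fun t w => M t w j 0)); last exact: gM.
  by move=> t w; rewrite col_mxEu.
- apply: (process_sub (Q := good) (Y := fun t w => M' t w j 0)); last exact: gM'.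
  by move=> t w; rewrite col_mxEd.
Qed.

Lemma mart_sum (I : finType) (M : I -> R -> Om -> R) :
  (forall i, good (M i)) -> (forall i, mart (M i)) ->
  mart (fun t w => \sum_i M i t w).
Proof.
move=> gM mM s sT Z gZ fZ.
have mZ := gm_measurable gen_meas sT gZ.
have iM i : P.-integrable setT (EFin \o (fun w => Z w * (M i T w - M i s w))).
  apply: L2_prod_integrable => //; first exact: good_incr (gM i) sT.
  have [C _ h] := good_incr_sqE T_gt0 gen_meas (gM i).
  by apply: (le_lt_trans (h s sT)); exact: ltry.
transitivity (\sum_i \int[P]_w (Z w * (M i T w - M i s w))); last first.
  by rewrite big1// => i _; exact: mM.
rewrite /Rintegral sum_fine; last by move=> i _; exact: (integrable_fin_num measurableT (iM i)).
congr fine; rewrite -integral_sum//; apply: eq_integral => w _.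
by rewrite sumEFin -sumrB mulr_sumr.
Qed.

Lemma mart_scale (a : R) M : good M -> mart M -> mart (fun t w => a * M t w).
Proof.
move=> gM mM s sT Z gZ fZ.
under eq_Rintegral do rewrite -mulrBr mulrCA.
rewrite RintegralZl ?mM ?mulr0//.
apply: L2_prod_integrable => //; [exact: (gm_measurable gen_meas sT gZ)|
  exact: good_incr gM sT|].
have [C _ h] := good_incr_sqE T_gt0 gen_meas gM.
by apply: (le_lt_trans (h s sT)); exact: ltry.
Qed.

Lemma noise_sum (I : finType) p (M : I -> R -> Om -> 'cV[R]_p) :
  (forall i, noise (M i)) -> noise (fun t w => \sum_i M i t w).
Proof.
move=> nM; split; first by apply: vgood_sum => i; have [] := nM i.
move=> k; apply: (process_sub (Q := mart) (Y := fun t w => \sum_i M i t w k 0)).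
  by move=> t w; rewrite summxE.
by apply: mart_sum => i; have [gM mM] := nM i; [exact: gM|exact: mM].
Qed.

Lemma noise_mul p q (A : 'M[R]_(p, q)) (M : R -> Om -> 'cV[R]_q) :
  noise M -> noise (fun t w => A *m M t w).
Proof.
move=> [gM mM]; split; first exact: vgood_mul.
move=> k; apply: (process_sub (Q := mart) (Y := fun t w => \sum_j A k j * M t w j 0)).
  by move=> t w; rewrite mxE.
by apply: mart_sum => j; [apply: good_scale|apply: mart_scale].
Qed.

Lemma noiseB p (M M' : R -> Om -> 'cV[R]_p) : noise M -> noise M' ->
  noise (fun t w => M t w - M' t w).
Proof.
move=> nM nM'.
apply: (process_sub (Q := @noise p) (Y := fun t w =>
  \sum_(b : bool) (if b then 1%:M else - 1%:M) *m (if b then M t w else M' t w))).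
  by move=> t w; rewrite big_bool /= mul1mx mulNmx mul1mx.
by apply: noise_sum => -[]; exact: noise_mul.
Qed.

Lemma noise_col p q (M : R -> Om -> 'cV[R]_p) (M' : R -> Om -> 'cV[R]_q) :
  noise M -> noise M' -> noise (fun t w => col_mx (M t w) (M' t w)).
Proof.
move=> [gM mM] [gM' mM']; split; first exact: vgood_col.
move=> k; case: (split_ordP k) => j ->.
- apply: (process_sub (Q := mart) (Y := fun t w => M t w j 0)); last exact: mM.
  by move=> t w; rewrite col_mxEu.
- apply: (process_sub (Q := mart) (Y := fun t w => M' t w j 0)); last exact: mM'.
  by move=> t w; rewrite col_mxEd.
Qed.

Lemma scalar_ctrlD X Y : scalar_ctrl X -> scalar_ctrl Y ->
  scalar_ctrl (fun t w => X t w + Y t w).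
Proof.
move=> [jX eX aX] [jY eY aY]; split; [exact: jointD|exact: energyD_lty|].
by move=> s sT; apply: measurable_funD; [exact: aX|exact: aY].
Qed.

Lemma scalar_ctrlZ a X : scalar_ctrl X -> scalar_ctrl (fun t w => a * X t w).
Proof.
move=> [jX eX aX]; split; [|exact: energyZ_lty|].
  by apply: jointM => //; exact: (joint_time (g := cst a)).
by move=> s sT; apply: measurable_funM => //; exact: aX.
Qed.

Lemma scalar_ctrl0 : scalar_ctrl (fun _ _ => 0).
Proof.
split; first exact: measurable_cst.
- by rewrite /energy integral0_eq// => w _; rewrite integral0_eq// => s _; rewrite expr0n.
- by move=> s _; exact: measurable_cst.
Qed.

Lemma scalar_ctrl_sum (I : finType) (X : I -> R -> Om -> R) :
  (forall i, scalar_ctrl (X i)) -> scalar_ctrl (fun t w => \sum_i X i t w).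
Proof. exact: (bigop_closed2 (Q := scalar_ctrl) scalar_ctrl0 scalar_ctrlD). Qed.

Lemma ctrl_eq p (U V : R -> Om -> 'cV[R]_p) :
  (forall t w, t \in `[0, T] -> U t w = V t w) -> ctrl U -> ctrl V.
Proof.
move=> UV cU k; have [jU eU aU] := cU k; split.
- apply: eq_measurable_fun jU => -[t w]; rewrite inE /= => -[/= tT _].
  by rewrite UV.
- suff -> : energy (fun t w => V t w k 0)%R = energy (fun t w => U t w k 0)%R by exact: eU.
  apply: eq_integral => w _; apply: eq_integral => t; rewrite inE /= => tT.
  by rewrite UV.
- move=> s sT; rewrite (_ : (fun w => V s w k 0) = fun w => U s w k 0); first exact: aU.
  by apply/funext => w; rewrite UV.
Qed.

Lemma ctrlB p (U V : R -> Om -> 'cV[R]_p) : ctrl U -> ctrl V ->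
  ctrl (fun t w => U t w - V t w).
Proof.
move=> cU cV k.
apply: (process_sub (Q := scalar_ctrl) _ (scalar_ctrlD (cU k) (scalar_ctrlZ (-1) (cV k)))).
by move=> t w; rewrite !mxE mulN1r.
Qed.

Lemma ctrlZ p a (U : R -> Om -> 'cV[R]_p) : ctrl U -> ctrl (fun t w => a *: U t w).
Proof.
move=> cU k; apply: (process_sub (Q := scalar_ctrl) _ (scalar_ctrlZ a (cU k))).
by move=> t w; rewrite !mxE.
Qed.

Lemma ctrl_sum (I : finType) p (U : I -> R -> Om -> 'cV[R]_p) :
  (forall i, ctrl (U i)) -> ctrl (fun t w => \sum_i U i t w).
Proof.
move=> cU k.
apply: (process_sub (Q := scalar_ctrl) _ (scalar_ctrl_sum (fun i => cU i k))).
by move=> t w; rewrite summxE.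
Qed.

Lemma ctrl_gain p q (g : R -> 'M[R]_(p, q)) (X : R -> Om -> 'cV[R]_q) :
  mL2 T g -> vgood X -> ctrl (fun t w => g t *m X t w).
Proof.
move=> Lg gX k.
apply: (process_sub (Q := scalar_ctrl) (Y := fun t w => \sum_j g t k j * X t w j 0)).
  by move=> t w; rewrite mxE.
apply: scalar_ctrl_sum => j; have [cX aX bX] := gX j; split.
- apply: jointM; first exact: (joint_time (Lg k j).1).
  exact: (good_joint gen_meas (gX j)).
- exact: (energy_mul_lty T_gt0 gen_meas (Lg k j) (gX j)).
- by move=> s sT; apply: measurable_funM => //; exact: aX.
Qed.

(** Variation of constants. As the noise is additive, the formula makes sense path by
    path: the stochastic integral has been integrated by parts. *)
Lemma linear_sde_exists p (L : R -> 'M[R]_p) (M : R -> Om -> 'cV[R]_p)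
    (z0 : Om -> 'cV[R]_p) :
  mL1 T L -> vgood M -> vgood (fun=> z0) ->
  (forall w, M 0 w = 0) ->
  exists z : R -> Om -> 'cV[R]_p,
    [/\ vgood z, forall w, z 0 w = z0 w &
      forall w, mac T (fun t => z t w - M t w) (fun t => L t *m z t w)].
Proof.
move=> L_L1 gM gz0 M0.
have [Phi [Psi [Phi0 Psi0 aPhi aPsi inv]]] := fundamental_pair T_gt0 L_L1.
pose g t := Psi t *m L t.
have g_L1 : mL1 T g by apply: mL1Ml => //; exact: mac_mbm aPsi.
pose V t w : 'cV[R]_p := z0 w +
  \col_j \sum_l \int[mu]_(s in `[0, t]) (g s j l * M s w l 0).
have aV w : mac T (V ^~ w) (fun t => g t *m M t w).
  move=> i j; rewrite ord1.
  have bM l : bmeas T (fun s => M s w l 0) by exact: good_bmeas (gM l).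
  have h := @ac_sum _ T T_gt0 _ _ _ (fun l => ac_int 0 (L1Mr (g_L1 i l) (bM l))).
  apply: (ac_eq T_gt0 _ _ (acD (ac_cst T (z0 w i 0)) h)) => t tT.
    by rewrite /V !mxE; congr (_ + _); apply: eq_bigr => l _; rewrite add0r.
  by rewrite mxE add0r.
exists (fun t w => Phi t *m V t w + M t w); split.
- move=> k; have -> : (fun t w => (Phi t *m V t w + M t w) k 0) =
    (fun t w => \sum_j (Phi t k j * (z0 w j 0 +
      \sum_l \int[mu]_(s in `[0, t]) (g s j l * M s w l 0))) + M t w k 0).
    apply/funext => t; apply/funext => w; rewrite !mxE; congr (_ + _).
    by apply: eq_bigr => j _; rewrite !mxE.
  apply: goodD => //; apply: good_sum => // j.
  apply: goodM => //; first exact: ac_continuous (aPhi k j).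
  apply: goodD => //.
  by apply: good_sum => // l; exact: good_int.
- move=> w; rewrite Phi0 mul1mx M0 addr0 /V.
  apply/matrixP => i j; rewrite !mxE [X in _ + X]big1 ?addr0 ?ord1//.
  by move=> l _; rewrite Rint00.
- move=> w; apply: (mac_eq T_gt0 _ _ (macM T_gt0 aPhi (aV w))) => t tT.
    by rewrite addrK.
  rewrite /g mulmxDr [Phi t *m (_ *m _ *m _)]mulmxA [Phi t *m (_ *m _)]mulmxA.
  by rewrite (inv t tT).1 mul1mx mulmxA.
Qed.

Section Verification.
Variables (p m : nat).
Variables (a : R -> 'M[R]_p) (B : 'M[R]_(p, m)) (q : R -> 'M[R]_p).
Variables (N : R -> 'M[R]_(m, p)) (Rw : 'M[R]_m) (h : 'M[R]_p).
Hypotheses (a_L1 : mL1 T a) (q_L1 : mL1 T q) (N_L2 : mL2 T N).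
Hypotheses (Rw_sym : Rw^T = Rw) (Rw_unit : Rw \in unitmx).
Hypotheses (h_psd : psd h) (q_sym : forall t, (q t)^T = q t).
Hypothesis run_ge0 : forall t z u, t \in `[0, T] -> 0 <= lq_run q N Rw t z u.
Variable Pi : R -> 'M[R]_p.
Hypothesis Pi_ric :
  terminal_ode T Pi (ric (lq_a a B N Rw) (lq_q q N Rw) (lq_S B Rw) Pi) h.

Let Pi_mac : mac T Pi (fun t => - ric (lq_a a B N Rw) (lq_q q N Rw) (lq_S B Rw) Pi t).
Proof. by case: ((terminal_odeP T_gt0 _ _ _).1 Pi_ric). Qed.

Let Pi_bm := mac_mbm T_gt0 Pi_mac.

Let kappa t := (a t)^T *m Pi t - ric (lq_a a B N Rw) (lq_q q N Rw) (lq_S B Rw) Pi t.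

Let kappa_L1 : mL1 T kappa.
Proof.
apply: mL1D; last exact: mac_mL1 Pi_mac.
by apply: mL1Mr => //; exact: mL1_tr.
Qed.

Lemma closed_loop_exists (M : R -> Om -> 'cV[R]_p) (z0 : Om -> 'cV[R]_p) :
  vgood M -> vgood (fun=> z0) -> (forall w, M 0 w = 0) ->
  exists z : R -> Om -> 'cV[R]_p,
    [/\ vgood z, forall w, z 0 w = z0 w,
        ctrl (fun t w => lq_gain B N Rw Pi t *m z t w) &
        forall w, mac T (fun t => z t w - M t w)
          (fun t => a t *m z t w + B *m (- (lq_gain B N Rw Pi t *m z t w)))].
Proof.
move=> gM gz0 M0; have Lk := lq_gain_L2 T_gt0 N_L2 Pi_ric.
have LL : mL1 T (fun t => a t - B *m lq_gain B N Rw Pi t).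
  apply: mL1B => //; apply: mL1Ml; last exact: mL2_mL1.
  exact: mbm_cst.
have [z [gz z_0 az]] := linear_sde_exists LL gM gz0 M0.
exists z; split=> //; first exact: ctrl_gain.
move=> w; apply: (mac_eq T_gt0 _ _ (az w)) => // t _.
by rewrite mulmxBl mulmxN -mulmxA.
Qed.

Variables (z y M : R -> Om -> 'cV[R]_p) (u v : R -> Om -> 'cV[R]_m).
Hypotheses (M_noise : noise M) (u_ctrl : ctrl u) (v_ctrl : ctrl v).
Hypotheses (z_joint : forall k, joint (fun t w => z t w k 0))
  (y_joint : forall k, joint (fun t w => y t w k 0)).
Hypothesis zy_ode : {ae P, forall w, [/\ z 0 w = y 0 w,
    mac T (fun t => z t w - M t w) (fun t => a t *m z t w + B *m u t w)
  & mac T (fun t => y t w - M t w) (fun t => a t *m y t w + B *m v t w)]}.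
Hypothesis u_fb : forall w t, t \in `[0, T] ->
  u t w = - (lq_gain B N Rw Pi t *m z t w).

Let dv k t w := v t w k 0 - u t w k 0.

Let dv_ctrl k : scalar_ctrl (dv k).
Proof.
apply: (process_sub (Q := scalar_ctrl) _ (ctrlB v_ctrl u_ctrl k)).
by move=> t w; rewrite /dv !mxE.
Qed.

Let dv_joint k : joint (dv k). Proof. by case: (dv_ctrl k). Qed.
Let dv_energy k : (energy (dv k) < +oo)%E. Proof. by case: (dv_ctrl k). Qed.
Let dv_adapted k s : s \in `[0, T] -> gm s (dv k s).
Proof. by case: (dv_ctrl k) => _ _; exact. Qed.
Let M_good k : good (fun t w => M t w k 0). Proof. by case: M_noise. Qed.
Let M_mart k : mart (fun t w => M t w k 0). Proof. by case: M_noise. Qed.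

Let dy k t w := y t w k 0 - z t w k 0.

(* the common noise cancels in the difference of two states, which is therefore given by
   variation of constants in terms of the difference of the controls *)
Let dy_flow : exists phi psi : 'I_p -> 'I_p * 'I_m -> R -> R,
  [/\ forall k i, bmeas T (phi k i), forall k i, bmeas T (psi k i) &
   {ae P, forall w, forall k s, s \in `[0, T] -> dy k s w =
     \sum_i phi k i s * \int[mu]_(r in `[0, s]) (psi k i r * dv i.2 r w)}].
Proof.
have [Phi [Psi [Phi0 Psi0 aPhi aPsi inv]]] := fundamental_pair T_gt0 a_L1.
have bPhi := mac_mbm T_gt0 aPhi.
have bPsiB : mbm T (fun t => Psi t *m B).
  by apply: mbmM; [exact: mac_mbm aPsi|exact: mbm_cst].
exists (fun k i s => Phi s k i.1), (fun k i s => (Psi s *m B) i.1 i.2); split=> //.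
have pL : {ae P, forall w, forall k, L2 T (fun s => dv k s w)}.
  by apply: ae_all_fin => k; exact: ae_path_L2.
apply: ae_sub2 zy_ode pL => w [zy0 az ay] Lw k s sT.
pose dd t := y t w - z t w.
have ad : mac T dd (fun t => a t *m dd t + B *m (v t w - u t w)).
  apply: (mac_eq T_gt0 _ _ (macB T_gt0 ay az)) => t _.
    by rewrite /dd opprB addrA subrK.
  by rewrite /dd !mulmxBr opprD addrACA.
have aPd : mac T (fun t => Psi t *m dd t) (fun t => Psi t *m B *m (v t w - u t w)).
  apply: (mac_eq T_gt0 _ _ (macM T_gt0 aPsi ad)) => // t _.
  by rewrite mulNmx mulmxDr !mulmxA addKr.
have dd0 : dd 0 = 0 by rewrite /dd zy0 subrr.
have := mac0 aPd sT; rewrite dd0 mulmx0 add0r => /(congr1 (mulmx (Phi s))).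
rewrite mulmxA (inv s sT).1 mul1mx => /matrixP /(_ k 0).
rewrite [LHS]mxE [X in _ + X = _]mxE => ddE; rewrite /dy ddE.
rewrite mxE; rewrite -(pair_bigA _ (fun j l => Phi s k j *
  \int[mu]_(r in `[0, s]) ((Psi r *m B) j l * dv l r w))) /=.
apply: eq_bigr => j _; rewrite -mulr_sumr; congr (_ * _); rewrite mxE.
have Lt l : L1 T (fun r => (Psi r *m B) j l * dv l r w).
  by apply: L1M; [exact: bPsiB|exact: L2_L1].
have := @ac_sum _ T T_gt0 _ _ _ (fun l => ac_int 0 (Lt l)) => -[_ /(_ s sT)].
rewrite [X in _ = X + _]big1 ?add0r; last by move=> l _; rewrite Rint00 addr0.
under eq_bigr do rewrite add0r; move=> ->.
by apply: eq_Rintegral => r _; rewrite mxE; apply: eq_bigr => l _; rewrite /dv !mxE.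
Qed.

Definition lq_noise w := \int[mu]_(t in `[0, T])
  lq_cross T a B q N Rw Pi (z ^~ w) (y ^~ w) (M ^~ w) (u ^~ w) (v ^~ w) t.

Lemma lq_noise_centered :
  P.-integrable setT (EFin \o lq_noise) /\ \int[P]_w lq_noise w = 0.
Proof.
have [phi [psi [bphi bpsi flow]]] := dy_flow.
apply: null_expectation => //.
pose DM j t w := M T w j 0 - M t w j 0.
apply: (@null_ext _ _ _ _ _ (fun s w =>
  \sum_k \sum_j ((B^T *m Pi s) k j * dv k s w * DM j s w) +
  \sum_k \sum_j (kappa s k j * (dy k s w * DM j s w)))).
  move=> s w; rewrite /lq_cross !bil_mulr !mul1mx !bilE.
  congr (_ + _); apply: eq_bigr => k _; apply: eq_bigr => j _.
    by rewrite /dv /DM !mxE; ring.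
  by rewrite /dy /DM !mxE -/(kappa s); ring.
apply: nullD => //.
  apply: null_sum => // k; apply: null_sum => // j.
  apply: (null_adapted T_gt0 gen_meas) => //.
  - by apply: mbmM => //; exact: mbm_cst.
  - by move=> s sT; exact: dv_adapted.
apply: null_sum => // k; apply: null_sum => // j.
apply: (@null_flow _ _ _ P T T_gt0 gen gen_mono gen_meas _ (fun s => kappa s k j)
   (phi k) (psi k) (fun i => dv i.2) (dy k) (fun t w => M t w j 0)) => //.
- by move=> i s sT; exact: dv_adapted.
- by apply: measurable_funB; [exact: y_joint|exact: z_joint].
- by apply: ae_sub flow => w H s sT; exact: H.
Qed.

Lemma lq_cost_ge_noise : {ae P, forall w,
  lq_cost T q N Rw h (z ^~ w) (u ^~ w) + 2 * lq_noise w <=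
  lq_cost T q N Rw h (y ^~ w) (v ^~ w)}.
Proof.
have pv : {ae P, forall w, forall k, L2 T (fun s => v s w k 0)}.
  by apply: ae_all_fin => k; have [jv ev _] := v_ctrl k; exact: ae_path_L2.
apply: ae_sub2 zy_ode pv => w [zy0 az ay] Lv.
apply: (@lq_cost_ge _ T T_gt0 p m a B q N Rw h) => //.
- by move=> i j; rewrite ord1; have := good_bmeas T_gt0 w (M_good i).
- by move=> i j; rewrite ord1; exact: Lv.
- by move=> t tT; exact: u_fb.
Qed.

End Verification.
End StochasticLQ.

(** * Brownian noise *)

Section Gaussian.
Context (R : realType).
Local Notation mu := (@lebesgue_measure R).

Lemma normal_pdf_eq (s x : R) : s != 0 ->
  normal_pdf 0 s x = normal_peak s * expR (- x ^+ 2 / (s ^+ 2 *+ 2)).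
Proof.
by move=> s0; rewrite /normal_pdf (negbTE s0) /normal_fun subr0.
Qed.

Lemma normal_prob_sym (s : R) (A : set (measurableTypeR R)) : s != 0 ->
  measurable A -> normal_prob 0 s ((-%R : R -> R) @^-1` A) = normal_prob 0 s A.
Proof.
move=> s0 mA; rewrite /normal_prob.
rewrite [RHS](@eq_measure_integral _ _ _ _ (pushforward mu (-%R : R -> measurableTypeR R))); last first.
  by move=> B mB _; rewrite /= -lebesgue_measureN.
rewrite ge0_integral_pushforward//.
- apply: eq_integral => x _; congr EFin.
  by rewrite /= !normal_pdf_eq// sqrrN.
- by apply/measurable_EFinP; apply: measurable_funTS; exact: measurable_normal_pdf.
- by move=> x _; rewrite lee_fin normal_pdf_ge0.
Qed.

Lemma integral_normal_prob (s : R) (f : R -> \bar R) : (forall x, 0 <= f x)%E ->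
  measurable_fun setT f ->
  (\int[normal_prob 0%R s]_x f x = \int[mu]_x (f x * (normal_pdf 0%R s x)%:E))%E.
Proof.
move=> f0 mf; have dom := normal_prob_dominates (0 : R) s.
rewrite -(Radon_Nikodym_SigmaFinite.change_of_variables dom f0 measurableT mf).
have iRN := Radon_Nikodym_SigmaFinite.f_integrable dom.
have mpdf : measurable_fun setT (fun x => (normal_pdf 0 s x)%:E : \bar R).
  by apply/measurable_EFinP; exact: measurable_normal_pdf.
apply: ae_eq_integral => //.
- by apply: emeasurable_funM => //; exact: measurable_int iRN.
- exact: emeasurable_funM.
- have : ae_eq mu setT (Radon_Nikodym_SigmaFinite.f (normal_prob 0 s) mu)
      (fun x => (normal_pdf 0 s x)%:E).
    by apply: integral_ae_eq => // E _ mE; rewrite -Radon_Nikodym_SigmaFinite.f_integral.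
  by apply: filterS => x /(_ I) e _; rewrite e.
Qed.

(** Since [y <= expR y], the second moment of a normal law is at most a multiple
    of the mass of the normal law of twice its variance. *)
Lemma normal_second_moment (s : R) : 0 < s ->
  (\int[normal_prob 0%R s]_x (x ^+ 2)%:E <= (8 * s ^+ 2)%:E)%E.
Proof.
move=> s0; rewrite integral_normal_prob//; last 2 first.
- by move=> x; rewrite lee_fin sqr_ge0.
- by apply/measurable_EFinP; exact: measurable_funX.
pose r := s * Num.sqrt 2.
have r2 : r ^+ 2 = s ^+ 2 *+ 2 by rewrite exprMn sqr_sqrtr// mulr_natr.
have rp : 0 < r by rewrite mulr_gt0// sqrtr_gt0.
have sn0 : s != 0 by rewrite gt_eqF.
have peak : normal_peak s <= 2 * normal_peak r.
  rewrite /normal_peak r2.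
  have a0 : 0 < s ^+ 2 * pi *+ 2 by rewrite pmulrn_lgt0// mulr_gt0 ?pi_gt0// exprn_gt0.
  rewrite ler_pdivlMr ?sqrtr_gt0 ?pmulrn_lgt0// ?mulr_gt0 ?pi_gt0 ?pmulrn_lgt0 ?exprn_gt0//.
  rewrite ler_pdivrMl ?sqrtr_gt0//.
  rewrite -[2]ger0_norm// -sqrtr_sqr -sqrtrM ?sqr_ge0//; last exact: ltW.
  by rewrite ler_sqrt; lra.
rewrite -[leRHS]mule1 -(integral_normal_pdf 0 r) -ge0_integralZl_EFin//; last 3 first.
- by move=> x _; rewrite lee_fin normal_pdf_ge0.
- by apply/measurable_EFinP; exact: measurable_normal_pdf.
- by rewrite mulr_ge0// sqr_ge0.
apply: ge0_le_integral => //.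
- by move=> x _; rewrite -EFinM lee_fin mulr_ge0 ?sqr_ge0// normal_pdf_ge0.
- apply/measurable_EFinP; apply: measurable_funM; first exact: measurable_funX.
  exact: measurable_normal_pdf.
- apply/measurable_EFinP; apply: measurable_funM => //; exact: measurable_normal_pdf.
move=> x _; rewrite -!EFinM lee_fin !normal_pdf_eq ?gt_eqF// r2.
pose y := x ^+ 2 / (s ^+ 2 *+ 4).
have -> : - x ^+ 2 / (s ^+ 2 *+ 2) = - y + - y by rewrite /y; field.
have -> : - x ^+ 2 / (s ^+ 2 *+ 2 *+ 2) = - y by rewrite /y; field.
have -> : x ^+ 2 = 4 * s ^+ 2 * y by rewrite /y; field.
rewrite expRD.
have y1 : y * expR (- y) <= 1.
  rewrite expRN ler_pdivrMr ?expR_gt0// mul1r.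
  by apply: le_trans (expR_ge1Dx y); rewrite lerDr.
have -> : 4 * s ^+ 2 * y * (normal_peak s * (expR (- y) * expR (- y))) =
  4 * s ^+ 2 * normal_peak s * expR (- y) * (y * expR (- y)) by ring.
have -> : 8 * s ^+ 2 * (normal_peak r * expR (- y)) =
  4 * s ^+ 2 * (2 * normal_peak r) * expR (- y) by ring.
have s2 : 0 <= 4 * s ^+ 2 by rewrite mulr_ge0// sqr_ge0.
apply: (@le_trans _ _ (4 * s ^+ 2 * normal_peak s * expR (- y))).
  apply: ler_piMr => //; apply: mulr_ge0; last exact: expR_ge0.
  by apply: mulr_ge0 => //; exact: normal_peak_ge0.
by rewrite ler_wpM2r ?expR_ge0// ler_wpM2l.
Qed.

End Gaussian.

Section SymmetricIndependence.
Context (R : realType) d (Om : measurableType d) (P : probability Om R).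

(** If [D] is symmetric and independent of [Z], then [(Z, D)] and [(Z, - D)] have
    the same law, so that [Z * D] and its opposite have the same mean. *)
Lemma indep_symmetric_mean0 (Z D : Om -> R) :
  measurable_fun setT Z -> measurable_fun setT D ->
  (sqE P Z < +oo)%E -> (sqE P D < +oo)%E ->
  (forall A B : set (measurableTypeR R), measurable A -> measurable B ->
    P (Z @^-1` A `&` D @^-1` B) = (P (Z @^-1` A) * P (D @^-1` B))%E) ->
  (forall B : set (measurableTypeR R), measurable B ->
    P (D @^-1` ((-%R : R -> R) @^-1` B)) = P (D @^-1` B)) ->
  \int[P]_w (Z w * D w) = 0.
Proof.
move=> mZ mD fZ fD ind sym.
have mDN : measurable_fun setT (fun w => - D w) by exact: measurableT_comp.
have iZD := L2_prod_integrable mZ mD fZ fD.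
pose phi1 w : measurableTypeR R * measurableTypeR R := (Z w, D w).
pose phi2 w : measurableTypeR R * measurableTypeR R := (Z w, - D w).
have m1 : measurable_fun setT phi1 by exact: measurable_fun_pair.
have m2 : measurable_fun setT phi2 by exact: measurable_fun_pair.
pose f (x : measurableTypeR R * measurableTypeR R) : \bar R := (x.1 * x.2)%:E.
have mf : measurable_fun setT f.
  by apply/measurable_EFinP; apply: measurable_funM.
have i2 : P.-integrable setT (f \o phi2).
  rewrite (_ : _ \o _ = fun w => (- (Z w * D w)%:E)%E); first exact: integrableN.
  by apply/funext => w; rewrite /f /= mulrN.
have eq_law A : measurable A -> pushforward P phi1 A = pushforward P phi2 A.
  apply: (@measure_unique _ R _ [set A `*` B | A in measurable & B in measurable]
    (fun=> setT)).
  - by rewrite measurable_prod_measurableType.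
  - move=> _ _ [A1 mA1 [B1 mB1 <-]] [A2 mA2 [B2 mB2 <-]].
    exists (A1 `&` A2); first exact: measurableI.
    by exists (B1 `&` B2); [exact: measurableI|rewrite setXI].
  - by move=> _; exists setT => //; exists setT => //; rewrite setXTT.
  - by rewrite bigcup_const.
  - move=> _ [A1 mA1 [B1 mB1 <-]].
    change (P (Z @^-1` A1 `&` D @^-1` B1) =
      P (Z @^-1` A1 `&` D @^-1` ((-%R : R -> R) @^-1` B1))).
    have mN : measurable_fun setT (-%R : measurableTypeR R -> measurableTypeR R).
      exact: oppr_measurable.
    by rewrite !ind// ?sym// -[X in measurable X]setTI; exact: mN.
  - by move=> _; change (P setT < +oo)%E; rewrite probability_setT ltry.
have e : (\int[P]_w (Z w * D w)%:E = \int[P]_w (- (Z w * D w))%:E)%E.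
  have -> : (\int[P]_w (Z w * D w)%:E = \int[pushforward P phi1]_x f x)%E.
    by rewrite (integral_pushforward m1 mf).
  rewrite (eq_measure_integral (pushforward P phi2)); last by move=> A mA _; exact: eq_law.
  rewrite (integral_pushforward m2 mf)//.
  by apply: eq_integral => w _; rewrite /f /= mulrN.
have := congr1 fine e; rewrite -/(Rintegral P setT (fun w => Z w * D w)).
rewrite -/(Rintegral P setT (fun w => - (Z w * D w))).
have -> : \int[P]_w (- (Z w * D w)) = - \int[P]_w (Z w * D w).
  rewrite -[RHS]mulN1r -RintegralZl//.
  by apply: eq_Rintegral => w _; rewrite mulN1r.
by lra.
Qed.

End SymmetricIndependence.

Lemma big_option_type (Rt : Type) (idx : Rt) (op : Monoid.com_law idx) (I : finType)
    (F : option I -> Rt) :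
  \big[op/idx]_o F o = op (F None) (\big[op/idx]_i F (Some i)).
Proof.
rewrite (bigD1 None)//= (reindex_omap Some id)/=; last by case.
by congr (op _ _); apply: eq_bigl => i; rewrite eqxx.
Qed.

Section Brownian.
Context (R : realType) dOm (Om : measurableType dOm) (P : probability Om R).
Variables (n d N : nat) (T : R).
Variables (xi : option 'I_N -> Om -> 'cV[R]_n)
  (W : option 'I_N -> R -> Om -> 'cV[R]_d).
Hypothesis T_gt0 : 0 < T.
Hypothesis W_bm : forall a, brownian_motion P T (W a).
Hypothesis xi_meas : forall a, random_vector (xi a).
Hypothesis indep : mutual_indep P (fun o : option (option 'I_N) =>
    if o is Some a
    then <<s \bigcup_(s in `[0, T]) vec_events (W a s) >>
    else <<s \bigcup_(a in [set: option 'I_N]) vec_events (xi a) >>).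

(** The generators of the filtration, rather than the sigma-algebra itself, so that the
    results for generated filtrations apply. *)
Definition history (t : R) : set (set Om) :=
  (\bigcup_(a in [set: option 'I_N]) vec_events (xi a)) `|`
      (\bigcup_(a in [set: option 'I_N])
         \bigcup_(s in `[0, t]) vec_events (W a s)).

Lemma vec_eventsP p (X : Om -> 'cV[R]_p) E :
  vec_events X E <-> exists k (B : set R), measurable B /\ E = (fun w => X w k 0) @^-1` B.
Proof.
split=> [[k _ [B mB <-]]|[k [B [mB ->]]]].
  by exists k, B; split=> //; rewrite setTI.
by exists k => //; exists B => //; rewrite setTI.
Qed.

Lemma history_mono s t : s <= t -> history s `<=` history t.
Proof.
move=> st; apply: setUS => E [a _ [r rs EE]]; exists a => //; exists r => //.
by move: rs; rewrite /= !in_itv /= => /andP[-> /le_trans->].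
Qed.

Lemma history_meas t : t \in `[0, T] -> history t `<=` measurable.
Proof.
rewrite in_itv /= => /andP[_ tT] E [[a _ /vec_eventsP[k [B [mB ->]]]]|].
  by rewrite -[X in measurable X]setTI; exact: xi_meas.
move=> [a _ [r /= rt /vec_eventsP[k [B [mB ->]]]]].
rewrite -[X in measurable X]setTI; apply: (bm_measurable (W_bm a)) => //.
by move: rt; rewrite !in_itv /= => /andP[-> /le_trans->].
Qed.

Lemma gm_component t p (X : Om -> 'cV[R]_p) k :
  vec_events X `<=` <<s history t >> -> gm history t (fun w => X w k 0).
Proof.
move=> Xt _ B mB; rewrite setTI; apply: Xt.
by apply/vec_eventsP; exists k, B.
Qed.

Lemma gm_init a t k : gm history t (fun w => xi a w k 0).
Proof.
apply: gm_component => E EE; apply: sub_sigma_algebra; left; by exists a.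
Qed.

Lemma gm_brownian a t k : 0 <= t -> gm history t (fun w => W a t w k 0).
Proof.
move=> t0; apply: gm_component => E EE; apply: sub_sigma_algebra; right; exists a => //.
by exists t => //=; rewrite in_itv /= t0 lexx.
Qed.

Lemma brownian_law a s t k (B : set (measurableTypeR R)) :
  0 <= s -> s < t -> t <= T -> measurable B ->
  P ((fun w => (W a t w - W a s w) k 0) @^-1` B) =
  normal_prob 0%R (Num.sqrt (t - s)) B.
Proof.
move=> s0 st tT mB.
pose E j : set R := if j == k then B else setT.
have mE j : measurable (E j) by rewrite /E; case: ifP.
have := bm_normal (W_bm a) s0 st tT mE.
rewrite (bigD1 k)//= big1 ?setIT; last first.
  by move=> j jk; rewrite /E (negbTE jk); apply/seteqP; split.
rewrite [RHS](bigD1 k)//= [X in (_ * X)%E]big1 ?mule1; last first.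
  by move=> j jk; rewrite /E (negbTE jk); exact: probability_setT.
by rewrite /E eqxx.
Qed.

Lemma measurable_brownian a t k : t \in `[0, T] ->
  measurable_fun setT (fun w => W a t w k 0).
Proof. by move=> tT; exact: (bm_measurable (W_bm a) tT). Qed.

Lemma measurable_brownian_incr a s t k : s \in `[0, T] -> t \in `[0, T] ->
  measurable_fun setT (fun w => (W a t w - W a s w) k 0).
Proof.
move=> sT tT; under eq_fun do rewrite !mxE.
by apply: measurable_funB; exact: measurable_brownian.
Qed.

Lemma brownian_incr_sqE a s t k : 0 <= s -> s < t -> t <= T ->
  (sqE P (fun w => (W a t w - W a s w) k 0)%R <= (8 * (t - s))%:E)%E.
Proof.
move=> s0 st tT.
have sT : s \in `[0, T] by rewrite in_itv /= s0 (le_trans (ltW st)).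
have tT' : t \in `[0, T] by rewrite in_itv /= tT (le_trans s0 (ltW st)).
pose D w : measurableTypeR R := (W a t w - W a s w) k 0.
have mD : measurable_fun setT D by exact: measurable_brownian_incr.
have r0 : 0 < Num.sqrt (t - s) by rewrite sqrtr_gt0 subr_gt0.
have := normal_second_moment r0; rewrite sqr_sqrtr ?subr_ge0 ?(ltW st)//.
apply: le_trans; rewrite /sqE le_eqVlt; apply/orP; left; apply/eqP.
transitivity (\int[pushforward P D]_x (x ^+ 2)%:E)%E.
  rewrite (ge0_integral_pushforward mD)//.
  - by apply/measurable_EFinP; exact: measurable_funX.
  - by move=> x _; rewrite lee_fin sqr_ge0.
by apply: eq_measure_integral => A mA _; exact: (brownian_law a k s0 st tT mA).
Qed.

(** The past is generated by the intersections of an event on the initial states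
    with one event for each past Brownian path; for these the product rule is the
    independence of the sources combined with that of the increments of [W a]. *)
Lemma brownian_incr_indep a s t k (B : set (measurableTypeR R)) E :
  0 <= s -> s < t -> t <= T -> measurable B -> <<s history s >> E ->
  P (E `&` (fun w => (W a t w - W a s w) k 0) @^-1` B) =
  (P E * P ((fun w => (W a t w - W a s w)%R k 0%R) @^-1` B))%E.
Proof.
move=> s0 st tT mB.
set D := (fun w => _) @^-1` B.
have sT : s \in `[0, T] by rewrite in_itv /= s0 (le_trans (ltW st)).
have tT' : t \in `[0, T] by rewrite in_itv /= tT (le_trans s0 (ltW st)).
have mD : measurable D by rewrite -[D]setTI; exact: measurable_brownian_incr.
pose Fx := <<s \bigcup_(b in [set: option 'I_N]) vec_events (xi b) >>.
pose Fw r b := <<s \bigcup_(r' in `[0, r]) vec_events (W b r') >>.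
have sigI (F : set (set Om)) A A' : <<s F >> A -> <<s F >> A' -> <<s F >> (A `&` A').
  by move=> FA FA'; exact: (@measurableI _ (g_sigma_algebraType F)).
have sigT (F : set (set Om)) : <<s F >> setT.
  exact: (@measurableT _ (g_sigma_algebraType F)).
have Fws b A : Fw s b A -> Fw T b A.
  apply: sub_sigma_algebra2 => A' [r rs EE]; exists r => //.
  by move: rs; rewrite /= !in_itv /= => /andP[-> /le_trans->//]; rewrite (le_trans (ltW st)).
have FTt b r j : r \in `[0, T] ->
    measurable_fun setT ((fun w => W b r w j 0) :
      g_sigma_algebraType (\bigcup_(r' in `[0, T]) vec_events (W b r')) -> R).
  move=> rT _ A mA; rewrite setTI; apply: sub_sigma_algebra; exists r => //.
  by apply/vec_eventsP; exists j, A.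
have FwD : Fw T a D.
  have := measurable_funB (FTt a t k tT') (FTt a s k sT) measurableT mB.
  by rewrite setTI; congr (Fw T a _); apply/funext => w; rewrite /D /preimage /= !mxE.
pose G : set (set Om) := [set E | exists Ax Aw, [/\ Fx Ax,
  forall b, Fw s b (Aw b) & E = Ax `&` \big[setI/setT]_b Aw b]].
have prodE Ax Aw : Fx Ax -> (forall b, Fw T b (Aw b)) ->
    P (Ax `&` \big[setI/setT]_b Aw b) = (P Ax * \prod_b P (Aw b))%E.
  move=> hx hw.
  pose EE (o : option (option 'I_N)) := if o is Some b then Aw b else Ax.
  have hE (o : option (option 'I_N)) : (if o is Some b then Fw T b else Fx) (EE o).
    by case: o.
  have := indep [set: option (option 'I_N)]%SET hE.
  rewrite (eq_bigl xpredT) => [|b]; last by rewrite inE.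
  rewrite [in RHS](eq_bigl xpredT) => [|b]; last by rewrite inE.
  by rewrite !big_option_type.
have GD : forall E', G E' -> P (E' `&` D) = (P E' * P D)%E.
  move=> _ [Ax [Aw [hx hw ->]]].
  rewrite prodE//; last by move=> b; exact: Fws.
  pose Aw' b := if b == a then Aw a `&` D else Aw b.
  have -> : Ax `&` \big[setI/setT]_b Aw b `&` D = Ax `&` \big[setI/setT]_b Aw' b.
    rewrite -setIA; congr (_ `&` _).
    rewrite (bigD1 a)//= [RHS](bigD1 a)//= /Aw' eqxx setIAC; congr (_ `&` _).
    by apply: eq_bigr => b /negbTE ->.
  rewrite prodE//; last first.
    move=> b; rewrite /Aw'; case: eqP => [->|_]; last exact: Fws.
    by apply: sigI => //; exact: Fws.
  rewrite (bigD1 a)//= [in RHS](bigD1 a)//= {1}/Aw' eqxx.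
  rewrite (eq_bigr (fun b => P (Aw b))); last by move=> b /negbTE; rewrite /Aw' => ->.
  have -> : P (Aw a `&` D) = (P (Aw a) * P D)%E.
    pose F b := if b then D else Aw a.
    have hF (b : bool) : (if b then <<s vec_events (fun w => W a t w - W a s w) >>
        else Fw s a) (F b).
      case: b; last exact: hw.
      by apply: sub_sigma_algebra; apply/vec_eventsP; exists k, B.
    have := bm_indep (W_bm a) s0 st tT [set: bool]%SET hF.
    rewrite (eq_bigl xpredT) => [|b]; last by rewrite inE.
    rewrite [in RHS](eq_bigl xpredT) => [|b]; last by rewrite inE.
    by rewrite !big_bool /= setIC muleC.
  by rewrite -!muleA; congr (_ * (_ * _))%E; rewrite muleC.
have Gmeas : G `<=` measurable.
  have hist := history_meas sT.
  have sm (F : set (set Om)) : F `<=` history s -> <<s F >> `<=` measurable.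
    move=> Fh; apply: smallest_sub; first exact: sigma_algebra_measurable.
    exact: subset_trans Fh hist.
  move=> _ [Ax [Aw [hx hw ->]]]; apply: measurableI.
    by apply: sm hx => A hA; left.
  apply: bigsetI_measurable => b _.
  by apply: sm (hw b) => A hA; right; exists b.
have GI : setI_closed G.
  move=> _ _ [Ax [Aw [hx hw ->]]] [Ax' [Aw' [hx' hw' ->]]].
  exists (Ax `&` Ax'), (fun b => Aw b `&` Aw' b); split.
  - exact: sigI.
  - by move=> b; exact: (sigI _ _ _ (hw b) (hw' b)).
  - by rewrite big_split/= setIACA.
have sub : <<s history s >> `<=` <<s G >>.
  apply: sub_sigma_algebra2 => A [hA|[b _ hA]].
    exists A, (fun=> setT); split; [exact: sub_sigma_algebra|by move=> b; exact: sigT|].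
    by rewrite big1// setIT.
  exists setT, (fun b' => if b' == b then A else setT); split.
  - exact: sigT.
  - by move=> b'; case: eqP => [->|_]; [exact: sub_sigma_algebra|exact: sigT].
  by rewrite setTI (bigD1 b)//= eqxx big1 ?setIT// => b' /negbTE ->.
move=> /sub; move: E.
have r0 : 0 <= fine (P D) by rewrite fine_ge0.
pose m2 := mscale (NngNum r0) P.
move=> E GE.
suff : mrestr P mD E = m2 E.
  by rewrite /mrestr /m2 /mscale /= fineK ?fin_num_measure// => ->; rewrite muleC.
move: E GE; apply: (@g_sigma_algebra_measure_unique _ _ _ G Gmeas (fun=> setT)) => //.
- move=> _; exists setT, (fun=> setT); split; [exact: sigT|by move=> b; exact: sigT|].
  by rewrite big1// setIT.
- by rewrite bigcup_const.
- move=> A GA; rewrite /= /mrestr /mscale /= fineK ?fin_num_measure// GD//.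
  by rewrite muleC.
- by move=> _; rewrite /= /mrestr setTI ltey_eq fin_num_measure.
Qed.

(** Increments are independent of the past and have a symmetric law. *)
Lemma brownian_noise a : noise P T history (W a).
Proof.
split=> k.
  split.
  - move=> w t; apply: (cvg_comp (fun r => W a r w) (fun A : 'cV[R]_d => A k 0)).
      exact: (bm_continuous (W_bm a)).
    exact: coord_continuous.
  - by move=> s; rewrite in_itv /= => /andP[s0 _]; exact: gm_brownian.
  - exists (8 * T) => s; rewrite in_itv /= => /andP[s0 sT].
    move: s0; rewrite le_eqVlt => /predU1P[<-|s0].
      rewrite /sqE (eq_integral (cst 0%E)) ?integral0 ?lee_fin ?mulr_ge0 ?ltW// => w _.
      by rewrite (bm_start (W_bm a)) mxE expr0n.
    have := brownian_incr_sqE a k (lexx 0) s0 sT; rewrite subr0.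
    under eq_fun do rewrite (bm_start (W_bm a)) subr0.
    by move=> /le_trans; apply; rewrite lee_fin ler_wpM2l.
move=> s sT Z gZ fZ; have := sT; rewrite in_itv /= => /andP[s0].
rewrite le_eqVlt => /predU1P[->|st].
  by under eq_Rintegral do rewrite subrr mulr0; rewrite Rintegral_cst// mul0r.
have e : (fun w => W a T w k 0 - W a s w k 0) = (fun w => (W a T w - W a s w) k 0).
  by apply/funext => w; rewrite !mxE.
under eq_Rintegral => w _ do rewrite (congr1 (@^~ w) e).
have mD := measurable_brownian_incr a k sT (inTT T_gt0).
apply: indep_symmetric_mean0 => //.
- exact: (gm_measurable history_meas sT gZ).
- by apply: (le_lt_trans (brownian_incr_sqE a k s0 st (lexx T))); exact: ltry.
- move=> A B mA mB; apply: brownian_incr_indep => //.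
  by rewrite -[X in <<s _ >> X]setTI; exact: gZ.
- move=> B mB; rewrite brownian_law//; last first.
    rewrite -[X in measurable X]setTI.
    have mN : measurable_fun setT (-%R : measurableTypeR R -> measurableTypeR R).
      exact: oppr_measurable.
    exact: mN.
  rewrite normal_prob_sym// ?brownian_law//.
  by rewrite gt_eqF// sqrtr_gt0 subr_gt0.
Qed.

End Brownian.

(** * The coupled Riccati equations *)

Section TerminalOde.
Context (R : realType) (T : R).
Hypothesis T_gt0 : 0 < T.

Lemma terminal_ode_eq p q (X Y Phi Psi : R -> 'M[R]_(p, q)) (XT YT : 'M[R]_(p, q)) :
  {in `[0, T], X =1 Y} -> {in `[0, T], Phi =1 Psi} -> XT = YT ->
  terminal_ode T X Phi XT -> terminal_ode T Y Psi YT.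
Proof.
move=> XY PP <- /(terminal_odeP T_gt0)[aX X_T]; apply/(terminal_odeP T_gt0); split.
  by apply: (mac_eq T_gt0 _ _ aX) => t tT; rewrite ?XY ?PP.
by rewrite -XY// inTT.
Qed.

Lemma terminal_odeD p q (X Y Phi Psi : R -> 'M[R]_(p, q)) (XT YT : 'M[R]_(p, q)) :
  terminal_ode T X Phi XT -> terminal_ode T Y Psi YT ->
  terminal_ode T (fun t => X t + Y t) (fun t => Phi t + Psi t) (XT + YT).
Proof.
move=> /(terminal_odeP T_gt0)[aX <-] /(terminal_odeP T_gt0)[aY <-].
apply/(terminal_odeP T_gt0); split=> //.
by apply: (mac_eq T_gt0 _ _ (macD T_gt0 aX aY)) => // t tT; rewrite opprD.
Qed.

Lemma terminal_odeN p q (X Phi : R -> 'M[R]_(p, q)) (XT : 'M[R]_(p, q)) :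
  terminal_ode T X Phi XT -> terminal_ode T (fun t => - X t) (fun t => - Phi t) (- XT).
Proof.
move=> /(terminal_odeP T_gt0)[aX <-]; apply/(terminal_odeP T_gt0); split=> //.
by have := macN T_gt0 aX.
Qed.

Lemma terminal_ode_block p1 p2 q1 q2 (X11 F11 : R -> 'M[R]_(p1, q1))
    (X12 F12 : R -> 'M[R]_(p1, q2)) (X21 F21 : R -> 'M[R]_(p2, q1))
    (X22 F22 : R -> 'M[R]_(p2, q2)) T11 T12 T21 T22 :
  terminal_ode T (fun t => block_mx (X11 t) (X12 t) (X21 t) (X22 t))
    (fun t => block_mx (F11 t) (F12 t) (F21 t) (F22 t)) (block_mx T11 T12 T21 T22) <->
  [/\ terminal_ode T X11 F11 T11, terminal_ode T X12 F12 T12,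
      terminal_ode T X21 F21 T21 & terminal_ode T X22 F22 T22].
Proof.
split.
  move=> /(terminal_odeP T_gt0)[aX /eq_block_mx[<- <- <- <-]].
  split; apply/(terminal_odeP T_gt0); split=> // i j.
  - by apply: (ac_eq T_gt0 _ _ (aX (lshift _ i) (lshift _ j))) => t _;
      rewrite ?opp_block_mx ?block_mxEul.
  - by apply: (ac_eq T_gt0 _ _ (aX (lshift _ i) (rshift _ j))) => t _;
      rewrite ?opp_block_mx ?block_mxEur.
  - by apply: (ac_eq T_gt0 _ _ (aX (rshift _ i) (lshift _ j))) => t _;
      rewrite ?opp_block_mx ?block_mxEdl.
  - by apply: (ac_eq T_gt0 _ _ (aX (rshift _ i) (rshift _ j))) => t _;
      rewrite ?opp_block_mx ?block_mxEdr.
move=> [/(terminal_odeP T_gt0)[a11 <-] /(terminal_odeP T_gt0)[a12 <-]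
  /(terminal_odeP T_gt0)[a21 <-] /(terminal_odeP T_gt0)[a22 <-]].
apply/(terminal_odeP T_gt0); split=> // i j.
case: (split_ordP i) => k ->; case: (split_ordP j) => l ->.
- by apply: (ac_eq T_gt0 _ _ (a11 k l)) => t _; rewrite ?opp_block_mx ?block_mxEul.
- by apply: (ac_eq T_gt0 _ _ (a12 k l)) => t _; rewrite ?opp_block_mx ?block_mxEur.
- by apply: (ac_eq T_gt0 _ _ (a21 k l)) => t _; rewrite ?opp_block_mx ?block_mxEdl.
- by apply: (ac_eq T_gt0 _ _ (a22 k l)) => t _; rewrite ?opp_block_mx ?block_mxEdr.
Qed.

End TerminalOde.

Lemma row_congr (R : comPzRingType) p q1 q2 r1 r2 (X1 : 'M[R]_(p, q1))
    (X2 : 'M[R]_(p, q2)) (S : 'M[R]_p) (Y1 : 'M[R]_(p, r1)) (Y2 : 'M[R]_(p, r2)) :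
  (row_mx X1 X2)^T *m S *m row_mx Y1 Y2 =
  block_mx (X1^T *m S *m Y1) (X1^T *m S *m Y2) (X2^T *m S *m Y1) (X2^T *m S *m Y2).
Proof. by rewrite tr_row_mx mul_col_mx mul_col_row. Qed.

Lemma weight_block (R : realType) p (S X Y : 'M[R]_p) : S^T = S ->
  (row_mx (1%:M - X) (- Y))^T *m S *m row_mx (1%:M - X) (- Y) =
  block_mx (S - (S *m X + X^T *m S - X^T *m S *m X)) (- (S *m Y - X^T *m S *m Y))
    (- (S *m Y - X^T *m S *m Y)^T) (Y^T *m S *m Y).
Proof.
have tB (U V : 'M[R]_p) : (U - V)^T = U^T - V^T by exact: raddfB.
have tN (U : 'M[R]_p) : (- U)^T = - U^T by exact: raddfN.
move=> Ss; rewrite row_congr !tB tN trmx1 !trmx_mul trmxK Ss.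
rewrite !(mulmxDl, mulmxDr, mulmxN, mulNmx, mulmx1, mul1mx, mulmxA, opprK).
by congr block_mx; mxadd.
Qed.

Section SocialRiccati.
Context (R : realType) (n m d : nat) (c : model R n m d) (T : R).
Hypothesis T_gt0 : 0 < T.
Variables P0 Pb : R -> 'M[R]_(m, n).

Local Notation A0 := (mA0 c).
Local Notation B0 := (mB0 c).
Local Notation G0 := (mG0 c).
Local Notation A := (mA c).
Local Notation B := (mB c).
Local Notation G := (mG c).
Local Notation F := (mF c).
Local Notation B1 := (mB1 c).
Local Notation Q := (mQ c).
Local Notation H := (mH c).
Local Notation Rw := (mR c).
Local Notation L := (mL c).
Local Notation R1 := (mR1 c).
Local Notation Gam := (mGam c).
Local Notation Gam1 := (mGam1 c).
Local Notation Gamb := (mGamb c).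
Local Notation Gamb1 := (mGamb1 c).
Local Notation S := (B *m invmx Rw *m B^T).

(** The linear-quadratic problem of the pair (average of the followers, leader). The
    control of the leader is [mean_gain] times the state, so that its cost [R1] becomes
    a state cost and its coupling [L] with the controls a cross weight. *)
Definition mean_gain t : 'M[R]_(m, n + n) := row_mx (Pb t) (P0 t).
Definition mean_a t : 'M[R]_(n + n) :=
  block_mx (A + G + B1 *m Pb t) (F + B1 *m P0 t) (G0 + B0 *m Pb t) (A0 + B0 *m P0 t).
Definition mean_B : 'M[R]_(n + n, m) := col_mx B 0.
Definition mean_C : 'M[R]_(n, n + n) := row_mx (1%:M - Gam) (- Gam1).
Definition mean_Cb : 'M[R]_(n, n + n) := row_mx (1%:M - Gamb) (- Gamb1).
Definition mean_q t := mean_C^T *m Q *m mean_C + (mean_gain t)^T *m R1 *m mean_gain t.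
Definition mean_N t := L *m mean_gain t.
Definition mean_h := mean_Cb^T *m H *m mean_Cb.

Definition mean_ric := ric (lq_a mean_a mean_B mean_N Rw) (lq_q mean_q mean_N Rw)
  (lq_S mean_B Rw).
Definition dev_ric := ric (fun _ : R => A) (fun=> Q) S.

Hypotheses (hA2 : assumptionA2 c) (hA4 : assumptionA4 c).
Hypotheses (P0_L2 : mx_L2 T P0) (Pb_L2 : mx_L2 T Pb).

Lemma Rw_posdef : posdef Rw. Proof. by case: hA2 => _ []. Qed.
Lemma Q_psd : psd Q. Proof. by case: hA2 => _ []. Qed.
Lemma H_psd : psd H. Proof. by case: hA2 => _ []. Qed.

(** Completing the square in the second argument leaves the Schur complement of
    [R1], which is nonnegative by assumption. *)
Lemma coupled_weight_ge0 (u z : 'cV[R]_m) :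
  0 <= wnorm Rw u + 2 * bil L u z + wnorm R1 z.
Proof.
have [pR1 [_ ge0]] := hA4.
have uR1 := posdef_unit pR1; have R1s := pR1.1.
have iR1s := invmx_sym R1s.
pose y := z + invmx R1 *m L^T *m u.
have h1 : 0 <= bil R1 y y by exact: (posdef_psd pR1).2.
have h2 : 0 <= bil (Rw - L *m invmx R1 *m L^T) u u by exact: ge0.
suff -> : wnorm Rw u + 2 * bil L u z + wnorm R1 z =
    bil R1 y y + bil (Rw - L *m invmx R1 *m L^T) u u by exact: addr_ge0.
rewrite !wnormE /y bilDl !bilDr bilBM !(bil_mull, bil_mulr) trmx_mul trmxK iR1s.
rewrite !mulmxA !(mulmxV, mulmxK, mulmxKV)// !mul1mx [bil L^T z u]bil_tr trmxK.
by ring.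
Qed.

(** The other Schur complement: substitute the minimizing control. *)
Lemma R1_complement_psd : psd (R1 - L^T *m invmx Rw *m L).
Proof.
have [pR1 _] := hA4; have pR := Rw_posdef.
have uR := posdef_unit pR; have iRs := invmx_sym pR.1.
split; first by rewrite linearB /= !trmx_mul trmxK iRs pR1.1 mulmxA.
move=> z; have := coupled_weight_ge0 (- (invmx Rw *m L *m z)) z.
rewrite !wnormE !bilNl bilNr opprK bilBM !(bil_mull, bil_mulr) !trmx_mul iRs.
by rewrite !mulmxA mulmxKV//; congr (_ <= _); ring.
Qed.

Lemma mean_run_ge0 t z u : 0 <= lq_run mean_q mean_N Rw t z u.
Proof.
have := coupled_weight_ge0 u (mean_gain t *m z).
have : 0 <= wnorm Q (mean_C *m z) by exact: Q_psd.2.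
rewrite /lq_run /mean_q /mean_N !wnormE !(bil_mull, bil_mulr) bilDM ?mulmxA.
by lra.
Qed.

Lemma mean_q_sym t : (mean_q t)^T = mean_q t.
Proof.
have [pR1 _] := hA4.
rewrite /mean_q linearD /= !trmx_mul !trmxK Q_psd.1 pR1.1.
by rewrite !mulmxA.
Qed.

Lemma mean_q_complement t : lq_q mean_q mean_N Rw t =
  mean_C^T *m Q *m mean_C
  + (mean_gain t)^T *m (R1 - L^T *m invmx Rw *m L) *m mean_gain t.
Proof.
rewrite /lq_q /mean_q /mean_N trmx_mul.
move: mean_C (mean_gain t) (invmx Rw) => C Th iR.
rewrite !(mulmxDr, mulmxDl, mulmxN, mulNmx, mulmxA) -addrA; congr (_ + _).
Qed.

Lemma mean_ric_block (M K0 Lamb Lam0 : R -> 'M[R]_n) t :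
  mean_ric (fun t => block_mx (M t) (K0 t) (Lamb t) (Lam0 t)) t =
  block_mx
    ((A + G + B1bar c *m Pb t)^T *m M t + (G0 + B0 *m Pb t)^T *m Lamb t
     + M t *m (A + G + B1bar c *m Pb t) + K0 t *m (G0 + B0 *m Pb t)
     - M t *m S *m M t + Q - QGam c
     + (Pb t)^T *m (R1 - L^T *m invmx Rw *m L) *m Pb t)
    ((A + G + B1bar c *m Pb t)^T *m K0 t + (G0 + B0 *m Pb t)^T *m Lam0 t
     + M t *m (F + B1bar c *m P0 t) + K0 t *m (A0 + B0 *m P0 t)
     - M t *m S *m K0 t - QGam1 c
     + (Pb t)^T *m (R1 - L^T *m invmx Rw *m L) *m P0 t)
    ((F + B1bar c *m P0 t)^T *m M t + (A0 + B0 *m P0 t)^T *m Lamb t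
     + Lamb t *m (A + G + B1bar c *m Pb t) + Lam0 t *m (G0 + B0 *m Pb t)
     - Lamb t *m S *m M t - (QGam1 c)^T
     + (P0 t)^T *m (R1 - L^T *m invmx Rw *m L) *m Pb t)
    ((F + B1bar c *m P0 t)^T *m K0 t + (A0 + B0 *m P0 t)^T *m Lam0 t
     + Lamb t *m (F + B1bar c *m P0 t) + Lam0 t *m (A0 + B0 *m P0 t)
     - Lamb t *m S *m K0 t + Gam1^T *m Q *m Gam1
     + (P0 t)^T *m (R1 - L^T *m invmx Rw *m L) *m P0 t).
Proof.
rewrite /mean_ric /ric mean_q_complement.
have -> : lq_a mean_a mean_B mean_N Rw t = block_mx
    (A + G + B1bar c *m Pb t) (F + B1bar c *m P0 t)
    (G0 + B0 *m Pb t) (A0 + B0 *m P0 t).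
  rewrite /lq_a /mean_a /mean_B /mean_N /mean_gain mul_col_mx mul0mx mul_mx_row.
  rewrite mul_col_row !mul0mx opp_block_mx add_block_mx !oppr0 !addr0 /B1bar.
  by rewrite !mulmxBl !mulmxA !addrA.
have -> : lq_S mean_B Rw = block_mx S 0 0 0.
  by rewrite /lq_S /mean_B mul_col_mx mul0mx tr_col_mx trmx0 mul_col_row !mulmx0 !mul0mx.
rewrite /mean_C weight_block ?Q_psd.1// row_congr tr_block_mx -/(QGam c) -/(QGam1 c).
rewrite !mulmx_block !(mulmx0, mul0mx, addr0) opp_block_mx !add_block_mx.
by congr block_mx; mxadd.
Qed.

Lemma mean_h_block : mean_h =
  block_mx (H - HGamb c) (- HGamb1 c) (- (HGamb1 c)^T) (Gamb1^T *m H *m Gamb1).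
Proof. by rewrite /mean_h weight_block// H_psd.1. Qed.

(** The coupled equations are two Riccati equations: that of [K], and that of the
    block matrix with first entry [K + Kb] for the pair of the mean state of the
    followers and the state of the leader. *)
Lemma riccati_systemP (K Kb K0 Lam0 Lamb : R -> 'M[R]_n) :
  riccati_system c T P0 Pb K Kb K0 Lam0 Lamb <->
  let Pi t := block_mx (K t + Kb t) (K0 t) (Lamb t) (Lam0 t) in
  terminal_ode T K (dev_ric K) H /\ terminal_ode T Pi (mean_ric Pi) mean_h.
Proof.
rewrite /=.
pose r11 t := (A + G + B1bar c *m Pb t)^T *m (K t + Kb t) + (G0 + B0 *m Pb t)^T *m Lamb t
     + (K t + Kb t) *m (A + G + B1bar c *m Pb t) + K0 t *m (G0 + B0 *m Pb t)
     - (K t + Kb t) *m S *m (K t + Kb t) + Q - QGam c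
     + (Pb t)^T *m (R1 - L^T *m invmx Rw *m L) *m Pb t.
(* the equation of [Kb] is that of the first block minus that of [K] *)
have E11 t : (A + G + B1bar c *m Pb t)^T *m Kb t + Kb t *m (A + G + B1bar c *m Pb t)
        - K t *m S *m Kb t - Kb t *m S *m K t - Kb t *m S *m Kb t
        + (G + B1bar c *m Pb t)^T *m K t + K t *m (G + B1bar c *m Pb t)
        + K0 t *m (G0 + B0 *m Pb t) + (G0 + B0 *m Pb t)^T *m Lamb t
        + (Pb t)^T *m R1 *m Pb t - QGam c
        - (Pb t)^T *m (L^T *m invmx Rw *m L) *m Pb t = r11 t - dev_ric K t.
  rewrite /r11 /dev_ric /ric -[A + G + _]addrA [(A + _)^T]linearD /=.
  move: (G + _) (G0 + _) (QGam c) => X Y Z.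
  mxabel.
pose r12 t := (A + G + B1bar c *m Pb t)^T *m K0 t + (G0 + B0 *m Pb t)^T *m Lam0 t
     + (K t + Kb t) *m (F + B1bar c *m P0 t) + K0 t *m (A0 + B0 *m P0 t)
     - (K t + Kb t) *m S *m K0 t - QGam1 c
     + (Pb t)^T *m (R1 - L^T *m invmx Rw *m L) *m P0 t.
pose r21 t := (F + B1bar c *m P0 t)^T *m (K t + Kb t) + (A0 + B0 *m P0 t)^T *m Lamb t
     + Lamb t *m (A + G + B1bar c *m Pb t) + Lam0 t *m (G0 + B0 *m Pb t)
     - Lamb t *m S *m (K t + Kb t) - (QGam1 c)^T
     + (P0 t)^T *m (R1 - L^T *m invmx Rw *m L) *m Pb t.
pose r22 t := (F + B1bar c *m P0 t)^T *m K0 t + (A0 + B0 *m P0 t)^T *m Lam0 t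
     + Lamb t *m (F + B1bar c *m P0 t) + Lam0 t *m (A0 + B0 *m P0 t)
     - Lamb t *m S *m K0 t + Gam1^T *m Q *m Gam1
     + (P0 t)^T *m (R1 - L^T *m invmx Rw *m L) *m P0 t.
rewrite (_ : mean_ric _ = fun t => block_mx (r11 t) (r12 t) (r21 t) (r22 t)); last first.
  by apply/funext => t; exact: mean_ric_block.
rewrite mean_h_block terminal_ode_block//.
split.
- move=> [eK eKb eK0 eLam0 eLamb]; split; first exact: eK.
  split.
  + apply: (terminal_ode_eq T_gt0 _ _ _ (terminal_odeD T_gt0 eK eKb)) => // t _.
    by rewrite E11 addrC subrK.
  + by apply: (terminal_ode_eq T_gt0 _ _ _ eK0) => // t _; rewrite /r12; mxabel.
  + by apply: (terminal_ode_eq T_gt0 _ _ _ eLamb) => // t _; rewrite /r21; mxabel.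
  + by apply: (terminal_ode_eq T_gt0 _ _ _ eLam0) => // t _; rewrite /r22; mxabel.
- move=> [eK [eM eK0 eLamb eLam0]]; split.
  + exact: eK.
  + apply: (terminal_ode_eq T_gt0 _ _ _ (terminal_odeD T_gt0 eM (terminal_odeN T_gt0 eK))).
    * by move=> t _; rewrite addrAC subrr add0r.
    * by move=> t _; rewrite E11.
    * by rewrite addrAC subrr add0r.
  + by apply: (terminal_ode_eq T_gt0 _ _ _ eK0) => // t _; rewrite /r12; mxabel.
  + by apply: (terminal_ode_eq T_gt0 _ _ _ eLam0) => // t _; rewrite /r22; mxabel.
  + by apply: (terminal_ode_eq T_gt0 _ _ _ eLamb) => // t _; rewrite /r21; mxabel.
Qed.

Lemma mean_gain_L2 : mL2 T mean_gain.
Proof.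
move=> i j; case: (split_ordP j) => l ->.
  by apply: (L2_eq _ (Pb_L2 i l)) => t _; rewrite row_mxEl.
by apply: (L2_eq _ (P0_L2 i l)) => t _; rewrite row_mxEr.
Qed.

Lemma mean_N_L2 : mL2 T mean_N.
Proof. by apply: mL2Ml mean_gain_L2; exact: mbm_cst. Qed.

Lemma mean_q_L1 : mL1 T mean_q.
Proof.
apply: mL1D; first exact: mL1_cst.
by apply: mL2M mean_gain_L2; apply: mL2Mr; [exact/mL2_tr/mean_gain_L2|exact: mbm_cst].
Qed.

Lemma mean_a_L1 : mL1 T mean_a.
Proof.
have LPb p (X : 'M[R]_(p, m)) : mL1 T (fun t => X *m Pb t).
  by apply: mL1Ml; [exact: mbm_cst|exact: (mL2_mL1 Pb_L2)].
have LP0 p (X : 'M[R]_(p, m)) : mL1 T (fun t => X *m P0 t).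
  by apply: mL1Ml; [exact: mbm_cst|exact: (mL2_mL1 P0_L2)].
by apply: mL1_block; (apply: mL1D; [exact: mL1_cst|]).
Qed.

Lemma mean_lq_a_L1 : mL1 T (lq_a mean_a mean_B mean_N Rw).
Proof.
apply: mL1B; first exact: mean_a_L1.
by apply: mL1Ml; [exact: mbm_cst|exact: (mL2_mL1 mean_N_L2)].
Qed.

Lemma mean_lq_q_L1 : mL1 T (lq_q mean_q mean_N Rw).
Proof.
apply: mL1B; first exact: mean_q_L1.
by apply: mL2M mean_N_L2; apply: mL2Mr; [exact/mL2_tr/mean_N_L2|exact: mbm_cst].
Qed.

Lemma S_psd p (X : 'M[R]_(p, m)) : psd (X *m invmx Rw *m X^T).
Proof. by have := psd_congr X^T (psd_invmx Rw_posdef); rewrite trmxK. Qed.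

Lemma dev_riccati_exists : exists K, terminal_ode T K (dev_ric K) H.
Proof.
apply: riccati_exists => //; [exact: mL1_cst|exact: mL1_cst|exact: S_psd|
  exact: H_psd|by move=> t _; exact: Q_psd].
Qed.

Lemma mean_riccati_exists : exists Pi, terminal_ode T Pi (mean_ric Pi) mean_h.
Proof.
apply: riccati_exists => //; [exact: mean_lq_a_L1|exact: mean_lq_q_L1|exact: S_psd|
  exact/psd_congr/H_psd|].
move=> t _; rewrite mean_q_complement; apply: psdD; apply: psd_congr.
  exact: Q_psd.
exact: R1_complement_psd.
Qed.

Lemma riccati_system_unique K Kb K0 Lam0 Lamb K' Kb' K0' Lam0' Lamb' :
  riccati_system c T P0 Pb K Kb K0 Lam0 Lamb ->
  riccati_system c T P0 Pb K' Kb' K0' Lam0' Lamb' -> forall t, t \in `[0, T] ->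
  [/\ K' t = K t, Kb' t = Kb t, K0' t = K0 t, Lam0' t = Lam0 t & Lamb' t = Lamb t].
Proof.
move=> /riccati_systemP[eK ePi] /riccati_systemP[eK' ePi'] t tT.
have EK := riccati_unique T_gt0 (mL1_cst T A) eK' eK tT.
have := riccati_unique T_gt0 mean_lq_a_L1 ePi' ePi tT.
by move=> /eq_block_mx[/eqP + -> -> ->]; rewrite EK (inj_eq (addrI _)) => /eqP ->.
Qed.

End SocialRiccati.

(** * Orthogonal decomposition of the social cost *)

Section Average.
Context (R : realType) (N : nat).
Hypothesis N_gt0 : (0 < N)%N.

Definition avg p (x : 'I_N -> 'cV[R]_p) : 'cV[R]_p := N%:R^-1 *: \sum_i x i.

Lemma avg_sum p (x : 'I_N -> 'cV[R]_p) : \sum_i x i = N%:R *: avg x.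
Proof. by rewrite /avg scalerA divff ?scale1r// pnatr_eq0 -lt0n. Qed.

Lemma avgD p (x y : 'I_N -> 'cV[R]_p) : avg (fun i => x i + y i) = avg x + avg y.
Proof. by rewrite /avg big_split scalerDr. Qed.

Lemma avgB p (x y : 'I_N -> 'cV[R]_p) : avg (fun i => x i - y i) = avg x - avg y.
Proof. by rewrite /avg sumrB scalerBr. Qed.

Lemma avg_cst p (y : 'cV[R]_p) : avg (fun=> y) = y.
Proof.
rewrite /avg sumr_const card_ord -[y *+ N]scaler_nat scalerA mulVf ?scale1r//.
by rewrite pnatr_eq0 -lt0n.
Qed.

Lemma avg_mul p q (A : 'M[R]_(p, q)) (x : 'I_N -> 'cV[R]_q) :
  avg (fun i => A *m x i) = A *m avg x.
Proof. by rewrite /avg -scalemxAr mulmx_sumr. Qed.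

Lemma sum_dev p (x : 'I_N -> 'cV[R]_p) : \sum_i (x i - avg x) = 0.
Proof.
by apply/eqP; rewrite sumrB subr_eq0 avg_sum sumr_const card_ord scaler_nat.
Qed.

Lemma sum_bil_dev p q (S : 'M[R]_(p, q)) (x : 'I_N -> 'cV[R]_p) (y : 'cV[R]_q) :
  \sum_i bil S (x i) y = N%:R * bil S (avg x) y.
Proof. by rewrite -bil_suml avg_sum bilZl. Qed.

(** Since the deviations from the average sum to zero, the cross terms cancel. *)
Lemma variance_split p (S : 'M[R]_p) (x : 'I_N -> 'cV[R]_p) (y : 'cV[R]_p) :
  S^T = S ->
  \sum_i wnorm S (x i - avg x + y) = \sum_i wnorm S (x i - avg x) + N%:R * wnorm S y.
Proof.
move=> Ss; have e i : wnorm S (x i - avg x + y) =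
    wnorm S (x i - avg x) + 2 * bil S (x i - avg x) y + wnorm S y.
  move: (x i - avg x) => e.
  by rewrite !wnormE bilDl !bilDr (bil_sym y _ Ss); ring.
rewrite (eq_bigr _ (fun i _ => e i)) !big_split /= -mulr_sumr -bil_suml sum_dev bil0l.
by rewrite mulr0 addr0 sumr_const card_ord mulr_natl.
Qed.

End Average.

Section MatrixProcesses.
Context (R : realType) d (Om : measurableType d) (T : R).
Local Notation joint := (joint T).

Definition mjoint p q (X : R -> Om -> 'M[R]_(p, q)) :=
  forall i j, joint (fun t w => X t w i j).

Lemma joint_sum (I : finType) (X : I -> R -> Om -> R) : (forall i, joint (X i)) ->
  joint (fun t w => \sum_i X i t w).
Proof. by move=> jX; apply: measurable_sum => i; exact: jX. Qed.

Lemma joint_ext (X Y : R -> Om -> R) : (forall t w, X t w = Y t w) -> joint Y -> joint X.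
Proof. exact: process_sub. Qed.

Lemma mjointM p q r (X : R -> Om -> 'M[R]_(p, q)) (Y : R -> Om -> 'M[R]_(q, r)) :
  mjoint X -> mjoint Y -> mjoint (fun t w => X t w *m Y t w).
Proof.
move=> jX jY i j; apply: (joint_ext (Y := fun t w => \sum_k X t w i k * Y t w k j)).
  by move=> t w; rewrite mxE.
by apply: joint_sum => k; exact: jointM.
Qed.

Lemma mjointD p q (X Y : R -> Om -> 'M[R]_(p, q)) :
  mjoint X -> mjoint Y -> mjoint (fun t w => X t w + Y t w).
Proof.
move=> jX jY i j; apply: (joint_ext (Y := fun t w => X t w i j + Y t w i j)).
  by move=> t w; rewrite mxE.
exact: jointD.
Qed.

Lemma mjointN p q (X : R -> Om -> 'M[R]_(p, q)) : mjoint X -> mjoint (fun t w => - X t w).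
Proof.
move=> jX i j; apply: (joint_ext (Y := fun t w => - X t w i j)).
  by move=> t w; rewrite mxE.
by apply: measurable_funN; exact: jX.
Qed.

Lemma mjoint_tr p q (X : R -> Om -> 'M[R]_(p, q)) : mjoint X -> mjoint (fun t w => (X t w)^T).
Proof.
move=> jX i j; apply: (joint_ext (Y := fun t w => X t w j i)) => // t w.
by rewrite mxE.
Qed.

Lemma mjoint_cst p q (A : 'M[R]_(p, q)) : mjoint (fun _ _ => A).
Proof. by move=> i j; exact: measurable_cst. Qed.

Lemma mjoint_time p q (g : R -> 'M[R]_(p, q)) : mL1 T g -> mjoint (fun t _ => g t).
Proof. by move=> Lg i j; apply: joint_time; exact: L1_meas (Lg i j). Qed.

Lemma mjoint_avg N p (X : 'I_N -> R -> Om -> 'cV[R]_p) : (forall i, mjoint (X i)) ->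
  mjoint (fun t w => avg (fun i => X i t w)).
Proof.
move=> jX i j; apply: (joint_ext (Y := fun t w => N%:R^-1 * \sum_l X l t w i j)).
  by move=> t w; rewrite /avg mxE summxE.
apply: jointM; first exact: (joint_time (g := cst _)).
by apply: joint_sum => l; exact: jX.
Qed.

Lemma joint_wnorm p (S : 'M[R]_p) (X : R -> Om -> 'cV[R]_p) : mjoint X ->
  joint (fun t w => wnorm S (X t w)).
Proof.
move=> jX.
exact: (mjointM (mjointM (mjoint_tr jX) (mjoint_cst S)) jX 0 0).
Qed.

Lemma joint_bil p q (S : 'M[R]_(p, q)) (X : R -> Om -> 'cV[R]_p) (Y : R -> Om -> 'cV[R]_q) :
  mjoint X -> mjoint Y -> joint (fun t w => bil S (X t w) (Y t w)).
Proof.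
move=> jX jY.
exact: (mjointM (mjointM (mjoint_tr jX) (mjoint_cst S)) jY 0 0).
Qed.

Local Notation mu := (@lebesgue_measure R).

Lemma measurable_path_integral (f : R -> Om -> R) : joint f -> (forall t w, 0 <= f t w) ->
  measurable_fun setT (fun w => \int[mu]_(t in `[0%R, T]) (f t w)%:E)%E.
Proof.
move=> jf f0.
by apply: (@measurable_integral_on2 _ _ (measurableTypeR R) Om R mu _ _
      (measurable_itv _) measurableT f).
Qed.

Lemma sum_iterated (P : probability Om R) (J : finType) (f : J -> R -> Om -> R) :
  (forall i, joint (f i)) -> (forall i t w, 0 <= f i t w) ->
  (\int[P]_w \int[mu]_(t in `[0%R, T]) (\sum_i f i t w)%:E =
   \sum_i \int[P]_w \int[mu]_(t in `[0%R, T]) (f i t w)%:E)%E.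
Proof.
move=> jf f0; rewrite -ge0_integral_sum//; last 2 first.
- by move=> i; apply: measurable_path_integral.
- by move=> i w _; apply: integral_ge0 => t _; rewrite lee_fin.
apply: eq_integral => w _; rewrite -ge0_integral_sum//.
- by apply: eq_integral => t _; rewrite sumEFin.
- move=> i; apply/measurable_EFinP.
  exact: (@measurable_section2 _ _ (measurableTypeR R) Om R
      `[0, T]%classic setT (measurable_itv _) measurableT (f i) (jf i) w I).
- by move=> i t _; rewrite lee_fin.
Qed.

Lemma measurable_processP p (X : R -> Om -> 'cV[R]_p) :
  measurable_process T X <-> mjoint X.
Proof.
split=> [mX i j|jX k]; last exact: jX.
by rewrite ord1; exact: mX.
Qed.

End MatrixProcesses.

Section SocialCost.
Context (R : realType) dOm (Om : measurableType dOm) (P : probability Om R).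
Context (n m d N : nat) (c : model R n m d) (T : R).
Hypotheses (T_gt0 : 0 < T) (N_gt0 : (0 < N)%N).
Variables P0 Pb : R -> 'M[R]_(m, n).
Hypotheses (hA2 : assumptionA2 c) (hA4 : assumptionA4 c).
Hypotheses (P0_L2 : mx_L2 T P0) (Pb_L2 : mx_L2 T Pb).
Local Notation mu := (@lebesgue_measure R).
Local Notation joint := (joint T).
Local Notation mjoint := (mjoint T).
Local Notation mean_q := (mean_q c P0 Pb).
Local Notation mean_N := (mean_N c P0 Pb).
Local Notation mean_gain := (mean_gain P0 Pb).

Definition dev (x : 'I_N -> R -> Om -> 'cV[R]_n) i t w := x i t w - average x t w.
Definition mean (x0 : R -> Om -> 'cV[R]_n) (x : 'I_N -> R -> Om -> 'cV[R]_n) t w :=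
  col_mx (average x t w) (x0 t w).
Definition ctrl_avg (u : 'I_N -> R -> Om -> 'cV[R]_m) t w := avg (fun i => u i t w).
Definition ctrl_dev (u : 'I_N -> R -> Om -> 'cV[R]_m) i t w := u i t w - ctrl_avg u t w.

Definition agent_run (u : 'I_N -> R -> Om -> 'cV[R]_m) x0 x i t w : R :=
  let u0 := leader_control P0 Pb x0 x in
  wnorm (mQ c) (x i t w - mGam c *m average x t w - mGam1 c *m x0 t w)
       + wnorm (mR c) (u i t w)
       + 2 * ((u i t w)^T *m mL c *m u0 t w) 0 0
       + wnorm (mR1 c) (u0 t w).

Definition agent_end (x0 : R -> Om -> 'cV[R]_n) (x : 'I_N -> R -> Om -> 'cV[R]_n) i w : R :=
  wnorm (mH c) (x i T w - mGamb c *m average x T w - mGamb1 c *m x0 T w).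

Definition path_cost u x0 x w : \bar R :=
  (\int[mu]_(t in `[0%R, T]) (\sum_i agent_run u x0 x i t w)%:E
   + (\sum_i agent_end x0 x i w)%:E)%E.

Lemma leader_controlE x0 x t w :
  leader_control P0 Pb x0 x t w = mean_gain t *m mean x0 x t w.
Proof. by rewrite /leader_control /mean_gain mul_row_col addrC. Qed.

Lemma agent_run_ge0 u x0 x i t w : 0 <= agent_run u x0 x i t w.
Proof.
have := coupled_weight_ge0 hA4 (u i t w) (leader_control P0 Pb x0 x t w).
have := (Q_psd hA2).2 (x i t w - mGam c *m average x t w - mGam1 c *m x0 t w).
rewrite /agent_run /bil; lra.
Qed.

Lemma agent_end_ge0 x0 x i w : 0 <= agent_end x0 x i w.
Proof. exact: (H_psd hA2).2. Qed.

(** The tracking error is the deviation plus a term common to all followers. *)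
Lemma tracking_split (S X Y : 'M[R]_n) (y : 'cV[R]_n) (x : 'I_N -> 'cV[R]_n) :
  S^T = S ->
  \sum_i wnorm S (x i - X *m avg x - Y *m y) = \sum_i wnorm S (x i - avg x)
  + N%:R * wnorm S (row_mx (1%:M - X) (- Y) *m col_mx (avg x) y).
Proof.
move=> Ss; rewrite -variance_split//; apply: eq_bigr => i _; congr wnorm.
rewrite mul_row_col mulmxBl mul1mx mulNmx !addrA subrK; congr (_ - _).
Qed.

(** States and controls both split orthogonally; as the control of the leader is common to
    all followers, it is coupled with the average of their controls only. *)
Lemma run_split u x0 x t w : \sum_i agent_run u x0 x i t w =
  \sum_i lq_run (fun=> mQ c) (fun=> 0) (mR c) t (dev x i t w) (ctrl_dev u i t w)
  + N%:R * lq_run mean_q mean_N (mR c) t (mean x0 x t w) (ctrl_avg u t w).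
Proof.
have [pR1 _] := hA4.
rewrite /agent_run leader_controlE; set z := mean x0 x t w.
rewrite !big_split /= tracking_split ?(Q_psd hA2).1//.
have -> : \sum_i wnorm (mR c) (u i t w) = \sum_i wnorm (mR c) (ctrl_dev u i t w)
    + N%:R * wnorm (mR c) (ctrl_avg u t w).
  rewrite -variance_split ?(Rw_posdef hA2).1//; apply: eq_bigr => i _.
  by rewrite /ctrl_avg subrK.
rewrite -mulr_sumr (sum_bil_dev N_gt0 (mL c) (fun i => u i t w)).
rewrite sumr_const card_ord -/(mean x0 x t w) -/z.
rewrite [X in _ = _ + X + _]big1; last first.
  by move=> i _; rewrite /bil mulmx0 mul0mx mxE mulr0.
rewrite /lq_run /mean_q /mean_N !wnormE bilDM !(bil_mull, bil_mulr) ?mulmxA.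
rewrite -/(mean_C c) -[_ *+ N]mulr_natl -/(ctrl_avg u t w).
set s := \sum_i wnorm (mQ c) _.
have -> : s = \sum_(i < N) wnorm (mQ c) (dev x i t w) by [].
by ring.
Qed.

Lemma end_split x0 x w : \sum_i agent_end x0 x i w =
  \sum_i wnorm (mH c) (dev x i T w) + N%:R * wnorm (mean_h c) (mean x0 x T w).
Proof.
rewrite /agent_end tracking_split ?(H_psd hA2).1//.
congr (_ + _ * _); rewrite -/(mean x0 x T w) -/(mean_Cb c) /mean_h.
by rewrite !wnormE !(bil_mull, bil_mulr) ?mulmxA.
Qed.

Section Admissible.
Variables (u : 'I_N -> R -> Om -> 'cV[R]_m) (x0 : R -> Om -> 'cV[R]_n)
  (x : 'I_N -> R -> Om -> 'cV[R]_n).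
Hypotheses (u_joint : forall i, mjoint (u i)) (x0_joint : mjoint x0)
  (x_joint : forall i, mjoint (x i)).

Lemma leader_control_joint : mjoint (leader_control P0 Pb x0 x).
Proof.
apply: mjointD; apply: mjointM => //; try exact: mjoint_avg.
  by apply: mjoint_time; exact: (mL2_mL1 P0_L2).
by apply: mjoint_time; exact: (mL2_mL1 Pb_L2).
Qed.

Lemma tracking_joint (X Y : 'M[R]_n) i :
  mjoint (fun t w => x i t w - X *m average x t w - Y *m x0 t w).
Proof.
apply: mjointD; last by apply: mjointN; apply: mjointM => //; exact: mjoint_cst.
apply: mjointD => //; apply: mjointN; apply: mjointM; first exact: mjoint_cst.
exact: mjoint_avg.
Qed.

Lemma agent_run_joint i : joint (agent_run u x0 x i).
Proof.
apply: jointD; last by apply: joint_wnorm; exact: leader_control_joint.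
apply: jointD.
  by apply: jointD; apply: joint_wnorm => //; exact: tracking_joint.
apply: jointM; first exact: (joint_time (g := cst 2)).
by apply: joint_bil => //; exact: leader_control_joint.
Qed.

Lemma agent_end_measurable i : measurable_fun setT (agent_end x0 x i).
Proof.
have j := joint_wnorm (mH c) (tracking_joint (mGamb c) (mGamb1 c) i).
exact: (joint_section j (inTT T_gt0)).
Qed.

Lemma path_cost_ge0 w : (0 <= path_cost u x0 x w)%E.
Proof.
apply: adde_ge0.
  by apply: integral_ge0 => t _; rewrite lee_fin; apply: sumr_ge0 => i _;
    exact: agent_run_ge0.
by rewrite lee_fin; apply: sumr_ge0 => i _; exact: agent_end_ge0.
Qed.

Lemma measurable_path_cost : measurable_fun setT (path_cost u x0 x).
Proof.
apply: emeasurable_funD.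
  apply: measurable_path_integral.
    by apply: joint_sum => i; exact: agent_run_joint.
  by move=> t w; apply: sumr_ge0 => i _; exact: agent_run_ge0.
apply/measurable_EFinP; apply: measurable_sum => i; exact: agent_end_measurable.
Qed.

Lemma Jsoc_path_cost : Jsoc P c T P0 Pb u x0 x = (\int[P]_w path_cost u x0 x w)%E.
Proof.
have me i : measurable_fun setT (fun w => (agent_end x0 x i w)%:E).
  by apply/measurable_EFinP; exact: agent_end_measurable.
rewrite /path_cost ge0_integralD//=; last 4 first.
- move=> w _; apply: integral_ge0 => t _; rewrite lee_fin.
  by apply: sumr_ge0 => i _; exact: agent_run_ge0.
- apply: measurable_path_integral.
    by apply: joint_sum => i; exact: agent_run_joint.
  by move=> t w; apply: sumr_ge0 => i _; exact: agent_run_ge0.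
- by move=> w _; rewrite lee_fin; apply: sumr_ge0 => i _; exact: agent_end_ge0.
- by apply/measurable_EFinP; apply: measurable_sum => i; exact: agent_end_measurable.
congr (_ + _)%E.
- apply/esym; apply: sum_iterated; first exact: agent_run_joint.
  by move=> i t w; exact: agent_run_ge0.
- transitivity (\int[P]_w \sum_i (agent_end x0 x i w)%:E)%E.
    rewrite ge0_integral_sum// => i w _; rewrite lee_fin; exact: agent_end_ge0.
  by apply: eq_integral => w _; rewrite sumEFin.
Qed.

Definition split_cost w : R :=
  \sum_i lq_cost T (fun=> mQ c) (fun=> 0) (mR c) (mH c) (dev x i ^~ w) (ctrl_dev u i ^~ w)
  + N%:R * lq_cost T mean_q mean_N (mR c) (mean_h c) (mean x0 x ^~ w) (ctrl_avg u ^~ w).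

Lemma path_costE w : (forall i, mbm T (dev x i ^~ w)) -> mbm T (mean x0 x ^~ w) ->
  (forall i, mL2 T (ctrl_dev u i ^~ w)) -> mL2 T (ctrl_avg u ^~ w) ->
  path_cost u x0 x w = (split_cost w)%:E.
Proof.
move=> bdev bmean Ldev Lavg.
have L1dev i : L1 T (fun t => lq_run (fun=> mQ c) (fun=> 0) (mR c) t (dev x i t w)
    (ctrl_dev u i t w)).
  apply: lq_run_L1 => //; first exact: mL1_cst.
  by apply: mbm_mL2; exact: mbm_cst.
have L1mean : L1 T (fun t => lq_run mean_q mean_N (mR c) t (mean x0 x t w)
    (ctrl_avg u t w)).
  by apply: lq_run_L1 => //; [exact: mean_q_L1|exact: mean_N_L2].
have L1sum := L1_sum L1dev.
have L1N := L1Zl N%:R L1mean.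
rewrite /path_cost; under eq_integral do rewrite run_split.
rewrite -[integral _ _ _]fineK; last first.
  by apply: integrable_fin_num => //; exact: (L1D L1sum L1N).
rewrite -/(Rintegral mu `[0, T] (fun t => \sum_i lq_run (fun=> mQ c) (fun=> 0) (mR c) t
   (dev x i t w) (ctrl_dev u i t w) + N%:R * lq_run mean_q mean_N (mR c) t
   (mean x0 x t w) (ctrl_avg u t w))).
rewrite RintegralD// RintegralZl// -EFinD end_split /split_cost /lq_cost; congr EFin.
rewrite big_split /= mulrDr.
suff -> : \int[mu]_(t in `[0, T]) (\sum_i lq_run (fun=> mQ c) (fun=> 0) (mR c) t
    (dev x i t w) (ctrl_dev u i t w)) = \sum_i \int[mu]_(t in `[0, T])
    lq_run (fun=> mQ c) (fun=> 0) (mR c) t (dev x i t w) (ctrl_dev u i t w) by ring.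
have := @ac_sum _ T T_gt0 _ _ _ (fun i => ac_int 0 (L1dev i)) => -[_ /(_ T (inTT T_gt0))].
rewrite [X in _ = X + _]big1 ?add0r; last by move=> i _; rewrite Rint00 addr0.
by under eq_bigr do rewrite add0r.
Qed.

End Admissible.
End SocialCost.

(** * Equations of the deviations and of the mean *)

Section MatrixEquations.
Context (R : realType) (T : R).
Hypothesis T_gt0 : 0 < T.

Lemma mac_sum (I : finType) p q (F f : I -> R -> 'M[R]_(p, q)) :
  (forall i, mac T (F i) (f i)) -> mac T (fun t => \sum_i F i t) (fun t => \sum_i f i t).
Proof.
move=> aF k l; apply: (ac_eq T_gt0 _ _ (ac_sum T_gt0 (fun i => aF i k l))) => t _;
  by rewrite summxE.
Qed.

Lemma mac_avg N p (F f : 'I_N -> R -> 'cV[R]_p) : (forall i, mac T (F i) (f i)) ->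
  mac T (fun t => avg (fun i => F i t)) (fun t => avg (fun i => f i t)).
Proof.
move=> aF k l; have := acZ N%:R^-1 (mac_sum aF k l).
by apply: (ac_eq T_gt0) => t _; rewrite /avg !mxE.
Qed.

Lemma mac_col p1 p2 q (F f : R -> 'M[R]_(p1, q)) (G g : R -> 'M[R]_(p2, q)) :
  mac T F f -> mac T G g ->
  mac T (fun t => col_mx (F t) (G t)) (fun t => col_mx (f t) (g t)).
Proof.
move=> aF aG i j; case: (split_ordP i) => k ->.
  by apply: (ac_eq T_gt0 _ _ (aF k j)) => t _; rewrite col_mxEu.
by apply: (ac_eq T_gt0 _ _ (aG k j)) => t _; rewrite col_mxEd.
Qed.

End MatrixEquations.

Section CenteredVariables.
Context (R : realType) d (Om : measurableType d) (P : probability Om R).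

Definition centered (f : Om -> R) :=
  P.-integrable setT (EFin \o f) /\ \int[P]_w f w = 0.

Lemma centeredD f g : centered f -> centered g -> centered (fun w => f w + g w).
Proof.
move=> [jf f0] [jg g0]; split; first exact: (integrableD measurableT jf jg).
by rewrite RintegralD// f0 g0 addr0.
Qed.

Lemma centeredZ a f : centered f -> centered (fun w => a * f w).
Proof.
move=> [jf f0]; split; first exact: (integrableZl measurableT a jf).
by rewrite RintegralZl// f0 mulr0.
Qed.

Lemma centered_sum (I : finType) (f : I -> Om -> R) : (forall i, centered (f i)) ->
  centered (fun w => \sum_i f i w).
Proof.
apply: (bigop_closed (Q := centered)); last exact: centeredD.
by split; [exact: integrable0|rewrite Rintegral_cst// mul0r].
Qed.

(** The costs may be infinite: [f] is moved to the other side only when the cost [Y] has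
    finite mean. *)
Lemma compare_expectation (X Y : Om -> \bar R) (f : Om -> R) :
  measurable_fun setT X -> (forall w, 0 <= X w)%E ->
  measurable_fun setT Y -> (forall w, 0 <= Y w)%E -> centered f ->
  {ae P, forall w, (X w + (f w)%:E <= Y w)%E} ->
  (\int[P]_w X w <= \int[P]_w Y w)%E.
Proof.
move=> mX X0 mY Y0 [jf f0] le.
have [->|fin] := eqVneq (\int[P]_w Y w)%E +oo%E; first exact: leey.
have iY : P.-integrable setT Y.
  apply/integrableP; split=> //.
  by under eq_integral do rewrite gee0_abs//; rewrite ltey.
pose Z w := (Y w - (f w)%:E)%E.
have iZ : P.-integrable setT Z by exact: integrableB.
have mZ := measurable_int _ iZ.
have XZ : {ae P, forall w, (X w <= Z w)%E}.
  by apply: ae_sub le => w; rewrite leeBrDr.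
apply: (@le_trans _ _ (\int[P]_w `|Z w|)%E).
  apply: ae_ge0_le_integral => //; first exact: measurableT_comp.
  by apply: ae_sub XZ => w h _; apply: (le_trans h); exact: lee_abs.
rewrite (ae_eq_integral Z)//; last 2 first.
- exact: measurableT_comp.
- by apply: ae_sub XZ => w h _; rewrite gee0_abs// (le_trans (X0 w)).
rewrite integralB//.
have -> : (\int[P]_w (f w)%:E = 0)%E.
  rewrite -[LHS]fineK; last exact: (integrable_fin_num measurableT jf).
  by rewrite -/(Rintegral P setT f) f0.
by rewrite sube0.
Qed.

End CenteredVariables.

Section Social.
Context (R : realType) dOm (Om : measurableType dOm) (P : probability Om R).
Context (n m d N : nat) (c : model R n m d) (T : R).
Variables (xi : option 'I_N -> Om -> 'cV[R]_n) (W : option 'I_N -> R -> Om -> 'cV[R]_d).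
Variables (xibar : 'cV[R]_n) (c0 : R) (P0 Pb : R -> 'M[R]_(m, n)).
Hypotheses (T_gt0 : 0 < T) (N_gt0 : (0 < N)%N).
Hypothesis W_bm : forall a, brownian_motion P T (W a).
Hypothesis hA1 : assumptionA1 P T xi W xibar c0.
Hypotheses (hA2 : assumptionA2 c) (hA4 : assumptionA4 c).
Hypotheses (P0_L2 : mx_L2 T P0) (Pb_L2 : mx_L2 T Pb).
Local Notation mu := (@lebesgue_measure R).
Local Notation joint := (joint T).
Local Notation mjoint := (mjoint T).
Local Notation mean_q := (mean_q c P0 Pb).
Local Notation mean_N := (mean_N c P0 Pb).
Local Notation mean_a := (mean_a c P0 Pb).
Local Notation past := (history xi W).
Local Notation ctrl := (ctrl P T past).
Local Notation noise := (noise P T past).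
Local Notation vgood := (vgood P T past).

Let xi_meas a : random_vector (xi a). Proof. by case: hA1 => -[]. Qed.
Let past_mono := @history_mono R dOm Om n d N xi W.
Let past_meas := history_meas W_bm xi_meas.

Let W_noise a : noise (W a).
Proof. by apply: brownian_noise => //; case: hA1. Qed.

Let W0 a w : W a 0 w = 0. Proof. exact: (bm_start (W_bm a)). Qed.

Definition noise_avg t w := avg (fun i => W (Some i) t w).
Definition noise_dev i t w := mD c *m (W (Some i) t w - noise_avg t w).
Definition noise_mean t w := col_mx (mD c *m noise_avg t w) (mD0 c *m W None t w).

Lemma noise_avg_noise : noise noise_avg.
Proof.
have -> : noise_avg = fun t w => N%:R^-1%:M *m \sum_i W (Some i) t w.
  by apply/funext => t; apply/funext => w; rewrite mul_scalar_mx.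
apply: (noise_mul T_gt0 past_mono past_meas).
exact: (noise_sum T_gt0 past_mono past_meas).
Qed.

Lemma noise_dev_noise i : noise (noise_dev i).
Proof.
apply: (noise_mul T_gt0 past_mono past_meas).
apply: (noiseB T_gt0 past_mono past_meas) => //; exact: noise_avg_noise.
Qed.

Lemma noise_mean_noise : noise noise_mean.
Proof.
apply: noise_col; apply: (noise_mul T_gt0 past_mono past_meas) => //.
exact: noise_avg_noise.
Qed.

Lemma noise_avg0 w : noise_avg 0 w = 0.
Proof. by rewrite /noise_avg /avg big1 ?scaler0. Qed.

Lemma noise_dev0 i w : noise_dev i 0 w = 0.
Proof. by rewrite /noise_dev noise_avg0 W0 subrr mulmx0. Qed.

Lemma noise_mean0 w : noise_mean 0 w = 0.
Proof. by rewrite /noise_mean noise_avg0 W0 !mulmx0 col_mx0. Qed.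

Definition init_avg w := avg (fun i => xi (Some i) w).
Definition init_dev i w := xi (Some i) w - init_avg w.
Definition init_mean w := col_mx (init_avg w) (xi None w).

Lemma sqnormE p (z : 'cV[R]_p) : sqnorm z = \sum_k z k 0 ^+ 2.
Proof.
rewrite /sqnorm /wnorm mulmx1 mxE; apply: eq_bigr => k _.
by rewrite mxE expr2.
Qed.

Lemma init_good a : vgood (fun=> xi a).
Proof.
have sq : (\int[P]_w (sqnorm (xi a w))%:E < +oo)%E.
  case: hA1 => -[_ _ _ h0 h] _; case: a => [i|].
    by have := h i; rewrite unlock => /le_lt_trans; apply; exact: ltry.
  by move: h0; rewrite unlock.
move=> k; apply: (good_cst _ past_mono); first exact: gm_init.
apply: le_lt_trans sq; apply: ge0_le_integral => //.
- by move=> w _; rewrite lee_fin sqr_ge0.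
- by apply/measurable_EFinP/measurable_funX; exact: xi_meas.
- apply/measurable_EFinP; rewrite (_ : (fun _ => _) = fun w => \sum_k xi a w k 0 ^+ 2).
    by apply: measurable_sum => l; apply/measurable_funX; exact: xi_meas.
  by apply/funext => w; rewrite sqnormE.
- move=> w _; rewrite lee_fin sqnormE (bigD1 k)//= lerDl.
  by apply: sumr_ge0 => l _; exact: sqr_ge0.
Qed.

Lemma init_avg_good : vgood (fun=> init_avg).
Proof.
have -> : init_avg = fun w => N%:R^-1%:M *m \sum_i xi (Some i) w.
  by apply/funext => w; rewrite mul_scalar_mx.
apply: (vgood_mul T_gt0 past_mono past_meas).
by apply: (vgood_sum past_mono past_meas) => i; exact: init_good.
Qed.

Lemma init_dev_good i : vgood (fun=> init_dev i).
Proof.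
apply: (vgoodB T_gt0 past_mono past_meas); [exact: init_good|exact: init_avg_good].
Qed.

Lemma init_mean_good : vgood (fun=> init_mean).
Proof. by apply: vgood_col; [exact: init_avg_good|exact: init_good]. Qed.

Lemma ctrl_energy p (U : R -> Om -> 'cV[R]_p) : mjoint U ->
  (\int[P]_w \int[mu]_(t in `[0%R, T]) (sqnorm (U t w))%:E =
   \sum_k energy P T (fun t w => U t w k 0)%R)%E.
Proof.
move=> jU; rewrite -(@sum_iterated _ _ _ _ P _ (fun k t w => U t w k 0 ^+ 2)).
- by apply: eq_integral => w _; apply: eq_integral => t _; rewrite sqnormE.
- by move=> k; apply: measurable_funX; exact: jU.
- by move=> k t w; exact: sqr_ge0.
Qed.

Lemma Uc_ctrl (u : 'I_N -> R -> Om -> 'cV[R]_m) : Uc P T xi W u <-> forall i, ctrl (u i).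
Proof.
split=> h i.
- have [/measurable_processP ju au eu] := h i.
  move=> k; split; first exact: ju.
  + apply: le_lt_trans eu; rewrite ctrl_energy//.
    rewrite (bigD1 k)//= leeDl//; apply: sume_ge0 => l _; exact: energy_ge0.
  + by move=> s sT; apply: gm_component; exact: au.
- have ju : mjoint (u i).
    by move=> k l; rewrite ord1; case: (h i k).
  split.
  + exact/measurable_processP.
  + move=> t tT E /vec_eventsP[k [B [mB ->]]].
    have [_ _ au] := h i k.
    by have := au t tT measurableT B mB; rewrite setTI.
  + rewrite ctrl_energy//; apply: lte_sum_pinfty => k _; by case: (h i k).
Qed.

Lemma ctrl_joint p (U : R -> Om -> 'cV[R]_p) : ctrl U -> mjoint U.
Proof. by move=> cU k l; rewrite ord1; case: (cU k). Qed.

Lemma ctrl_path_L2 p (U : R -> Om -> 'cV[R]_p) : ctrl U ->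
  {ae P, forall w, mL2 T (U ^~ w)}.
Proof.
move=> cU; have : {ae P, forall w, forall k, L2 T (fun t => U t w k 0)}.
  by apply: ae_all_fin => k; have [jU eU _] := cU k; exact: ae_path_L2.
by apply: ae_sub => w h k l; rewrite ord1; exact: h.
Qed.

Lemma solves_sde_mac X0 b (D : 'M[R]_(n, d)) a X :
  solves_sde P T X0 b D (W a) X -> mjoint X /\
  {ae P, forall w, X 0 w = X0 w /\ mac T (fun t => X t w - D *m W a t w) (b ^~ w)}.
Proof.
move=> [/measurable_processP jX eX]; split=> //; apply: ae_sub eX => w [bL bX]; split.
  rewrite bX ?in0T// W0 mulmx0 addr0; apply/matrixP => i j.
  by rewrite !mxE Rint00 addr0.
apply: (mac_eq T_gt0 _ _ (mac_int T_gt0 (X0 w) bL)) => // t tT.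
by rewrite bX// addrK.
Qed.

Lemma mac_solves_sde X0 b (D : 'M[R]_(n, d)) a X : mjoint X ->
  (forall w, X 0 w = X0 w) ->
  (forall w, mac T (fun t => X t w - D *m W a t w) (b ^~ w)) ->
  solves_sde P T X0 b D (W a) X.
Proof.
move=> jX X00 aX; split; first exact/measurable_processP.
apply: aeW => w; split; first exact: (mac_mL1 (aX w)).
move=> t tT; have := mac0 (aX w) tT.
by rewrite W0 mulmx0 subr0 X00 => /eqP; rewrite subr_eq => /eqP.
Qed.

Lemma mean_drift (x0 : R -> Om -> 'cV[R]_n) (x : 'I_N -> R -> Om -> 'cV[R]_n) (v : 'cV[R]_m) t w :
  let u0 := leader_control P0 Pb x0 x t w in
  mean_a t *m mean x0 x t w + mean_B c *m v = col_mx
    (mA c *m average x t w + mB c *m v + mG c *m average x t w + mF c *m x0 t w + mB1 c *m u0)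
    (mA0 c *m x0 t w + mB0 c *m u0 + mG0 c *m average x t w).
Proof.
rewrite /= /mean_a /mean /mean_B /leader_control mul_block_col mul_col_mx mul0mx add_col_mx.
by rewrite addr0; congr col_mx; mxabel.
Qed.

(** The coupling terms are the same for all followers, so that they cancel in the
    equations of the deviations and reappear in that of the average. *)
Lemma state_paths u x0 x : state P c T xi W P0 Pb u x0 x ->
  {ae P, forall w, (forall i, dev x i 0 w = init_dev i w /\
      mac T (fun t => dev x i t w - noise_dev i t w)
        (fun t => mA c *m dev x i t w + mB c *m ctrl_dev u i t w)) /\
    (mean x0 x 0 w = init_mean w /\
      mac T (fun t => mean x0 x t w - noise_mean t w)
        (fun t => mean_a t *m mean x0 x t w + mean_B c *m ctrl_avg u t w))}.
Proof.
move=> [/solves_sde_mac[_ h0] hx].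
have {}hx := ae_all_fin (fun i => (solves_sde_mac (hx i)).2).
apply: ae_sub2 h0 hx => w [x00 a0] hx.
have xb0 : average x 0 w = init_avg w.
  by congr (_ *: _); apply: eq_bigr => i _; case: (hx i).
have ab : mac T (fun t => average x t w - mD c *m noise_avg t w)
    (fun t => mA c *m average x t w + mB c *m ctrl_avg u t w + mG c *m average x t w
       + mF c *m x0 t w + mB1 c *m leader_control P0 Pb x0 x t w).
  apply: (mac_eq T_gt0 _ _ (mac_avg T_gt0 (fun i => (hx i).2))) => t _.
    by rewrite avgB avg_mul.
  by rewrite !avgD !avg_mul !avg_cst.
split=> [i|].
- have [xi0 ai] := hx i; split; first by rewrite /dev xi0 xb0.
  apply: (mac_eq T_gt0 _ _ (macB T_gt0 ai ab)) => t _.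
    by rewrite /dev /noise_dev; mxabel.
  by rewrite /dev /ctrl_dev; mxabel.
- split; first by rewrite /mean xb0 x00.
  apply: (mac_eq T_gt0 _ _ (mac_col T_gt0 ab a0)) => t _.
    by rewrite /mean /noise_mean opp_col_mx add_col_mx.
  by rewrite mean_drift.
Qed.

(** * Optimality of the feedback *)

Section Feedback.
Variables K Kb K0 Lam0 Lamb : R -> 'M[R]_n.
Hypothesis riccati : riccati_system c T P0 Pb K Kb K0 Lam0 Lamb.

Let Pi t := block_mx (K t + Kb t) (K0 t) (Lamb t) (Lam0 t).

Let Rs : (mR c)^T = mR c. Proof. exact: (Rw_posdef hA2).1. Qed.
Let Ru : mR c \in unitmx. Proof. exact: posdef_unit (Rw_posdef hA2). Qed.

Let K_ric : terminal_ode T K (ric (lq_a (fun=> mA c) (mB c) (fun=> 0) (mR c))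
  (lq_q (fun=> mQ c) (fun=> 0) (mR c)) (lq_S (mB c) (mR c)) K) (mH c).
Proof.
have /=[eK _] := (riccati_systemP T_gt0 P0 Pb hA2 K Kb K0 Lam0 Lamb).1 riccati.
apply: (terminal_ode_eq T_gt0 _ _ _ eK) => // t _.
by rewrite /dev_ric /ric /lq_a /lq_q !mulmx0 !subr0.
Qed.

Let Pi_ric : terminal_ode T Pi (mean_ric c P0 Pb Pi) (mean_h c).
Proof. by have /=[_] := (riccati_systemP T_gt0 P0 Pb hA2 K Kb K0 Lam0 Lamb).1 riccati. Qed.

Local Notation dev_gain := (lq_gain (mB c) (fun=> 0) (mR c) K).
Local Notation mean_fb := (lq_gain (mean_B c) mean_N (mR c) Pi).

(** The feedback is the sum of those of the two linear-quadratic problems, which is why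
    averaging and subtracting recover each of them. *)
Lemma feedback_split (x0 : R -> Om -> 'cV[R]_n) (x : 'I_N -> R -> Om -> 'cV[R]_n) i t w :
  feedback_control c P0 Pb K Kb K0 x0 x i t w =
  - (dev_gain t *m dev x i t w) - mean_fb t *m mean x0 x t w.
Proof.
rewrite /feedback_control /lq_gain /mean_B tr_col_mx trmx0 /Pi mul_row_block !mul0mx !addr0.
rewrite -[invmx _ *m (_ + _) *m _]mulmxA [(_ + _) *m mean _ _ _ _]mulmxDl.
rewrite {1}/mean mul_row_col /mean_N -[mL c *m _ *m _]mulmxA -leader_controlE /dev.
by mxabel.
Qed.

Section Optimality.
Variables (u : 'I_N -> R -> Om -> 'cV[R]_m) (x0 : R -> Om -> 'cV[R]_n)
  (x : 'I_N -> R -> Om -> 'cV[R]_n).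
Hypotheses (u_Uc : Uc P T xi W u) (u_state : state P c T xi W P0 Pb u x0 x).
Hypothesis u_fb : forall i t w, t \in `[0, T] ->
  u i t w = feedback_control c P0 Pb K Kb K0 x0 x i t w.

Let ctrl_avg_fb w t : t \in `[0, T] ->
  ctrl_avg u t w = - (mean_fb t *m mean x0 x t w).
Proof.
move=> tT; rewrite /ctrl_avg.
have -> : (fun i => u i t w) = fun i =>
    (- dev_gain t) *m dev x i t w - mean_fb t *m mean x0 x t w.
  by apply/funext => i; rewrite u_fb// feedback_split mulNmx.
rewrite avgB avg_mul avg_cst// (_ : avg _ = 0) ?mulmx0 ?sub0r//.
by rewrite /avg (sum_dev N_gt0 (fun i => x i t w)) scaler0.
Qed.

Let ctrl_dev_fb i w t : t \in `[0, T] ->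
  ctrl_dev u i t w = - (dev_gain t *m dev x i t w).
Proof.
by move=> tT; rewrite /ctrl_dev ctrl_avg_fb// u_fb// feedback_split opprK subrK.
Qed.

Lemma ctrl_avg_ctrl (v : 'I_N -> R -> Om -> 'cV[R]_m) : (forall i, ctrl (v i)) ->
  ctrl (ctrl_avg v).
Proof.
by move=> cv; apply: ctrlZ => //; apply: ctrl_sum.
Qed.

Lemma ctrl_dev_ctrl (v : 'I_N -> R -> Om -> 'cV[R]_m) i : (forall i, ctrl (v i)) ->
  ctrl (ctrl_dev v i).
Proof.
by move=> cv; apply: ctrlB => //; exact: ctrl_avg_ctrl.
Qed.

Lemma state_joint (v : 'I_N -> R -> Om -> 'cV[R]_m) y0 y :
  state P c T xi W P0 Pb v y0 y -> mjoint y0 /\ forall i, mjoint (y i).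
Proof.
by move=> [/solves_sde_mac[j0 _] hy]; split=> // i; have [] := solves_sde_mac (hy i).
Qed.

Lemma dev_joint (y : 'I_N -> R -> Om -> 'cV[R]_n) i : (forall i, mjoint (y i)) ->
  mjoint (dev y i).
Proof. by move=> jy; apply: mjointD => //; apply: mjointN; exact: mjoint_avg. Qed.

Lemma mean_joint y0 (y : 'I_N -> R -> Om -> 'cV[R]_n) : mjoint y0 ->
  (forall i, mjoint (y i)) -> mjoint (mean y0 y).
Proof.
move=> j0 jy k l; case: (split_ordP k) => j ->.
  apply: (joint_ext (Y := fun t w => average y t w j l)) => [t w|].
    by rewrite /mean col_mxEu.
  exact: (mjoint_avg jy j l).
apply: (joint_ext (Y := fun t w => y0 t w j l)) => [t w|]; last exact: j0.
by rewrite /mean col_mxEd.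
Qed.

Lemma noise_path p (M : R -> Om -> 'cV[R]_p) w : noise M -> mbm T (M ^~ w).
Proof. by move=> [gM _] k l; rewrite ord1; have := good_bmeas T_gt0 w (gM k). Qed.

Lemma path_cost_split (v : 'I_N -> R -> Om -> 'cV[R]_m) y0 y : Uc P T xi W v ->
  state P c T xi W P0 Pb v y0 y ->
  {ae P, forall w, path_cost c T P0 Pb v y0 y w = (split_cost c T P0 Pb v y0 y w)%:E}.
Proof.
move=> /Uc_ctrl cv sv.
have Lavg := ctrl_path_L2 (ctrl_avg_ctrl cv).
have Ldev := ae_all_fin (fun i => ctrl_path_L2 (ctrl_dev_ctrl i cv)).
have := state_paths sv; move: Lavg Ldev.
apply: ae_sub3 => w Lavg Ldev [hdev [_ hmean]].
apply: path_costE => //.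
- move=> i; have [_ ai] := hdev i.
  exact: (mbm_of_mac_noise T_gt0 (noise_path w (noise_dev_noise i)) ai).
- exact: (mbm_of_mac_noise T_gt0 (noise_path w noise_mean_noise) hmean).
Qed.

(** Comparison of each deviation and of the mean pair with the competitor, with the same
    noise; the sum of the first-order terms is centered. *)
Theorem feedback_optimal v y0 y : Uc P T xi W v -> state P c T xi W P0 Pb v y0 y ->
  (Jsoc P c T P0 Pb u x0 x <= Jsoc P c T P0 Pb v y0 y)%E.
Proof.
move=> v_Uc v_state.
have cu := (Uc_ctrl u).1 u_Uc; have cv := (Uc_ctrl v).1 v_Uc.
have [jx0 jx] := state_joint u_state; have [jy0 jy] := state_joint v_state.
have ju i := ctrl_joint (cu i); have jv i := ctrl_joint (cv i).
have pu := state_paths u_state; have pv := state_paths v_state.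
have edev i : {ae P, forall w, [/\ dev x i 0 w = dev y i 0 w,
    mac T (fun t => dev x i t w - noise_dev i t w)
      (fun t => mA c *m dev x i t w + mB c *m ctrl_dev u i t w) &
    mac T (fun t => dev y i t w - noise_dev i t w)
      (fun t => mA c *m dev y i t w + mB c *m ctrl_dev v i t w)]}.
  apply: ae_sub2 pu pv => w [/(_ i) [u0 au] _] [/(_ i) [v0 av] _].
  by split=> //; rewrite u0 v0.
have emean : {ae P, forall w, [/\ mean x0 x 0 w = mean y0 y 0 w,
    mac T (fun t => mean x0 x t w - noise_mean t w)
      (fun t => mean_a t *m mean x0 x t w + mean_B c *m ctrl_avg u t w) &
    mac T (fun t => mean y0 y t w - noise_mean t w)
      (fun t => mean_a t *m mean y0 y t w + mean_B c *m ctrl_avg v t w)]}.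
  by apply: ae_sub2 pu pv => w [_ [u0 au]] [_ [v0 av]]; split=> //; rewrite u0 v0.
pose Ndev i := lq_noise T (fun=> mA c) (mB c) (fun=> mQ c) (fun=> 0) (mR c) K
  (dev x i) (dev y i) (noise_dev i) (ctrl_dev u i) (ctrl_dev v i).
pose Nmean := lq_noise T mean_a (mean_B c) mean_q mean_N (mR c) Pi
  (mean x0 x) (mean y0 y) noise_mean (ctrl_avg u) (ctrl_avg v).
have cdev i : centered P (Ndev i).
  apply: (lq_noise_centered T_gt0 past_mono past_meas (mL1_cst T (mA c)) K_ric
    (noise_dev_noise i) (ctrl_dev_ctrl i cu) (ctrl_dev_ctrl i cv) _ _ (edev i)).
    by move=> k; exact: (dev_joint i jx k 0).
  by move=> k; exact: (dev_joint i jy k 0).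
have cmean : centered P Nmean.
  apply: (lq_noise_centered T_gt0 past_mono past_meas (mean_a_L1 c P0_L2 Pb_L2) Pi_ric
    noise_mean_noise (ctrl_avg_ctrl cu) (ctrl_avg_ctrl cv) _ _ emean).
    by move=> k; exact: (mean_joint jx0 jx k 0).
  by move=> k; exact: (mean_joint jy0 jy k 0).
have cN : centered P (fun w => 2 * (\sum_i Ndev i w + N%:R * Nmean w)).
  apply: centeredZ; apply: centeredD; first exact: centered_sum.
  exact: centeredZ.
have ledev i : {ae P, forall w,
    lq_cost T (fun=> mQ c) (fun=> 0) (mR c) (mH c) (dev x i ^~ w) (ctrl_dev u i ^~ w)
      + 2 * Ndev i w <=
    lq_cost T (fun=> mQ c) (fun=> 0) (mR c) (mH c) (dev y i ^~ w) (ctrl_dev v i ^~ w)}.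
  apply: (lq_cost_ge_noise T_gt0 (mL1_cst T (mQ c)) _ Rs Ru (H_psd hA2) _ _ K_ric
    (noise_dev_noise i) (ctrl_dev_ctrl i cv) (edev i)).
  - by apply: mbm_mL2; exact: mbm_cst.
  - by move=> t; exact: (Q_psd hA2).1.
  - move=> t z k tT; rewrite /lq_run /bil mulmx0 mul0mx mxE mulr0 addr0.
    by rewrite addr_ge0// ?(Q_psd hA2).2// (posdef_psd (Rw_posdef hA2)).2.
  - by move=> w t tT; exact: ctrl_dev_fb.
have lemean : {ae P, forall w,
    lq_cost T mean_q mean_N (mR c) (mean_h c) (mean x0 x ^~ w) (ctrl_avg u ^~ w)
      + 2 * Nmean w <=
    lq_cost T mean_q mean_N (mR c) (mean_h c) (mean y0 y ^~ w) (ctrl_avg v ^~ w)}.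
  apply: (lq_cost_ge_noise T_gt0 (mean_q_L1 c P0_L2 Pb_L2) (mean_N_L2 c P0_L2 Pb_L2)
    Rs Ru (psd_congr _ (H_psd hA2)) _ _ Pi_ric
    noise_mean_noise (ctrl_avg_ctrl cv) emean).
  - by move=> t; exact: mean_q_sym.
  - by move=> t z k tT; exact: mean_run_ge0.
  - by move=> w t tT; exact: ctrl_avg_fb.
have le_split : {ae P, forall w, split_cost c T P0 Pb u x0 x w
    + 2 * (\sum_i Ndev i w + N%:R * Nmean w) <= split_cost c T P0 Pb v y0 y w}.
  apply: ae_sub2 (ae_all_fin ledev) lemean => w hdev hmean; rewrite /split_cost.
  have -> : 2 * (\sum_i Ndev i w + N%:R * Nmean w) =
      \sum_i 2 * Ndev i w + N%:R * (2 * Nmean w) by rewrite -mulr_sumr; ring.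
  rewrite addrACA -big_split /= -mulrDr; apply: lerD; first exact: ler_sum.
  by rewrite ler_wpM2l.
rewrite !Jsoc_path_cost//; apply: (compare_expectation _ _ _ _ cN).
- exact: measurable_path_cost.
- by move=> w; exact: path_cost_ge0.
- exact: measurable_path_cost.
- by move=> w; exact: path_cost_ge0.
- have := path_cost_split v_Uc v_state; have := path_cost_split u_Uc u_state.
  move: le_split; apply: ae_sub3 => w le -> ->.
  by rewrite -EFinD lee_fin.
Qed.

End Optimality.

(** * Existence of the optimal trajectory *)

(** The equations of the deviations and of the mean pair are solved separately and the
    solutions are added. *)
Theorem feedback_exists : exists (x0 : R -> Om -> 'cV[R]_n) (x : 'I_N -> R -> Om -> 'cV[R]_n),
  let u := feedback_control c P0 Pb K Kb K0 x0 x in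
  Uc P T xi W u /\ state P c T xi W P0 Pb u x0 x.
Proof.
have N0_L2 : mL2 T (fun _ : R => 0 : 'M[R]_(m, n)) by apply: mbm_mL2; exact: mbm_cst.
have [z [gz z_0 cz az]] := closed_loop_exists T_gt0 past_mono past_meas
  (mean_a_L1 c P0_L2 Pb_L2) (mean_N_L2 c P0_L2 Pb_L2) Pi_ric
  noise_mean_noise.1 init_mean_good noise_mean0.
have /choice[e he] : forall i, exists e, [/\ vgood e, forall w, e 0 w = init_dev i w,
    ctrl (fun t w => dev_gain t *m e t w) &
    forall w, mac T (fun t => e t w - noise_dev i t w)
      (fun t => mA c *m e t w + mB c *m (- (dev_gain t *m e t w)))].
  move=> i; exact: (closed_loop_exists T_gt0 past_mono past_meas (mL1_cst T (mA c)) N0_L2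
    K_ric (noise_dev_noise i).1 (init_dev_good i) (noise_dev0 i)).
(* The average of the constructed states is the first component of [z] because the
   deviations sum to zero: their sum solves a homogeneous linear equation. *)
have sum_e w t : t \in `[0, T] -> \sum_i e i t w = 0.
  have LL : mL1 T (fun t => mA c - mB c *m dev_gain t).
    apply: mL1B; first exact: mL1_cst.
    apply: mL1Ml; first exact: mbm_cst.
    exact: (mL2_mL1 (lq_gain_L2 T_gt0 N0_L2 K_ric)).
  apply: (@linear_ode_unique _ T T_gt0 n _ LL 1%N (fun s => \sum_i e i s w)).
    have ae i : mac T (fun t => e i t w - noise_dev i t w)
      (fun t => mA c *m e i t w + mB c *m (- (dev_gain t *m e i t w))).
      by have [_ _ _] := he i.
    apply: (mac_eq T_gt0 _ _ (mac_sum T_gt0 ae)) => s _.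
      rewrite sumrB (_ : \sum_i noise_dev i s w = 0) ?subr0//.
      by rewrite -mulmx_sumr (sum_dev N_gt0 (fun i => W (Some i) s w)) mulmx0.
    rewrite mulmxBl !mulmx_sumr -sumrB.
    by apply: eq_bigr => i _; rewrite mulmxN !mulmxA.
  under eq_bigr => i _ do have [_ -> _ _] := he i.
  exact: (sum_dev N_gt0 (fun i => xi (Some i) w)).
pose x i t w := e i t w + usubmx (z t w).
pose x0 t w := dsubmx (z t w).
have average_x w t : t \in `[0, T] -> average x t w = usubmx (z t w).
  move=> tT; rewrite -[LHS]/(avg (fun i => e i t w + usubmx (z t w))).
  by rewrite avgD avg_cst// {1}/avg sum_e// scaler0 add0r.
have mean_x w t : t \in `[0, T] -> mean x0 x t w = z t w.
  by move=> tT; rewrite /mean average_x// vsubmxK.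
have dev_x i w t : t \in `[0, T] -> dev x i t w = e i t w.
  by move=> tT; rewrite /dev average_x// /x addrK.
exists x0, x => u.
have uE i t w : t \in `[0, T] ->
    u i t w = - (dev_gain t *m e i t w) - mean_fb t *m z t w.
  by move=> tT; rewrite /u feedback_split dev_x// mean_x.
have gx i : vgood (x i).
  move=> k; apply: (process_sub (Q := good P T past)
      (Y := fun t w => e i t w k 0 + z t w (lshift n k) 0)).
    by move=> t w; rewrite !mxE.
  have [ge _ _ _] := he i; apply: (goodD past_meas); [exact: ge|exact: gz].
have gx0 : vgood x0.
  move=> k; apply: (process_sub (Q := good P T past) (Y := fun t w => z t w (rshift n k) 0)).
    by move=> t w; rewrite !mxE.
  exact: gz.
have jgood p (X : R -> Om -> 'cV[R]_p) : vgood X -> mjoint X.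
  by move=> gX k l; rewrite ord1; exact: (good_joint past_meas (gX k)).
split.
  apply/Uc_ctrl => i; have [_ _ ce _] := he i.
  apply: (ctrl_eq (U := fun t w => (-1) *: (dev_gain t *m e i t w) - mean_fb t *m z t w)).
    by move=> t w tT; rewrite uE// scaleN1r.
  by apply: ctrlB => //; exact: ctrlZ.
have drift w t : t \in `[0, T] ->
    mean_a t *m z t w + mean_B c *m (- (mean_fb t *m z t w)) = col_mx
    (mA c *m average x t w + mB c *m (- (mean_fb t *m z t w)) + mG c *m average x t w
      + mF c *m x0 t w + mB1 c *m leader_control P0 Pb x0 x t w)
    (mA0 c *m x0 t w + mB0 c *m leader_control P0 Pb x0 x t w + mG0 c *m average x t w).
  by move=> tT; rewrite -mean_drift mean_x.
split.
- apply: mac_solves_sde; first exact: jgood.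
    by move=> w; rewrite /x0 z_0 /init_mean col_mxKd.
  move=> w; apply: (mac_eq T_gt0 _ _ (mac_dsub T_gt0 (az w))) => t tT.
    by rewrite linearB /= /noise_mean col_mxKd.
  by rewrite drift// col_mxKd.
- move=> i; apply: mac_solves_sde; first exact: jgood.
    move=> w; have [_ e0 _ _] := he i.
    by rewrite /x e0 z_0 /init_mean col_mxKu /init_dev subrK.
  move=> w; have [_ _ _ /(_ w) ae] := he i.
  apply: (mac_eq T_gt0 _ _ (macD T_gt0 ae (mac_usub T_gt0 (az w)))) => t tT.
    rewrite linearB /= /noise_mean col_mxKu /noise_dev /x.
    by mxabel.
  rewrite drift// col_mxKu uE// /x average_x//.
  by mxabel.
Qed.

End Feedback.

End Social.

Theorem theorem4p2 (R : realType) (dOm : measure_display)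
    (Om : measurableType dOm) (P : probability Om R)
    (n m d N : nat) (c : model R n m d) (T : R)
    (xi : option 'I_N -> Om -> 'cV[R]_n)
    (W : option 'I_N -> R -> Om -> 'cV[R]_d)
    (xibar : 'cV[R]_n) (c0 : R) (P0 Pb : R -> 'M[R]_(m, n))
    (T_gt0 : 0 < T) (N_gt0 : (0 < N)%N)
    (W_bm : forall a, brownian_motion P T (W a))
    (hA1 : assumptionA1 P T xi W xibar c0)
    (hA2 : assumptionA2 c) (hA4 : assumptionA4 c)
    (P0_L2 : mx_L2 T P0) (Pb_L2 : mx_L2 T Pb) :
  exists K Kb K0 Lam0 Lamb : R -> 'M[R]_n,
    [/\ riccati_system c T P0 Pb K Kb K0 Lam0 Lamb,
        forall K' Kb' K0' Lam0' Lamb' : R -> 'M[R]_n,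
          riccati_system c T P0 Pb K' Kb' K0' Lam0' Lamb' ->
          forall t, t \in `[0, T] ->
            [/\ K' t = K t, Kb' t = Kb t, K0' t = K0 t,
                Lam0' t = Lam0 t & Lamb' t = Lamb t]
      & exists (x0 : R -> Om -> 'cV[R]_n) (x : 'I_N -> R -> Om -> 'cV[R]_n)
               (u : 'I_N -> R -> Om -> 'cV[R]_m),
          (forall i t w, t \in `[0, T] ->
             u i t w = feedback_control c P0 Pb K Kb K0 x0 x i t w) /\
          solves_P3 P c T xi W P0 Pb u x0 x].
Proof.
have [K eK] := dev_riccati_exists T_gt0 hA2.
have [Pi ePi] := mean_riccati_exists T_gt0 hA2 hA4 P0_L2 Pb_L2.
pose Kb t := ulsubmx (Pi t) - K t.
pose K0 t := ursubmx (Pi t).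
pose Lamb t := dlsubmx (Pi t).
pose Lam0 t := drsubmx (Pi t).
have ric : riccati_system c T P0 Pb K Kb K0 Lam0 Lamb.
  apply: (riccati_systemP T_gt0 P0 Pb hA2 K Kb K0 Lam0 Lamb).2.
  have -> : (fun t => block_mx (K t + Kb t) (K0 t) (Lamb t) (Lam0 t)) = Pi.
    by apply/funext => t; rewrite /Kb addrC subrK submxK.
  exact: (conj eK ePi).
exists K, Kb, K0, Lam0, Lamb; split=> //.
  move=> K' Kb' K0' Lam0' Lamb' ric' t tT.
  exact: (riccati_system_unique T_gt0 hA2 P0_L2 Pb_L2 ric ric').
have [x0 [x [uU us]]] := feedback_exists T_gt0 N_gt0 W_bm hA1 hA2 P0_L2 Pb_L2 ric.
exists x0, x, (feedback_control c P0 Pb K Kb K0 x0 x).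
split; first by move=> i t w _.
split; [exact: uU|exact: us|move=> v y0 y vU vs].
exact: (feedback_optimal T_gt0 N_gt0 W_bm hA1 hA2 hA4 P0_L2 Pb_L2 ric uU us _ vU vs).
Qed.
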